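(* Let $f=f(\rho,u)$ be smooth and let $(\rho_0,u_0)\in C^1_b(\mathbb{R})\times C^2_b(\mathbb{R})$ with $\rho_0\ge 0$. Then there exists $T>0$ and a classical solution $(\rho,u)$ of system $(S_f)$ on $[0,T)$. Moreover $e=u_x+\rho\in C^1([0,T)\times\mathbb{R})$. Finally, the solution can be continued (as a classical solution with $u_x+\rho\in C^1$) beyond any time $T_1<\infty$ up to which $\|(\rho,u)(t,\cdot)\|_\infty$ and $\|\partial_x(\rho,u)(t,\cdot)\|_\infty$ stay bounded; equivalently, if $T^*<\infty$ is the maximal existence time then $\sup_{t<T^*}\big(\|\rho(t,\cdot)\|_\infty+\|u(t,\cdot)\|_\infty+\|\rho_x(t,\cdot)\|_\infty+\|u_x(t,\cdot)\|_\infty\big)=\infty$.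
   Context: Let $f$ be a smooth real function of $(\rho,u)\in\mathbb{R}^2$. System $(S_f)$ is: $\rho_t+(\rho f(\rho,u))_x=0$, $u_t+uu_x=\rho\,(f(\rho,u)-u)$ for $x\in\mathbb{R}$, $t>0$, with initial data $\rho(0,x)=\rho_0(x)\ge 0$, $u(0,x)=u_0(x)$. A classical solution on $[0,T)$ is a pair $\rho,u\in C^1([0,T)\times\mathbb{R})$ satisfying the equations pointwise and the initial data, such that $\rho,u,\rho_x,u_x$ are bounded on $[0,t]\times\mathbb{R}$ for every $t<T$. $C^k_b(\mathbb{R})$ denotes the bounded $C^k$ functions whose derivatives up to order $k$ are all bounded; $\|g\|_\infty=\sup_{x\in\mathbb{R}}|g(x)|$. We write $e:=u_x+\rho$ and $e_0:=u_0'+\rho_0$. The system may be only weakly hyperbolic (the eigenvalues $\rho f_\rho+f$ and $u$ of its coefficient matrix may coincide). *)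

(* Defs.v *)
From Stdlib Require Import Reals.
From Coquelicot Require Import Coquelicot.
Open Scope R_scope.

Definition cont2 (g : R -> R -> R) : Prop :=
  forall a b eps, 0 < eps -> exists delta, 0 < delta /\
    forall a' b', Rabs (a' - a) < delta -> Rabs (b' - b) < delta ->
      Rabs (g a' b' - g a b) < eps.

Fixpoint Ck2 (k : nat) (g : R -> R -> R) : Prop :=
  match k with
  | O => cont2 g
  | S k' => cont2 g /\ exists g1 g2 : R -> R -> R,
      (forall a b, is_derive (fun a0 => g a0 b) a (g1 a b)) /\
      (forall a b, is_derive (fun b0 => g a b0) b (g2 a b)) /\
      Ck2 k' g1 /\ Ck2 k' g2
  end.

Definition smooth2 (g : R -> R -> R) : Prop := forall k, Ck2 k g.

Definition bounded_fun (g : R -> R) : Prop :=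
  exists M, forall x, Rabs (g x) <= M.

Definition C1b (g : R -> R) : Prop :=
  exists g1 : R -> R,
    (forall x, is_derive g x (g1 x)) /\ (forall x, continuous g1 x) /\
    bounded_fun g /\ bounded_fun g1.

Definition C2b (g : R -> R) : Prop :=
  exists g1 g2 : R -> R,
    (forall x, is_derive g x (g1 x)) /\ (forall x, is_derive g1 x (g2 x)) /\
    (forall x, continuous g2 x) /\
    bounded_fun g /\ bounded_fun g1 /\ bounded_fun g2.

Definition in_strip (T t : R) : Prop := 0 <= t < T.

Definition cont_strip (T : R) (g : R -> R -> R) : Prop :=
  forall t x, in_strip T t -> forall eps, 0 < eps -> exists delta, 0 < delta /\
    forall t' x', in_strip T t' -> Rabs (t' - t) < delta -> Rabs (x' - x) < delta ->
      Rabs (g t' x' - g t x) < eps.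

(* partial derivative in t at (t,x), taken within [0,T)
   (one-sided at t = 0) *)
Definition has_dt (T : R) (g : R -> R -> R) (t x v : R) : Prop :=
  forall eps, 0 < eps -> exists delta, 0 < delta /\
    forall h, h <> 0 -> in_strip T (t + h) -> Rabs h < delta ->
      Rabs ((g (t + h) x - g t x) / h - v) < eps.

Definition C1_strip (T : R) (g : R -> R -> R) : Prop :=
  exists gt gx : R -> R -> R,
    (forall t x, in_strip T t -> has_dt T g t x (gt t x)) /\
    (forall t x, in_strip T t -> is_derive (g t) x (gx t x)) /\
    cont_strip T g /\ cont_strip T gt /\ cont_strip T gx.

Definition classical_solution (f : R -> R -> R) (rho0 u0 : R -> R) (T : R)
    (rho u : R -> R -> R) : Prop :=
  C1_strip T rho /\ C1_strip T u /\
  (forall t x, in_strip T t -> exists a b,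
     has_dt T rho t x a /\
     is_derive (fun y => rho t y * f (rho t y) (u t y)) x b /\
     a + b = 0) /\
  (forall t x, in_strip T t -> exists a b,
     has_dt T u t x a /\ is_derive (u t) x b /\
     a + u t x * b = rho t x * (f (rho t x) (u t x) - u t x)) /\
  (forall x, rho 0 x = rho0 x) /\ (forall x, u 0 x = u0 x) /\
  (forall t1, t1 < T -> exists M, forall t x, 0 <= t <= t1 ->
     Rabs (rho t x) <= M /\ Rabs (u t x) <= M /\
     Rabs (Derive (rho t) x) <= M /\ Rabs (Derive (u t) x) <= M).

Definition e_of (rho u : R -> R -> R) : R -> R -> R :=
  fun t x => Derive (u t) x + rho t x.

(* Main.v *)
(** Adding the x-derivative of the second equation to the first shows that e = u_x + rho
    satisfies e_t + u e_x = - e (e - rho).  Since u_x = e - rho, the triple (rho, u, e) solves a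
    diagonal system w_i,t + lam_i(w) w_i,x = src_i(w) with sources free of derivatives, for which
    weak hyperbolicity is harmless.

    The diagonal system is solved by the explicit scheme
    S_h w_i (x) = w_i (x - h lam_i(w x)) + h src_i(w x), iterated with steps h = 2^-n.  On a short
    time interval it preserves C^1 bounds, is Lipschitz stable in the sup norm and consistent to
    order h^2, so its iterates converge uniformly.  The x-derivatives of the iterates are
    equicontinuous on compact sets, which makes the limit C^1 in x; the estimate
    |w(t + s) - S_s w(t)| <= const s^2 then yields the time derivative and the equations.  The
    discrete defect u_x - e + rho obeys a linear recursion up to o(h), hence vanishes in the limit.

    Conversely a classical solution is tangent to the scheme, w(t + s) = S_s w(t) + o(s) locally
    uniformly.  A discrete Gronwall argument on cones of dependence gives uniqueness, and a bound on
    e_x in terms of the bounds on rho, u, rho_x, u_x.  The existence time from data at t0 < T1 is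
    therefore bounded below, and restarting close to T1 continues the solution. *)

Require Import Defs.
From Stdlib Require Import Reals ZArith Lra Lia FunctionalExtensionality.
From Coquelicot Require Import Coquelicot.
Open Scope R_scope.

(** * Functions of the state with locally Lipschitz gradient *)

(** The obstacle is a loss of derivatives. The flux puts rho f_u u_x into the first equation, so an
    estimate of rho_x asks for u_xx, while an estimate of u_xx from the second equation asks for
    rho_xx; when the eigenvalues coincide the coefficient matrix may be a Jordan block and no
    diagonalization helps. With e as a third unknown, u_xx occurs only through e_x, and C^1 bounds
    on (rho, u, e) close. This is why one derivative of rho0 but two of u0 are asked for. In the
    scheme the speed is frozen at the arrival point, so a step is an explicit formula and neither
    characteristic curves nor a fixed point have to be constructed. Gradients of the iterates grow
    quadratically, as in a Riccati equation, which limits the first existence time to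
    [/ (C * K * (K + 1))]. In the continuation argument the assumed bounds do not include e_x, on
    which that existence time depends. As e is only C^1, its equation cannot be differentiated; the
    bound on e_x comes from Lipschitz estimates along the scheme, and it is linear because e is
    transported with speed u, whose slope is bounded by assumption. *)

Inductive unknown := Rho | Vel | En.

Definition state := unknown -> R.

Definition at_pt (w : unknown -> R -> R) (x : R) : state := fun j => w j x.

Definition in_cube (B : R) (v : state) : Prop := forall j, Rabs (v j) <= B.

Definition close (d : R) (v v' : state) : Prop := forall j, Rabs (v j - v' j) <= d.

Lemma in_cube_nonneg (B : R) (v : state) : in_cube B v -> 0 <= B.
Proof. intros H; apply Rle_trans with (2 := H Rho); apply Rabs_pos. Qed.

Lemma close_nonneg (d : R) (v v' : state) : close d v v' -> 0 <= d.
Proof. intros H; apply Rle_trans with (2 := H Rho); apply Rabs_pos. Qed.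

Lemma Rabs_mult_le (a b A B : R) :
  Rabs a <= A -> Rabs b <= B -> Rabs (a * b) <= A * B.
Proof.
  intros Ha Hb; rewrite Rabs_mult.
  apply Rmult_le_compat; auto using Rabs_pos.
Qed.

Lemma Rabs_plus_le (a b A B : R) :
  Rabs a <= A -> Rabs b <= B -> Rabs (a + b) <= A + B.
Proof. intros Ha Hb; pose proof (Rabs_triang a b); lra. Qed.

Lemma Rabs_minus_le (a b A B : R) :
  Rabs a <= A -> Rabs b <= B -> Rabs (a - b) <= A + B.
Proof. intros Ha Hb; apply Rabs_plus_le; [|rewrite Rabs_Ropp]; auto. Qed.

Lemma mean_value (g g1 : R -> R) (a b : R) :
  (forall x, is_derive g x (g1 x)) ->
  exists c, Rmin a b <= c <= Rmax a b /\ g b - g a = g1 c * (b - a).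
Proof.
  intros H; apply MVT_gen; intros x _; auto.
  apply derivable_continuous_pt; exists (g1 x); apply is_derive_Reals; auto.
Qed.

(** A gradient is encoded by its directional derivatives [dphi v q] and characterized along curves
    of states, the form in which it acts on the x-derivative of a field. *)
Definition chain_rule (phi : state -> R) (dphi : state -> state -> R) : Prop :=
  forall w x q, (forall j, is_derive (w j) x (q j)) ->
    is_derive (fun y => phi (at_pt w y)) x (dphi (at_pt w x) q).

Definition additive_gradient (dphi : state -> state -> R) : Prop :=
  forall v q q', dphi v q - dphi v q' = dphi v (fun j => q j - q' j).

(** A single constant bounds the function, its gradient and the Lipschitz constant of the gradient
    on a cube, so that later estimates carry only [C]. *)
Definition bounds_on (B C : R) (phi : state -> R) (dphi : state -> state -> R) : Prop :=
  0 <= C /\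
  (forall v, in_cube B v -> Rabs (phi v) <= C) /\
  (forall v q d, in_cube B v -> in_cube d q -> Rabs (dphi v q) <= C * d) /\
  (forall v v' q d K, in_cube B v -> in_cube B v' -> close d v v' -> in_cube K q ->
     Rabs (dphi v q - dphi v' q) <= C * d * K).

Definition regular (phi : state -> R) (dphi : state -> state -> R) : Prop :=
  additive_gradient dphi /\ chain_rule phi dphi /\
  forall B, exists C, bounds_on B C phi dphi.

Lemma bounds_on_mono (B C C' : R) phi dphi :
  C <= C' -> bounds_on B C phi dphi -> bounds_on B C' phi dphi.
Proof.
  intros HC (H0 & H1 & H2 & H3); split; [lra|split; [|split]].
  - intros v Hv; specialize (H1 v Hv); lra.
  - intros v q d Hv Hq; specialize (H2 v q d Hv Hq).
    pose proof (in_cube_nonneg _ _ Hq); nra.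
  - intros v v' q d K Hv Hv' Hd Hq; specialize (H3 v v' q d K Hv Hv' Hd Hq).
    pose proof (in_cube_nonneg _ _ Hq); pose proof (close_nonneg _ _ _ Hd).
    assert (0 <= d * K) by nra; nra.
Qed.

(** Mean value theorem on the segment from [v'] to [v], which stays in the cube by convexity. It is
    stated with the gradient bound alone because [C1_lipschitz_2d] applies it before regularity is
    available. *)
Lemma lipschitz_of_gradient (B C d : R) phi dphi v v' :
  chain_rule phi dphi ->
  (forall v q d, in_cube B v -> in_cube d q -> Rabs (dphi v q) <= C * d) ->
  in_cube B v -> in_cube B v' -> close d v v' -> Rabs (phi v - phi v') <= C * d.
Proof.
  intros Hch Hb Hv Hv' Hd.
  set (w := fun j t => v' j + t * (v j - v' j)).
  assert (Hw : forall t j, is_derive (w j) t (v j - v' j)).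
  { intros t j; unfold w; auto_derive; [easy|ring]. }
  destruct (MVT_cor2 (fun t => phi (at_pt w t))
              (fun t => dphi (at_pt w t) (fun j => v j - v' j)) 0 1) as (c & Hc & Hc1).
  - lra.
  - intros t _; apply is_derive_Reals; apply Hch; auto.
  - replace (phi v - phi v') with (phi (at_pt w 1) - phi (at_pt w 0)).
    + rewrite Hc, Rminus_0_r, Rmult_1_r; apply Hb; auto.
      intros j; unfold at_pt, w.
      replace (v' j + c * (v j - v' j)) with (c * v j + (1 - c) * v' j) by ring.
      replace B with (c * B + (1 - c) * B) by ring.
      apply Rabs_plus_le; apply Rabs_mult_le; auto; rewrite Rabs_pos_eq; lra.
    + f_equal; f_equal; apply functional_extensionality; intros j;
        unfold at_pt, w; ring.
Qed.

Lemma regular_lipschitz (phi : state -> R) dphi B C d v v' :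
  chain_rule phi dphi -> bounds_on B C phi dphi ->
  in_cube B v -> in_cube B v' -> close d v v' -> Rabs (phi v - phi v') <= C * d.
Proof.
  intros Hch (_ & _ & Hb & _); apply lipschitz_of_gradient with (dphi := dphi); auto.
Qed.

Lemma regular_coord (j : unknown) : regular (fun v => v j) (fun _ q => q j).
Proof.
  split; [|split].
  - intros v q q'; ring.
  - intros w x q H; apply H.
  (* The summand 1 covers the gradient, which has norm 1; [Rabs] covers a negative [B]. *)
  - intros B; exists (Rabs B + 1); pose proof (Rabs_pos B).
    split; [lra|split; [|split]].
    + intros v Hv; specialize (Hv j); pose proof (Rle_abs B); lra.
    + intros v q d Hv Hq; pose proof (in_cube_nonneg _ _ Hq); specialize (Hq j); nra.
    + intros v v' q d K _ _ Hd Hq.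
      pose proof (in_cube_nonneg _ _ Hq); pose proof (close_nonneg _ _ _ Hd).
      assert (0 <= d * K) by nra.
      rewrite Rminus_diag, Rabs_R0; nra.
Qed.

Lemma regular_plus phi dphi psi dpsi :
  regular phi dphi -> regular psi dpsi ->
  regular (fun v => phi v + psi v) (fun v q => dphi v q + dpsi v q).
Proof.
  intros (L1 & C1 & B1) (L2 & C2 & B2); split; [|split].
  - intros v q q'; rewrite <- L1, <- L2; ring.
  - intros w x q H; apply (is_derive_plus (V := R_NormedModule)); auto.
  - intros B; destruct (B1 B) as (c1 & P1 & Q1 & R1 & S1).
    destruct (B2 B) as (c2 & P2 & Q2 & R2 & S2).
    exists (c1 + c2); split; [lra|split; [|split]].
    + intros v Hv; apply Rabs_plus_le; auto.
    + intros v q d Hv Hq; rewrite Rmult_plus_distr_r; apply Rabs_plus_le; auto.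
    + intros v v' q d K Hv Hv' Hd Hq.
      replace (dphi v q + dpsi v q - (dphi v' q + dpsi v' q))
        with ((dphi v q - dphi v' q) + (dpsi v q - dpsi v' q)) by ring.
      rewrite !Rmult_plus_distr_r; apply Rabs_plus_le; auto.
Qed.

Lemma regular_mult phi dphi psi dpsi :
  regular phi dphi -> regular psi dpsi ->
  regular (fun v => phi v * psi v) (fun v q => dphi v q * psi v + phi v * dpsi v q).
Proof.
  intros (L1 & C1 & B1) (L2 & C2 & B2); split; [|split].
  - intros v q q'; rewrite <- L1, <- L2; ring.
  - intros w x q H.
    apply (is_derive_mult (fun y => phi (at_pt w y)) (fun y => psi (at_pt w y))); auto.
    intros; apply Rmult_comm.
  - intros B; destruct (B1 B) as (c1 & P1 & Q1 & R1 & S1).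
    destruct (B2 B) as (c2 & P2 & Q2 & R2 & S2).
    assert (T1 := fun v v' d => regular_lipschitz phi dphi B c1 d v v' C1
              (conj P1 (conj Q1 (conj R1 S1)))).
    assert (T2 := fun v v' d => regular_lipschitz psi dpsi B c2 d v v' C2
              (conj P2 (conj Q2 (conj R2 S2)))).
    assert (P12 : 0 <= c1 * c2) by (apply Rmult_le_pos; auto).
    (* The difference of two gradients of a product splits into four terms, each at most
       [c1 * c2 * d * K]. *)
    exists (4 * (c1 * c2)); split; [lra|split; [|split]].
    + intros v Hv; apply Rle_trans with (c1 * c2); [apply Rabs_mult_le; auto|lra].
    + intros v q d Hv Hq; pose proof (in_cube_nonneg _ _ Hq).
      apply Rle_trans with (c1 * d * c2 + c1 * (c2 * d)).
      * apply Rabs_plus_le; apply Rabs_mult_le; auto.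
      * assert (0 <= c1 * c2 * d) by nra; nra.
    + intros v v' q d K Hv Hv' Hd Hq.
      pose proof (in_cube_nonneg _ _ Hq); pose proof (close_nonneg _ _ _ Hd).
      replace (dphi v q * psi v + phi v * dpsi v q - (dphi v' q * psi v' + phi v' * dpsi v' q))
        with (((dphi v q - dphi v' q) * psi v + dphi v' q * (psi v - psi v'))
              + ((phi v - phi v') * dpsi v q + phi v' * (dpsi v q - dpsi v' q))) by ring.
      apply Rle_trans with
        ((c1 * d * K * c2 + c1 * K * (c2 * d)) + (c1 * d * (c2 * K) + c1 * (c2 * d * K))).
      * repeat apply Rabs_plus_le; apply Rabs_mult_le; auto.
      * right; ring.
Qed.

Lemma regular_minus phi dphi psi dpsi :
  regular phi dphi -> regular psi dpsi ->
  regular (fun v => phi v - psi v) (fun v q => dphi v q - dpsi v q).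
Proof.
  intros (L1 & C1 & B1) (L2 & C2 & B2); split; [|split].
  - intros v q q'; rewrite <- L1, <- L2; ring.
  - intros w x q H; apply (is_derive_minus (V := R_NormedModule)); auto.
  - intros B; destruct (B1 B) as (c1 & P1 & Q1 & R1 & S1).
    destruct (B2 B) as (c2 & P2 & Q2 & R2 & S2).
    exists (c1 + c2); split; [lra|split; [|split]].
    + intros v Hv; apply Rabs_minus_le; auto.
    + intros v q d Hv Hq; rewrite Rmult_plus_distr_r; apply Rabs_minus_le; auto.
    + intros v v' q d K Hv Hv' Hd Hq.
      replace (dphi v q - dpsi v q - (dphi v' q - dpsi v' q))
        with ((dphi v q - dphi v' q) - (dpsi v q - dpsi v' q)) by ring.
      rewrite !Rmult_plus_distr_r; apply Rabs_minus_le; auto.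
Qed.

Lemma regular_opp phi dphi :
  regular phi dphi -> regular (fun v => - phi v) (fun v q => - dphi v q).
Proof.
  intros (L1 & C1 & B1); split; [|split].
  - intros v q q'; rewrite <- L1; ring.
  - intros w x q H; apply (is_derive_opp (V := R_NormedModule)); auto.
  - intros B; destruct (B1 B) as (c1 & P1 & Q1 & R1 & S1).
    exists c1; split; [lra|split; [|split]].
    + intros v Hv; rewrite Rabs_Ropp; auto.
    + intros v q d Hv Hq; rewrite Rabs_Ropp; auto.
    + intros v v' q d K Hv Hv' Hd Hq.
      replace (- dphi v q - - dphi v' q) with (- (dphi v q - dphi v' q)) by ring.
      rewrite Rabs_Ropp; auto.
Qed.

(** * Functions of two real variables: boundedness on squares and the chain rule *)

Lemma cont2_continuity_2d (g : R -> R -> R) (a b : R) : cont2 g -> continuity_2d_pt g a b.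
Proof.
  intros H eps; destruct (H a b eps (cond_pos eps)) as (d & Hd & Hc).
  exists (mkposreal d Hd); auto.
Qed.

Lemma cont2_unif (g : R -> R -> R) (a b c d eps : R) :
  cont2 g -> 0 < eps -> exists delta, 0 < delta /\
    forall x y u v, a <= x <= b -> c <= y <= d -> a <= u <= b -> c <= v <= d ->
      Rabs (u - x) < delta -> Rabs (v - y) < delta -> Rabs (g u v - g x y) < eps.
Proof.
  intros Hg He.
  destruct (uniform_continuity_2d g a b c d) with (eps := mkposreal eps He) as (dl & Hd).
  - intros; apply cont2_continuity_2d; auto.
  - exists dl; split; [apply cond_pos|exact Hd].
Qed.

(** By uniform continuity [g] changes by less than 1 over distances below some [dl]. Walking from
    the origin to the point in [N] equal steps shorter than [dl] changes [g] by at most [N]. *)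
Lemma cont2_bounded (g : R -> R -> R) (B : R) :
  cont2 g -> exists C, 0 <= C /\ forall a b, Rabs a <= B -> Rabs b <= B -> Rabs (g a b) <= C.
Proof.
  intros Hg.
  destruct (Rle_dec 0 B) as [HB|HB].
  2: { exists 0; split; [lra|]; intros a b Ha; pose proof (Rabs_pos a); lra. }
  destruct (cont2_unif g (-B) B (-B) B 1 Hg Rlt_0_1) as (dl & Hdl & Hu).
  destruct (nfloor_ex (B / dl)) as (n & _ & Hn).
  { apply Rle_div_r; lra. }
  rewrite <- S_INR in Hn; set (N := S n) in *.
  assert (HN : 0 < INR N) by (apply lt_0_INR; unfold N; lia).
  assert (HBN : B / INR N < dl).
  { apply Rlt_div_l; [lra|]; apply Rlt_div_l in Hn; lra. }
  exists (Rabs (g 0 0) + INR N); split.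
  { pose proof (Rabs_pos (g 0 0)); lra. }
  intros a b Ha Hb.
  assert (Hstep : forall k, (k <= N)%nat ->
     Rabs (g (INR k * (a / INR N)) (INR k * (b / INR N)) - g 0 0) <= INR k).
  { assert (Hin : forall c k, Rabs c <= B -> (k <= N)%nat -> -B <= INR k * (c / INR N) <= B).
    { intros c k Hc Hk; apply Rabs_le_between.
      apply le_INR in Hk; pose proof (pos_INR k).
      replace (INR k * (c / INR N)) with ((INR k / INR N) * c) by (field; lra).
      apply Rle_trans with (1 * B); [|lra].
      apply Rabs_mult_le; auto.
      rewrite Rabs_pos_eq; [apply Rle_div_l; lra|apply Rle_div_r; lra]. }
    assert (Hd : forall c k, Rabs c <= B ->
       Rabs (INR (S k) * (c / INR N) - INR k * (c / INR N)) < dl).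
    { intros c k Hc; rewrite S_INR.
      replace ((INR k + 1) * (c / INR N) - INR k * (c / INR N)) with (c / INR N) by ring.
      unfold Rdiv; rewrite Rabs_mult, (Rabs_pos_eq (/ _)).
      - apply Rle_lt_trans with (2 := HBN).
        apply Rmult_le_compat_r; auto; left; apply Rinv_0_lt_compat; auto.
      - left; apply Rinv_0_lt_compat; auto. }
    induction k as [|k IH]; intros Hk.
    - simpl; rewrite !Rmult_0_l, Rminus_diag, Rabs_R0; lra.
    - assert (H1 := Hu _ _ _ _ (Hin a k Ha ltac:(lia)) (Hin b k Hb ltac:(lia))
        (Hin a (S k) Ha Hk) (Hin b (S k) Hb Hk) (Hd a k Ha) (Hd b k Hb)).
      specialize (IH ltac:(lia)).
      rewrite (S_INR k) at 3.
      match goal with |- Rabs (?u - ?w) <= _ =>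
        match type of H1 with Rabs (u - ?v) < _ =>
          replace (u - w) with ((v - w) + (u - v)) by ring end end.
      apply Rabs_plus_le; lra. }
  specialize (Hstep N (le_n _)).
  replace (INR N * (a / INR N)) with a in Hstep by (field; lra).
  replace (INR N * (b / INR N)) with b in Hstep by (field; lra).
  replace (g a b) with (g 0 0 + (g a b - g 0 0)) by ring.
  apply Rabs_plus_le; lra.
Qed.

(** Two partial derivatives, one of them continuous, make [g] differentiable as a function of the
    pair. *)
Lemma chain_rule_2d (g g1 g2 : R -> R -> R) (a b : R -> R) (x a' b' : R) :
  (forall c d, is_derive (fun c0 => g c0 d) c (g1 c d)) ->
  (forall c d, is_derive (fun d0 => g c d0) d (g2 c d)) ->
  cont2 g1 -> is_derive a x a' -> is_derive b x b' ->
  is_derive (fun y => g (a y) (b y)) x (g1 (a x) (b x) * a' + g2 (a x) (b x) * b').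
Proof.
  intros H1 H2 Hc Ha Hb.
  assert (Hf := is_derive_filterdiff g (a x) (b x) g1 (g2 (a x) (b x))).
  assert (Hg : filterdiff (fun u : R * R => g (fst u) (snd u)) (locally (a x, b x))
      (fun u : R * R => plus (scal (fst u) (g1 (a x) (b x))) (scal (snd u) (g2 (a x) (b x))))).
  { apply Hf; auto.
    - apply filter_forall; intros [u v]; apply H1.
    - intros P [eps HP].
      destruct (Hc (a x) (b x) eps (cond_pos eps)) as (d & Hd & Hcd).
      exists (mkposreal d Hd); intros [u v] [Hu Hv]; apply HP; apply Hcd; [apply Hu|apply Hv]. }
  apply filterdiff_differentiable_pt_lim in Hg.
  apply is_derive_Reals; apply derivable_pt_lim_comp_2d; auto; apply is_derive_Reals; auto.
Qed.

Lemma C1_lipschitz_2d (g g1 g2 : R -> R -> R) (B : R) :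
  (forall c d, is_derive (fun c0 => g c0 d) c (g1 c d)) ->
  (forall c d, is_derive (fun d0 => g c d0) d (g2 c d)) ->
  cont2 g1 -> cont2 g2 ->
  exists C, 0 <= C /\ forall v v' d, in_cube B v -> in_cube B v' -> close d v v' ->
    Rabs (g (v Rho) (v Vel) - g (v' Rho) (v' Vel)) <= C * d.
Proof.
  intros H1 H2 K1 K2.
  destruct (cont2_bounded g1 B K1) as (c1 & P1 & Q1).
  destruct (cont2_bounded g2 B K2) as (c2 & P2 & Q2).
  exists (c1 + c2); split; [lra|]; intros v v' d Hv Hv' Hd.
  apply (lipschitz_of_gradient B (c1 + c2) d (fun v => g (v Rho) (v Vel))
           (fun v q => g1 (v Rho) (v Vel) * q Rho + g2 (v Rho) (v Vel) * q Vel)); auto.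
  - intros w x q Hq; apply (chain_rule_2d g g1 g2 (w Rho) (w Vel)); auto.
  - intros u q e Hu Hq; rewrite Rmult_plus_distr_r.
    apply Rabs_plus_le; apply Rabs_mult_le; auto.
Qed.

(** The Lipschitz bound on the gradient comes from bounded second partial derivatives. *)
Lemma regular_Ck2 (g g1 g2 : R -> R -> R) :
  cont2 g ->
  (forall c d, is_derive (fun c0 => g c0 d) c (g1 c d)) ->
  (forall c d, is_derive (fun d0 => g c d0) d (g2 c d)) ->
  Ck2 1 g1 -> Ck2 1 g2 ->
  regular (fun v => g (v Rho) (v Vel))
    (fun v q => g1 (v Rho) (v Vel) * q Rho + g2 (v Rho) (v Vel) * q Vel).
Proof.
  intros Hg H1 H2 (K1 & g11 & g12 & H11 & H12 & K11 & K12) (K2 & g21 & g22 & H21 & H22 & K21 & K22).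
  split; [|split].
  - intros v q q'; ring.
  - intros w x q Hq; apply (chain_rule_2d g g1 g2 (w Rho) (w Vel)); auto.
  - intros B.
    destruct (cont2_bounded g B Hg) as (c0 & P0 & Q0).
    destruct (cont2_bounded g1 B K1) as (c1 & P1 & Q1).
    destruct (cont2_bounded g2 B K2) as (c2 & P2 & Q2).
    destruct (C1_lipschitz_2d g1 g11 g12 B) as (c3 & P3 & Q3); auto.
    destruct (C1_lipschitz_2d g2 g21 g22 B) as (c4 & P4 & Q4); auto.
    exists (c0 + (c1 + c2) + (c3 + c4)); split; [lra|split; [|split]].
    + intros v Hv; specialize (Q0 _ _ (Hv Rho) (Hv Vel)); lra.
    + intros v q d Hv Hq; pose proof (in_cube_nonneg _ _ Hq).
      apply Rle_trans with (c1 * d + c2 * d); [|nra].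
      apply Rabs_plus_le; apply Rabs_mult_le; auto.
    + intros v v' q d K Hv Hv' Hd Hq.
      pose proof (in_cube_nonneg _ _ Hq); pose proof (close_nonneg _ _ _ Hd).
      match goal with |- Rabs ?e <= _ =>
        replace e with ((g1 (v Rho) (v Vel) - g1 (v' Rho) (v' Vel)) * q Rho
                      + (g2 (v Rho) (v Vel) - g2 (v' Rho) (v' Vel)) * q Vel) by ring end.
      apply Rle_trans with (c3 * d * K + c4 * d * K).
      * apply Rabs_plus_le; apply Rabs_mult_le; auto.
      * assert (0 <= d * K) by nra; nra.
Qed.

(** * The time-stepping scheme for a diagonal system *)

(* The bound for a sequence with a_0 <= c and a_{k+1} <= (1 + h A) a_k + h b, at time t = k h. *)
Definition growth (A c b t : R) : R := exp (A * t) * (c + t * b).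

Lemma growth_0 (A c b : R) : growth A c b 0 = c.
Proof. unfold growth; rewrite Rmult_0_r, exp_0; ring. Qed.

(** Uses [1 + h * A <= exp (A * h)] for the first term and the fact that the exponential factor is
    at least 1 for the second. *)
Lemma growth_step (A c b t h : R) :
  0 <= A -> 0 <= c -> 0 <= b -> 0 <= t -> 0 <= h ->
  (1 + h * A) * growth A c b t + h * b <= growth A c b (t + h).
Proof.
  intros HA Hc Hb Ht Hh; unfold growth.
  replace (A * (t + h)) with (A * t + A * h) by ring; rewrite exp_plus.
  pose proof (exp_ineq1_le (A * h)) as H1.
  pose proof (exp_ineq1_le (A * t)) as H2.
  assert (0 <= A * t) by nra. assert (0 <= A * h) by nra.
  assert (0 <= t * b) by nra. assert (0 <= h * b) by nra.
  set (E := exp (A * t)) in *; set (F := exp (A * h)) in *.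
  assert ((1 + h * A) * (E * (c + t * b)) <= F * (E * (c + t * b))).
  { apply Rmult_le_compat_r; [apply Rmult_le_pos; lra|lra]. }
  assert (1 * (h * b) <= E * F * (h * b)) by (apply Rmult_le_compat_r; nra).
  lra.
Qed.

Lemma growth_nonneg (A c b t : R) : 0 <= c -> 0 <= b -> 0 <= t -> 0 <= growth A c b t.
Proof.
  intros; unfold growth; apply Rmult_le_pos; [left; apply exp_pos|].
  assert (0 <= t * b) by nra; lra.
Qed.

Lemma growth_mono (A c b t t' : R) :
  0 <= A -> 0 <= c -> 0 <= b -> 0 <= t <= t' -> growth A c b t <= growth A c b t'.
Proof.
  intros; unfold growth; apply Rmult_le_compat; [left; apply exp_pos| | |nra].
  - assert (0 <= t * b) by nra; lra.
  - destruct (Req_dec (A * t) (A * t')) as [->|]; [lra|].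
    left; apply exp_increasing; nra.
Qed.

Record diagonal_system := {
  lam : unknown -> state -> R;
  src : unknown -> state -> R;
  dlam : unknown -> state -> state -> R;
  dsrc : unknown -> state -> state -> R;
  lam_regular : forall i, regular (lam i) (dlam i);
  src_regular : forall i, regular (src i) (dsrc i) }.

Definition system_bounds (S : diagonal_system) (B C : R) : Prop :=
  forall i, bounds_on B C (lam S i) (dlam S i) /\ bounds_on B C (src S i) (dsrc S i).

Lemma ex_system_bounds (S : diagonal_system) (B : R) :
  exists C, 0 < C /\ system_bounds S B C.
Proof.
  assert (H : forall i, exists C, 0 < C /\ forall C', C <= C' ->
    bounds_on B C' (lam S i) (dlam S i) /\ bounds_on B C' (src S i) (dsrc S i)).
  { intros i.
    destruct (lam_regular S i) as (_ & _ & H1); destruct (H1 B) as (c1 & P1).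
    destruct (src_regular S i) as (_ & _ & H2); destruct (H2 B) as (c2 & P2).
    pose proof (proj1 P1); pose proof (proj1 P2).
    exists (c1 + c2 + 1); split; [lra|intros C' HC; split].
    - apply bounds_on_mono with (2 := P1); lra.
    - apply bounds_on_mono with (2 := P2); lra. }
  destruct (H Rho) as (c1 & p1 & H1); destruct (H Vel) as (c2 & p2 & H2);
    destruct (H En) as (c3 & p3 & H3).
  exists (c1 + c2 + c3); split; [lra|].
  intros []; [apply H1|apply H2|apply H3]; lra.
Qed.

Definition field := unknown -> R -> R.

Definition bounded_by (b : R) (w : field) : Prop := forall x, in_cube b (at_pt w x).

Definition lipschitz (K : R) (w : field) : Prop :=
  forall i x y, Rabs (w i x - w i y) <= K * Rabs (x - y).

Definition derivative_of (w p : field) : Prop := forall i x, is_derive (w i) x (p i x).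

Lemma derivative_lipschitz (K : R) (w p : field) :
  derivative_of w p -> bounded_by K p -> lipschitz K w.
Proof.
  intros Hd Hb i x y.
  destruct (mean_value (w i) (p i) y x (Hd i)) as (c & _ & ->).
  apply Rabs_mult_le; [apply (Hb c i)|lra].
Qed.

Section Scheme.

Context (S : diagonal_system) (B C K : R).
Context (Hbd : system_bounds S B C) (HC : 0 < C) (HK : 1 <= K).

(** Where the straight characteristic arriving at [x] starts, its speed being evaluated at [x]
    itself. *)
Definition foot (h : R) (w : field) (i : unknown) (x : R) : R := x - h * lam S i (at_pt w x).

Definition step (h : R) (w : field) : field :=
  fun i x => w i (foot h w i x) + h * src S i (at_pt w x).

(* The x-derivative of [step h w] when [p] is that of [w]. *)
Definition dstep (h : R) (w p : field) : field :=
  fun i x => p i (foot h w i x) * (1 - h * dlam S i (at_pt w x) (at_pt p x))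
             + h * dsrc S i (at_pt w x) (at_pt p x).

Fixpoint approx (h : R) (k : nat) (w : field) : field :=
  match k with O => w | Datatypes.S k' => step h (approx h k' w) end.

Fixpoint dapprox (h : R) (k : nat) (w p : field) : field :=
  match k with O => p | Datatypes.S k' => dstep h (approx h k' w) (dapprox h k' w p) end.

Lemma lam_le (i : unknown) (v : state) : in_cube B v -> Rabs (lam S i v) <= C.
Proof. apply (proj1 (Hbd i)). Qed.

Lemma src_le (i : unknown) (v : state) : in_cube B v -> Rabs (src S i v) <= C.
Proof. apply (proj2 (Hbd i)). Qed.

Lemma lam_lip (i : unknown) (v v' : state) (d : R) :
  in_cube B v -> in_cube B v' -> close d v v' -> Rabs (lam S i v - lam S i v') <= C * d.
Proof.
  apply regular_lipschitz with (dphi := dlam S i); [apply lam_regular|apply Hbd].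
Qed.

Lemma src_lip (i : unknown) (v v' : state) (d : R) :
  in_cube B v -> in_cube B v' -> close d v v' -> Rabs (src S i v - src S i v') <= C * d.
Proof.
  apply regular_lipschitz with (dphi := dsrc S i); [apply src_regular|apply Hbd].
Qed.

Lemma dlam_le (i : unknown) (v q : state) (d : R) :
  in_cube B v -> in_cube d q -> Rabs (dlam S i v q) <= C * d.
Proof. apply (proj1 (Hbd i)). Qed.

Lemma dsrc_le (i : unknown) (v q : state) (d : R) :
  in_cube B v -> in_cube d q -> Rabs (dsrc S i v q) <= C * d.
Proof. apply (proj2 (Hbd i)). Qed.

Lemma gradient_diff (phi : state -> R) dphi (v v' q q' : state) (d e : R) :
  additive_gradient dphi -> bounds_on B C phi dphi ->
  in_cube B v -> in_cube B v' -> in_cube K q -> close d v v' -> close e q q' ->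
  Rabs (dphi v q - dphi v' q') <= C * (d * K + e).
Proof.
  intros Hsub (_ & _ & H2 & H3) Hv Hv' Hq Hd He.
  replace (dphi v q - dphi v' q') with ((dphi v q - dphi v' q) + (dphi v' q - dphi v' q')) by ring.
  rewrite Hsub.
  replace (C * (d * K + e)) with (C * d * K + C * e) by ring.
  apply Rabs_plus_le; auto.
Qed.

Lemma foot_close (h : R) (w : field) (i : unknown) (x : R) :
  0 <= h -> bounded_by B w -> Rabs (foot h w i x - x) <= h * C.
Proof.
  intros Hh Hw; unfold foot.
  replace (x - h * lam S i (at_pt w x) - x) with (- (h * lam S i (at_pt w x))) by ring.
  rewrite Rabs_Ropp; apply Rabs_mult_le; [rewrite Rabs_pos_eq; lra|apply lam_le, Hw].
Qed.

Lemma foot_in (h : R) (w : field) (i : unknown) (x r : R) :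
  0 <= h -> bounded_by B w -> Rabs x <= r - h * C -> Rabs (foot h w i x) <= r.
Proof.
  intros Hh Hw Hx; pose proof (foot_close h w i x Hh Hw).
  replace (foot h w i x) with (x + (foot h w i x - x)) by ring.
  replace r with ((r - h * C) + h * C) by ring; apply Rabs_plus_le; auto.
Qed.

Lemma foot_lip (h : R) (w : field) (i : unknown) (x y : R) :
  0 <= h -> bounded_by B w -> lipschitz K w ->
  Rabs (foot h w i x - foot h w i y) <= Rabs (x - y) * (1 + h * (C * K)).
Proof.
  intros Hh Hw Hl; unfold foot.
  match goal with |- Rabs ?e <= _ => replace e with
    ((x - y) - h * (lam S i (at_pt w x) - lam S i (at_pt w y))) by ring end.
  replace (Rabs (x - y) * (1 + h * (C * K)))
    with (Rabs (x - y) + h * (C * (K * Rabs (x - y)))) by ring.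
  apply Rabs_minus_le; [lra|].
  apply Rabs_mult_le; [rewrite Rabs_pos_eq; lra|].
  apply lam_lip; auto; intros j; apply Hl.
Qed.

Lemma step_bounded (h b : R) (w : field) :
  0 <= h -> b <= B -> bounded_by b w -> bounded_by (b + h * C) (step h w).
Proof.
  intros Hh Hb Hw x i; unfold at_pt at 1, step.
  apply Rabs_plus_le; [apply (Hw _ i)|].
  apply Rabs_mult_le; [rewrite Rabs_pos_eq; lra|apply src_le].
  intros j; specialize (Hw x j); lra.
Qed.

Lemma step_derivative (h : R) (w p : field) :
  derivative_of w p -> derivative_of (step h w) (dstep h w p).
Proof.
  intros Hd i x; unfold step, dstep.
  apply (is_derive_plus (V := R_NormedModule)).
  - assert (Hf : is_derive (foot h w i) x (1 - h * dlam S i (at_pt w x) (at_pt p x))).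
    { unfold foot.
      apply (is_derive_minus (V := R_NormedModule) (fun y => y)).
      - apply (is_derive_id (K := R_AbsRing)).
      - apply (is_derive_scal (fun y => lam S i (at_pt w y))).
        apply lam_regular; intros j; apply Hd. }
    rewrite Rmult_comm.
    apply (is_derive_comp (V := R_NormedModule) (w i) (foot h w i)); auto.
  - apply (is_derive_scal (fun y => src S i (at_pt w y))).
    apply src_regular; intros j; apply Hd.
Qed.

(** The exact increment is [h * C * (b * b + b)], of Riccati type; inserting the cap [b <= K] makes
    it linear in [h]. *)
Lemma dstep_bounded (h b : R) (w p : field) :
  0 <= h -> 0 <= b <= K -> bounded_by B w -> bounded_by b p ->
  bounded_by (b + h * (C * K * (K + 1))) (dstep h w p).
Proof.
  intros Hh Hb Hw Hp x i; unfold at_pt at 1, dstep.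
  assert (H1 : Rabs (h * dlam S i (at_pt w x) (at_pt p x)) <= h * (C * b)).
  { apply Rabs_mult_le; [rewrite Rabs_pos_eq; lra|apply dlam_le; auto]. }
  assert (H2 : Rabs (h * dsrc S i (at_pt w x) (at_pt p x)) <= h * (C * b)).
  { apply Rabs_mult_le; [rewrite Rabs_pos_eq; lra|apply dsrc_le; auto]. }
  apply Rle_trans with (b * (1 + h * (C * b)) + h * (C * b)).
  - apply Rabs_plus_le; auto.
    apply Rabs_mult_le; [apply (Hp _ i)|].
    apply Rabs_minus_le; auto; rewrite Rabs_R1; lra.
  - assert (0 <= h * C) by nra.
    assert (b * b + b <= K * (K + 1)) by nra.
    replace (b * (1 + h * (C * b)) + h * (C * b)) with (b + h * C * (b * b + b)) by ring.
    replace (h * (C * K * (K + 1))) with (h * C * (K * (K + 1))) by ring.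
    apply Rplus_le_compat_l, Rmult_le_compat_l; auto.
Qed.

Lemma approx_add (h : R) (m k : nat) (w : field) :
  approx h (m + k) w = approx h m (approx h k w).
Proof. induction m as [|m IH]; simpl; congruence. Qed.

Definition good (w : field) : Prop := bounded_by B w /\ lipschitz K w.

(** Both fields are compared at the foot belonging to [v]; moving [w] there costs its Lipschitz
    constant. Closeness is asked at [x] and at that foot only, so that the estimate works globally
    and also inside cones of dependence. *)
Lemma step_stable (h d : R) (w v : field) (i : unknown) (x : R) :
  0 <= h -> good w -> good v ->
  close d (at_pt w x) (at_pt v x) ->
  Rabs (w i (foot h v i x) - v i (foot h v i x)) <= d ->
  Rabs (step h w i x - step h v i x) <= (1 + h * (C * (K + 1))) * d.
Proof.
  intros Hh [Hw Lw] [Hv Lv] Hd Hd'; unfold step.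
  replace ((1 + h * (C * (K + 1))) * d) with (K * (h * (C * d)) + d + h * (C * d)) by ring.
  match goal with |- Rabs ?e <= _ => replace e with
   ((w i (foot h w i x) - w i (foot h v i x)) + (w i (foot h v i x) - v i (foot h v i x))
    + h * (src S i (at_pt w x) - src S i (at_pt v x))) by ring end.
  apply Rabs_plus_le; [apply Rabs_plus_le; auto|].
  - eapply Rle_trans; [apply Lw|].
    apply Rmult_le_compat_l; [lra|].
    unfold foot.
    match goal with |- Rabs ?e <= _ => replace e with
      (- (h * (lam S i (at_pt w x) - lam S i (at_pt v x)))) by ring end.
    rewrite Rabs_Ropp; apply Rabs_mult_le; [rewrite Rabs_pos_eq; lra|].
    apply lam_lip; auto.
  - apply Rabs_mult_le; [rewrite Rabs_pos_eq; lra|].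
    apply src_lip; auto.
Qed.

Lemma step_time_lip (h : R) (w : field) (i : unknown) (x : R) :
  0 <= h -> good w -> Rabs (step h w i x - w i x) <= h * (C * (K + 1)).
Proof.
  intros Hh [Hw Lw]; unfold step.
  replace (w i (foot h w i x) + h * src S i (at_pt w x) - w i x)
    with ((w i (foot h w i x) - w i x) + h * src S i (at_pt w x)) by ring.
  replace (h * (C * (K + 1))) with (K * (h * C) + h * C) by ring.
  apply Rabs_plus_le.
  - eapply Rle_trans; [apply Lw|].
    apply Rmult_le_compat_l; [lra|apply foot_close; auto].
  - apply Rabs_mult_le; [rewrite Rabs_pos_eq; lra|apply src_le; auto].
Qed.

Lemma approx_time_lip (h : R) (m : nat) (w : field) :
  0 <= h -> (forall j, (j < m)%nat -> good (approx h j w)) ->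
  forall i x, Rabs (approx h m w i x - w i x) <= INR m * h * (C * (K + 1)).
Proof.
  intros Hh; induction m as [|m IH]; intros Hg i x.
  - simpl; rewrite Rminus_diag, Rabs_R0; lra.
  - rewrite S_INR; simpl approx.
    replace (step h (approx h m w) i x - w i x) with
      ((step h (approx h m w) i x - approx h m w i x) + (approx h m w i x - w i x)) by ring.
    replace ((INR m + 1) * h * (C * (K + 1)))
      with (h * (C * (K + 1)) + INR m * h * (C * (K + 1))) by ring.
    apply Rabs_plus_le; [apply step_time_lip; auto|apply IH; auto].
Qed.

(** In the induction below, the displacement of feet contributes [K * (2 * K + 1)] and the two
    source terms contribute [2 * K + 1], both times [C * C]. *)
Definition consistency : R := C * C * ((2 * K + 1) * (K + 1)).

Lemma consistency_pos : 0 < consistency.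
Proof. unfold consistency; repeat apply Rmult_lt_0_compat; lra. Qed.

(** During [m] steps the coefficients drift by O(m h), so the next step adds an error O(m h * h),
    which the increase of the square from [m] to [m + 1] absorbs. The constant does not depend on
    [m]. *)
Lemma approx_consistent (h : R) (m : nat) (w : field) :
  0 <= h -> (forall j, (j <= m)%nat -> good (approx h j w)) ->
  forall i x, Rabs (approx h m w i x - step (INR m * h) w i x) <= consistency * (INR m * h) ^ 2.
Proof.
  intros Hh; induction m as [|m IH]; intros Hg i x.
  - unfold step, foot; simpl; rewrite !Rmult_0_l, Rminus_0_r, Rplus_0_r, Rminus_diag, Rabs_R0; lra.
  - assert (Hw : good w) by (apply (Hg O); lia).
    assert (Hv : good (approx h m w)) by (apply Hg; lia).
    assert (Htl := approx_time_lip h m w Hh (fun j Hj => Hg j ltac:(lia))).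
    specialize (IH (fun j Hj => Hg j (le_S _ _ Hj))).
    rewrite S_INR; simpl approx.
    pose proof (pos_INR m) as Hm.
    set (v := approx h m w) in *; set (n := INR m) in *.
    set (x' := foot h v i x).
    specialize (IH i x').
    assert (Hxx : Rabs (x' - x) <= h * C) by (apply foot_close; [auto|apply Hv]).
    assert (Hvw : close (n * h * (C * (K + 1))) (at_pt v x) (at_pt w x))
      by (intros j; apply Htl).
    assert (Hwx : close (K * (h * C)) (at_pt w x') (at_pt w x)).
    { intros j; eapply Rle_trans; [apply Hw|].
      apply Rmult_le_compat_l; [lra|auto]. }
    assert (Hnh : 0 <= n * h) by nra.
    assert (Rh : Rabs h <= h) by (rewrite Rabs_pos_eq; lra).
    assert (Rnh : Rabs (n * h) <= n * h) by (rewrite Rabs_pos_eq; lra).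
    unfold step in IH |- *; fold x'.
    (* The four terms are the earlier error evaluated at [x'], the gap between the feet of the
       composed and the single long step, the source at the drifted state, and the source at the
       shifted point. *)
    match goal with |- Rabs ?e <= _ => replace e with
      ((v i x' - (w i (foot (n * h) w i x') + n * h * src S i (at_pt w x')))
       + (w i (foot (n * h) w i x') - w i (foot ((n + 1) * h) w i x))
       + h * (src S i (at_pt v x) - src S i (at_pt w x))
       + n * h * (src S i (at_pt w x') - src S i (at_pt w x))) by ring end.
    apply Rle_trans with (consistency * (n * h) ^ 2
      + K * (h * (C * (n * h * (C * (K + 1)))) + n * h * (C * (K * (h * C))))
      + h * (C * (n * h * (C * (K + 1))))
      + n * h * (C * (K * (h * C)))).
    + repeat apply Rabs_plus_le; auto.
      * eapply Rle_trans; [apply Hw|].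
        apply Rmult_le_compat_l; [lra|].
        unfold foot at 1 2; unfold x', foot at 1.
        match goal with |- Rabs ?e <= _ => replace e with
          (- (h * (lam S i (at_pt v x) - lam S i (at_pt w x))
              + n * h * (lam S i (at_pt w x') - lam S i (at_pt w x)))) by (unfold x', foot; ring) end.
        rewrite Rabs_Ropp; apply Rabs_plus_le; apply Rabs_mult_le; auto;
          apply lam_lip; auto; try apply Hw; apply Hv.
      * apply Rabs_mult_le; auto; apply src_lip; auto; [apply Hv|apply Hw].
      * apply Rabs_mult_le; auto; apply src_lip; auto; apply Hw.
    + replace (consistency * ((n + 1) * h) ^ 2)
        with (consistency * (n * h) ^ 2 + consistency * (n * h * h) + consistency * ((n + 1) * h * h))
        by ring.
      replace (K * (h * (C * (n * h * (C * (K + 1)))) + n * h * (C * (K * (h * C)))))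
        with (C * C * (K * (2 * K + 1)) * (n * h * h)) by ring.
      assert (0 <= consistency * ((n + 1) * h * h))
        by (pose proof consistency_pos; repeat apply Rmult_le_pos; lra).
      unfold consistency in *; lra.
Qed.

(** * A priori bounds on the iterates and comparison under halving of the step *)

Context (M T : R) (w0 p0 : field).
Context (HB : B = M + 1) (HKM : K = M + 1).
(* One step increases a bound [b <= K] on the derivatives by at most [h * (C * K * (K + 1))], so up to
   time [T] they grow by at most 1. *)
Context (HT : 0 < T) (HTC : T * (C * K * (K + 1)) <= 1).
Context (Hd0 : derivative_of w0 p0) (Hw0 : bounded_by M w0) (Hp0 : bounded_by M p0).

Lemma T_C_le : T * C <= 1.
Proof.
  apply Rle_trans with (2 := HTC).
  replace (T * (C * K * (K + 1))) with (T * C * (K * (K + 1))) by ring.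
  assert (0 < T * C) by nra; assert (1 <= K * (K + 1)) by nra; nra.
Qed.

Lemma approx_bounded (h : R) (k : nat) :
  0 <= h -> INR k * h <= T -> bounded_by (M + INR k * h * C) (approx h k w0).
Proof.
  intros Hh; pose proof T_C_le; induction k as [|k IH]; intros Hk.
  - simpl; intros x i; specialize (Hw0 x i); lra.
  - rewrite S_INR in *; simpl approx.
    replace (M + (INR k + 1) * h * C) with (M + INR k * h * C + h * C) by ring.
    apply step_bounded; [auto| |apply IH; lra].
    assert (INR k * h * C <= T * C) by (apply Rmult_le_compat_r; lra); lra.
Qed.

Lemma dapprox_bounded (h : R) (k : nat) :
  0 <= h -> INR k * h <= T ->
  bounded_by (M + INR k * h * (C * K * (K + 1))) (dapprox h k w0 p0).
Proof.
  intros Hh; pose proof T_C_le; induction k as [|k IH]; intros Hk.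
  - simpl; intros x i; specialize (Hp0 x i); lra.
  - rewrite S_INR in *; simpl dapprox.
    replace (M + (INR k + 1) * h * (C * K * (K + 1)))
      with (M + INR k * h * (C * K * (K + 1)) + h * (C * K * (K + 1))) by ring.
    pose proof (pos_INR k). assert (0 <= INR k * h) by nra.
    assert (0 <= C * K * (K + 1)) by (repeat apply Rmult_le_pos; lra).
    apply dstep_bounded; [auto| |intros x i|apply IH; lra].
    + assert (INR k * h * (C * K * (K + 1)) <= T * (C * K * (K + 1)))
        by (apply Rmult_le_compat_r; lra).
      assert (0 <= INR k * h * (C * K * (K + 1))) by (apply Rmult_le_pos; lra).
      pose proof (in_cube_nonneg _ _ (Hw0 0)); lra.
    + pose proof (approx_bounded h k Hh ltac:(lra) x i).
      assert (INR k * h * C <= T * C) by (apply Rmult_le_compat_r; lra); lra.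
Qed.

Lemma dapprox_derivative (h : R) (k : nat) : derivative_of (approx h k w0) (dapprox h k w0 p0).
Proof. induction k as [|k IH]; [exact Hd0|apply step_derivative; auto]. Qed.

Lemma dapprox_le (h : R) (k : nat) :
  0 <= h -> INR k * h <= T -> bounded_by K (dapprox h k w0 p0).
Proof.
  intros Hh Hk x i; pose proof (dapprox_bounded h k Hh Hk x i).
  assert (INR k * h * (C * K * (K + 1)) <= T * (C * K * (K + 1))).
  { apply Rmult_le_compat_r; auto; repeat apply Rmult_le_pos; lra. }
  lra.
Qed.

Lemma approx_good (h : R) (k : nat) : 0 <= h -> INR k * h <= T -> good (approx h k w0).
Proof.
  intros Hh Hk; split.
  - intros x i; pose proof (approx_bounded h k Hh Hk x i); pose proof T_C_le.
    assert (INR k * h * C <= T * C) by (apply Rmult_le_compat_r; lra); lra.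
  - apply derivative_lipschitz with (p := dapprox h k w0 p0);
      [apply dapprox_derivative|apply dapprox_le; auto].
Qed.

Definition speed : R := C * (K + 1).

Lemma speed_pos : 0 < speed.
Proof. unfold speed; nra. Qed.

(* Two half steps differ from one full step by O(h^2); stability sums these errors to O(h). *)
Lemma approx_halving (h : R) (k : nat) (i : unknown) (x : R) :
  0 <= h -> INR k * h <= T ->
  Rabs (approx h k w0 i x - approx (h / 2) (2 * k) w0 i x)
    <= growth speed 0 (consistency * h) (INR k * h).
Proof.
  intros Hh; pose proof speed_pos as Hs; pose proof consistency_pos as Hc.
  revert i x; induction k as [|k IH]; intros i x Hk.
  - simpl; rewrite Rmult_0_l, growth_0, Rminus_diag, Rabs_R0; lra.
  - rewrite S_INR in *.
    assert (Hk' : INR k * h <= T) by lra.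
    assert (HkN : forall j, (j <= 2)%nat -> INR (j + 2 * k) * (h / 2) <= T).
    { intros j Hj; apply le_INR in Hj; simpl INR at 2 in Hj.
      rewrite plus_INR, mult_INR; simpl INR at 2; nra. }
    replace (2 * Datatypes.S k)%nat with (2 + 2 * k)%nat by lia.
    rewrite approx_add; set (V := approx (h / 2) (2 * k) w0) in *.
    replace ((INR k + 1) * h) with (INR k * h + h) by ring.
    simpl approx at 1.
    eapply Rle_trans; [|apply growth_step; try nra; apply Rmult_le_pos; auto using pos_INR].
    replace (step h (approx h k w0) i x - approx (h / 2) 2 V i x) with
      ((step h (approx h k w0) i x - step h V i x) - (approx (h / 2) 2 V i x - step h V i x))
      by ring.
    apply Rabs_minus_le.
    + apply step_stable; auto.
      * apply approx_good; auto.
      * apply (approx_good (h / 2) (2 * k)); [lra|apply (HkN O); lia].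
      * intros j; apply IH; auto.
    + pose proof (approx_consistent (h / 2) 2 V ltac:(lra)) as Hcon.
      replace (INR 2 * (h / 2)) with h in Hcon by (simpl; field).
      eapply Rle_trans; [apply Hcon|right; ring].
      intros j Hj; unfold V; rewrite <- approx_add; apply approx_good; [lra|auto].
Qed.

(** * Uniform convergence along dyadic meshes *)

Definition mesh (n : nat) : R := / 2 ^ n.

Lemma mesh_pos (n : nat) : 0 < mesh n.
Proof. apply Rinv_0_lt_compat, pow_lt; lra. Qed.

Lemma mesh_S (n : nat) : mesh (Datatypes.S n) = mesh n / 2.
Proof. unfold mesh; simpl; field; apply pow_nonzero; lra. Qed.

Lemma mesh_le_1 (n : nat) : mesh n <= 1.
Proof.
  induction n as [|n IH]; [unfold mesh; simpl; lra|].
  rewrite mesh_S; pose proof (mesh_pos n); lra.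
Qed.

Lemma mesh_lim : is_lim_seq mesh 0.
Proof.
  apply is_lim_seq_ext with (fun n => (/ 2) ^ n).
  - intros n; unfold mesh; rewrite pow_inv; auto.
  - apply is_lim_seq_geom; rewrite Rabs_pos_eq; lra.
Qed.

(** Carries estimates from the iterates to their limit: all approximation errors are proportional to
    the mesh. *)
Lemma le_of_mesh (a b c : R) : (forall n, a <= b + c * mesh n) -> a <= b.
Proof.
  intros H.
  apply (is_lim_seq_le (fun _ => a) (fun n => b + c * mesh n) a b H).
  - apply is_lim_seq_const.
  - replace (Finite b) with (Rbar_plus b (Rbar_mult c 0)) by (simpl; f_equal; ring).
    apply (is_lim_seq_plus' _ _ b (c * 0)); [apply is_lim_seq_const|].
    apply (is_lim_seq_scal_l mesh c 0), mesh_lim.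
Qed.

(** The differences are dominated by a geometric series of ratio 1/2, whence the factor 2. The
    induction keeps the subtracted tail [mesh (m + n)], since the bound without it is not
    inductive. *)
Lemma geometric_limit (a : nat -> R) (c : R) :
  (forall n, Rabs (a (Datatypes.S n) - a n) <= c * mesh n) ->
  forall n, Rabs (a n - real (Lim_seq a)) <= 2 * c * mesh n.
Proof.
  intros Ha.
  assert (Hc : 0 <= c).
  { specialize (Ha O); unfold mesh in Ha; simpl in Ha.
    pose proof (Rabs_pos (a 1%nat - a O)); lra. }
  assert (Hnm : forall n m, Rabs (a (m + n)%nat - a n) <= 2 * c * (mesh n - mesh (m + n))).
  { intros n m; induction m as [|m IH]; simpl Nat.add.
    - rewrite !Rminus_diag, Rabs_R0; lra.
    - replace (a (Datatypes.S (m + n)) - a n)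
        with ((a (Datatypes.S (m + n)) - a (m + n)%nat) + (a (m + n)%nat - a n)) by ring.
      specialize (Ha (m + n)%nat); rewrite mesh_S.
      eapply Rle_trans; [apply Rabs_plus_le; [apply Ha|apply IH]|right; field]. }
  assert (Hlim : is_lim_seq a (real (Lim_seq a))).
  { assert (Hex : ex_finite_lim_seq a).
    { apply ex_lim_seq_cauchy_corr; intros eps.
      (* The summand 1 keeps the divisor positive when [c = 0]. *)
      assert (He : 0 < eps / (4 * c + 1)) by (apply Rdiv_lt_0_compat; [apply cond_pos|lra]).
      destruct (proj2 (is_lim_seq_spec mesh 0) mesh_lim (mkposreal _ He)) as (N & HN).
      specialize (HN N (le_n _)); simpl in HN.
      rewrite Rminus_0_r, Rabs_pos_eq in HN by (left; apply mesh_pos).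
      apply Rlt_div_r in HN; [|lra].
      assert (Hb : forall n, (N <= n)%nat -> Rabs (a n - a N) <= 2 * c * mesh N).
      { intros n Hn; pose proof (Hnm N (n - N)%nat) as H.
        replace (n - N + N)%nat with n in H by lia.
        pose proof (mesh_pos n); pose proof (mesh_pos N); nra. }
      exists N; intros n m Hn Hm.
      replace (a n - a m) with ((a n - a N) - (a m - a N)) by ring.
      pose proof (mesh_pos N).
      eapply Rle_lt_trans; [apply Rabs_minus_le; apply Hb; auto|]; lra. }
    destruct Hex as (l & Hl); rewrite (is_lim_seq_unique _ _ Hl); exact Hl. }
  intros n.
  rewrite Rabs_minus_sym.
  apply (is_lim_seq_le (fun m => Rabs (a (m + n)%nat - a n)) (fun _ => 2 * c * mesh n)
           (Rabs (real (Lim_seq a) - a n)) (2 * c * mesh n)).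
  - intros m; pose proof (Hnm n m); pose proof (mesh_pos (m + n)); nra.
  - apply (is_lim_seq_abs _ (real (Lim_seq a) - a n)).
    apply (is_lim_seq_minus' _ _ (real (Lim_seq a)) (a n)); [|apply is_lim_seq_const].
    apply (is_lim_seq_incr_n a n); auto.
  - apply is_lim_seq_const.
Qed.

Definition index (n : nat) (t : R) : nat := Z.to_nat (Int_part (t * 2 ^ n)).

Lemma index_spec (n : nat) (t : R) :
  0 <= t -> INR (index n t) * mesh n <= t < (INR (index n t) + 1) * mesh n.
Proof.
  intros Ht; unfold index, mesh.
  assert (H2 : 0 < 2 ^ n) by (apply pow_lt; lra).
  assert (H0 : 0 <= t * 2 ^ n) by nra.
  destruct (base_Int_part (t * 2 ^ n)) as (H3 & H4).
  assert (H5 : (0 <= Int_part (t * 2 ^ n))%Z).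
  { assert (-1 < Int_part (t * 2 ^ n))%Z; [|lia].
    apply lt_IZR; lra. }
  rewrite INR_IZR_INZ, Z2Nat.id by auto.
  split.
  - apply Rle_div_l; [auto|lra].
  - apply Rlt_div_r; [auto|lra].
Qed.

(** Piecewise constant in time: the iterate at the last mesh time not after [t]. *)
Definition polygon (n : nat) (t : R) : field := approx (mesh n) (index n t) w0.

Definition dpolygon (n : nat) (t : R) : field := dapprox (mesh n) (index n t) w0 p0.

Lemma index_le (n : nat) (t : R) : 0 <= t <= T -> INR (index n t) * mesh n <= T.
Proof. intros Ht; pose proof (index_spec n t (proj1 Ht)); lra. Qed.

Lemma polygon_good (n : nat) (t : R) : 0 <= t <= T -> good (polygon n t).
Proof.
  intros Ht; apply approx_good; [left; apply mesh_pos|apply index_le; auto].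
Qed.

(** The first summand is the accumulated halving error up to [T]; the second pays for one possible
    extra half step. *)
Definition rate : R := exp (speed * T) * (T * consistency) + speed.

Lemma polygon_refine (n : nat) (t : R) (i : unknown) (x : R) :
  0 <= t <= T -> Rabs (polygon (Datatypes.S n) t i x - polygon n t i x) <= rate * mesh n.
Proof.
  intros Ht; pose proof speed_pos as Hs; pose proof consistency_pos as Hc.
  pose proof (mesh_pos n) as Hm.
  pose proof (index_spec n t (proj1 Ht)) as H1.
  pose proof (index_spec (Datatypes.S n) t (proj1 Ht)) as H2.
  pose proof (index_le n t Ht) as H3.
  pose proof (index_le (Datatypes.S n) t Ht) as H4.
  unfold polygon; rewrite mesh_S in *.
  set (k := index n t) in *; set (k' := index (Datatypes.S n) t) in *.
  set (h := mesh n) in *.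
  assert (HD := approx_halving h k i x ltac:(lra) H3).
  assert (HD' : Rabs (approx h k w0 i x - approx (h / 2) (2 * k) w0 i x)
                <= exp (speed * T) * (T * consistency) * h).
  { eapply Rle_trans; [apply HD|].
    eapply Rle_trans; [apply (growth_mono speed 0 (consistency * h) _ T)|].
    - lra.
    - lra.
    - nra.
    - split; [apply Rmult_le_pos; [apply pos_INR|lra]|auto].
    - unfold growth; right; ring. }
  (* The two cases say whether [t] lies in the first or the second half of its coarse mesh
     interval. *)
  assert (Hk : k' = (2 * k)%nat \/ k' = (1 + 2 * k)%nat).
  { assert (Ha : (2 * k < k' + 1)%nat).
    { apply INR_lt; rewrite plus_INR, mult_INR; simpl INR.
      apply Rmult_lt_reg_r with (h / 2); [lra|].
      replace (2 * INR k * (h / 2)) with (INR k * h) by field. simpl; lra. }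
    assert (Hb : (k' < 2 * k + 2)%nat).
    { apply INR_lt; rewrite plus_INR, mult_INR; simpl INR.
      apply Rmult_lt_reg_r with (h / 2); [lra|].
      replace ((2 * INR k + 2) * (h / 2)) with ((INR k + 1) * h) by field. simpl; lra. }
    lia. }
  unfold rate; rewrite Rmult_plus_distr_r, Rabs_minus_sym.
  destruct Hk as [Hk|Hk]; rewrite Hk in *.
  - apply Rle_trans with (1 := HD'); nra.
  - rewrite approx_add.
    set (V := approx (h / 2) (2 * k) w0) in *.
    change (approx (h / 2) 1 V) with (step (h / 2) V).
    replace (approx h k w0 i x - step (h / 2) V i x) with
      ((approx h k w0 i x - V i x) - (step (h / 2) V i x - V i x)) by ring.
    apply Rabs_minus_le; auto.
    eapply Rle_trans; [apply step_time_lip; [lra|]|fold speed; nra].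
    apply approx_good; [lra|].
    rewrite plus_INR in H4; simpl INR at 1 in H4; nra.
Qed.

Definition sol (t : R) : field := fun i x => real (Lim_seq (fun n => polygon n t i x)).

Lemma sol_rate (n : nat) (t : R) (i : unknown) (x : R) :
  0 <= t <= T -> Rabs (polygon n t i x - sol t i x) <= 2 * rate * mesh n.
Proof.
  intros Ht; apply (geometric_limit (fun n => polygon n t i x) rate).
  intros m; apply polygon_refine; auto.
Qed.

Lemma sol_good (t : R) : 0 <= t <= T -> good (sol t).
Proof.
  intros Ht; split.
  - intros x i; unfold at_pt; apply le_of_mesh with (c := 2 * rate); intros n.
    replace (sol t i x) with (polygon n t i x - (polygon n t i x - sol t i x)) by ring.
    apply Rabs_minus_le; [apply (polygon_good n t Ht)|apply sol_rate; auto].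
  - intros i x y; apply le_of_mesh with (c := 4 * rate); intros n.
    replace (sol t i x - sol t i y) with ((polygon n t i x - polygon n t i y)
      - ((polygon n t i x - sol t i x) - (polygon n t i y - sol t i y))) by ring.
    replace (4 * rate * mesh n) with (2 * rate * mesh n + 2 * rate * mesh n) by ring.
    apply Rabs_minus_le; [apply (polygon_good n t Ht)|].
    apply Rabs_minus_le; apply sol_rate; auto.
Qed.

Lemma sol_0 (i : unknown) (x : R) : sol 0 i x = w0 i x.
Proof.
  unfold sol.
  rewrite (Lim_seq_ext _ (fun _ => w0 i x)), Lim_seq_const; auto.
  intros n; unfold polygon.
  destruct (index_spec n 0 (Rle_refl _)) as (H & _).
  destruct (index n 0) as [|k] eqn:E; [reflexivity|exfalso].
  pose proof (mesh_pos n); rewrite S_INR in H; pose proof (pos_INR k); nra.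
Qed.

(** The semigroup property of the scheme; both times are rounded down to the mesh, so the [m] steps
    between them last [s] up to one mesh width. *)
Lemma polygon_shift (n : nat) (t s : R) :
  0 <= t -> 0 <= s -> t + s <= T -> exists m,
    Rabs (INR m * mesh n - s) <= mesh n /\
    polygon n (t + s) = approx (mesh n) m (polygon n t) /\
    (forall j, (j <= m)%nat -> good (approx (mesh n) j (polygon n t))).
Proof.
  intros Ht Hs Hts; pose proof (mesh_pos n) as Hm.
  pose proof (index_spec n t Ht) as H1.
  pose proof (index_spec n (t + s) ltac:(lra)) as H2.
  unfold polygon.
  set (k := index n t) in *; set (k' := index n (t + s)) in *.
  assert (Hk : (k <= k')%nat).
  { assert (k < k' + 1)%nat; [|lia].
    apply INR_lt; rewrite plus_INR; simpl INR.
    apply Rmult_lt_reg_r with (mesh n); auto; simpl; lra. }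
  exists (k' - k)%nat; split; [|split].
  - rewrite minus_INR by auto; apply Rabs_le; split; lra.
  - rewrite <- approx_add; f_equal; lia.
  - intros j Hj; rewrite <- approx_add; apply approx_good; [lra|].
    assert (Hjk : (j + k <= k')%nat) by lia.
    apply le_INR in Hjk; nra.
Qed.

Lemma sol_time_lip (t s : R) (i : unknown) (x : R) :
  0 <= t -> 0 <= s -> t + s <= T -> Rabs (sol (t + s) i x - sol t i x) <= speed * s.
Proof.
  intros Ht Hs Hts; pose proof speed_pos.
  apply le_of_mesh with (c := speed + 4 * rate); intros n.
  destruct (polygon_shift n t s Ht Hs Hts) as (m & Hm & Hp & Hg).
  pose proof (mesh_pos n).
  replace (sol (t + s) i x - sol t i x) with
    ((approx (mesh n) m (polygon n t) i x - polygon n t i x)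
     - ((polygon n (t + s) i x - sol (t + s) i x) - (polygon n t i x - sol t i x)))
    by (rewrite <- Hp; ring).
  apply Rle_trans with (INR m * mesh n * (C * (K + 1))
     + (2 * rate * mesh n + 2 * rate * mesh n)).
  - apply Rabs_minus_le; [|apply Rabs_minus_le; apply sol_rate; lra].
    apply approx_time_lip; [lra|intros j Hj; apply Hg; lia].
  - fold speed; apply Rabs_le_between in Hm; nra.
Qed.

Lemma step_lip_step (h h' : R) (w : field) (i : unknown) (x : R) :
  good w -> Rabs (step h w i x - step h' w i x) <= Rabs (h - h') * speed.
Proof.
  intros [Hw Lw]; unfold step, speed.
  match goal with |- Rabs ?e <= _ => replace e with
    ((w i (foot h w i x) - w i (foot h' w i x)) + (h - h') * src S i (at_pt w x)) by ring end.
  replace (Rabs (h - h') * (C * (K + 1)))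
    with (K * (Rabs (h - h') * C) + Rabs (h - h') * C) by ring.
  apply Rabs_plus_le.
  - eapply Rle_trans; [apply Lw|apply Rmult_le_compat_l; [lra|]].
    unfold foot.
    replace (x - h * lam S i (at_pt w x) - (x - h' * lam S i (at_pt w x)))
      with (- ((h - h') * lam S i (at_pt w x))) by ring.
    rewrite Rabs_Ropp; apply Rabs_mult_le; [lra|apply lam_le; auto].
  - apply Rabs_mult_le; [lra|apply src_le; auto].
Qed.

(** [approx_consistent] compares many short steps with one long step at a cost independent of the
    mesh, so it survives the limit. *)
Lemma sol_tangent (t s : R) (i : unknown) (x : R) :
  0 <= t -> 0 <= s -> t + s <= T ->
  Rabs (sol (t + s) i x - step s (sol t) i x) <= consistency * s ^ 2.
Proof.
  intros Ht Hs Hts; pose proof speed_pos; pose proof consistency_pos.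
  (* The summands come, in order, from convergence at [t + s], from replacing [(s + mesh n) ^ 2] by
     [s ^ 2], from the mismatch of step lengths, and from convergence at [t] propagated by one
     step. *)
  apply le_of_mesh with
    (c := 2 * rate + consistency * (2 * T + 1) + speed + (1 + s * speed) * (2 * rate)).
  intros n.
  destruct (polygon_shift n t s Ht Hs Hts) as (m & Hm & Hp & Hg).
  pose proof (mesh_pos n) as Hm1; pose proof (mesh_le_1 n) as Hm2.
  pose proof (sol_rate n (t + s) i x ltac:(lra)) as H1.
  pose proof (approx_consistent (mesh n) m (polygon n t) ltac:(lra) Hg i x) as H2.
  pose proof (step_lip_step (INR m * mesh n) s (polygon n t) i x (Hg O ltac:(lia))) as H3.
  assert (H4 : Rabs (step s (polygon n t) i x - step s (sol t) i x)
               <= (1 + s * (C * (K + 1))) * (2 * rate * mesh n)).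
  { apply step_stable; auto.
    - apply polygon_good; lra.
    - apply sol_good; lra.
    - intros j; apply sol_rate; lra.
    - apply sol_rate; lra. }
  fold speed in H4; rewrite Hp in H1.
  replace (sol (t + s) i x - step s (sol t) i x) with
    (- (approx (mesh n) m (polygon n t) i x - sol (t + s) i x)
     + (approx (mesh n) m (polygon n t) i x - step (INR m * mesh n) (polygon n t) i x)
     + (step (INR m * mesh n) (polygon n t) i x - step s (polygon n t) i x)
     + (step s (polygon n t) i x - step s (sol t) i x)) by ring.
  apply Rle_trans with (2 * rate * mesh n + consistency * (s ^ 2 + (2 * T + 1) * mesh n)
     + mesh n * speed + (1 + s * speed) * (2 * rate * mesh n)); [|right; ring].
  repeat apply Rabs_plus_le; auto.
  - rewrite Rabs_Ropp; auto.
  - eapply Rle_trans; [apply H2|].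
    apply Rmult_le_compat_l; [lra|].
    apply Rabs_le_between in Hm.
    assert (0 <= INR m * mesh n) by (apply Rmult_le_pos; [apply pos_INR|lra]).
    apply Rle_trans with ((s + mesh n) ^ 2); [apply pow_incr; lra|].
    replace ((s + mesh n) ^ 2) with (s ^ 2 + (2 * s + mesh n) * mesh n) by ring.
    apply Rplus_le_compat_l, Rmult_le_compat_r; lra.
  - eapply Rle_trans; [apply H3|apply Rmult_le_compat_r; lra].
Qed.

(** * Equicontinuity and convergence of the x-derivatives *)

Context (Hc0 : forall i x, continuous (p0 i) x).

Definition modulus (r delta eps : R) (p : field) : Prop :=
  forall x y, Rabs x <= r -> Rabs y <= r -> Rabs (x - y) <= delta ->
    close eps (at_pt p x) (at_pt p y).

Lemma initial_modulus (r eps : R) : 0 < eps -> exists delta, 0 < delta /\ modulus r delta eps p0.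
Proof.
  intros He.
  assert (H : forall i, exists delta, 0 < delta /\ forall x y, Rabs x <= r -> Rabs y <= r ->
    Rabs (x - y) <= delta -> Rabs (p0 i x - p0 i y) <= eps).
  { intros i.
    destruct (cont2_unif (fun _ b => p0 i b) 0 0 (-r) r eps) as (d & Hd & Hu); auto.
    - intros a b e Hee.
      destruct (proj1 (filterlim_locally _ _) (Hc0 i b) (mkposreal e Hee)) as (d & Hd).
      exists d; split; [apply cond_pos|]; intros a' b' _ Hb; apply Hd, Hb.
    - exists (d / 2); split; [lra|]; intros x y Hx Hy Hxy; left.
      apply (Hu 0 y 0 x); try lra.
      + apply Rabs_le_between; auto.
      + apply Rabs_le_between; auto.
      + rewrite Rminus_diag, Rabs_R0; auto. }
  destruct (H Rho) as (d1 & P1 & H1); destruct (H Vel) as (d2 & P2 & H2);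
    destruct (H En) as (d3 & P3 & H3).
  exists (Rmin d1 (Rmin d2 d3)); split; [repeat apply Rmin_glb_lt; auto|].
  intros x y Hx Hy Hxy.
  assert (Rabs (x - y) <= d1) by (eapply Rle_trans; [apply Hxy|apply Rmin_l]).
  assert (Rabs (x - y) <= Rmin d2 d3) by (eapply Rle_trans; [apply Hxy|apply Rmin_r]).
  assert (Rabs (x - y) <= d2) by (apply Rle_trans with (Rmin d2 d3); [auto|apply Rmin_l]).
  assert (Rabs (x - y) <= d3) by (apply Rle_trans with (Rmin d2 d3); [auto|apply Rmin_r]).
  intros []; [apply H1|apply H2|apply H3]; auto.
Qed.

(** In a difference of values of [dstep] the old modulus recurs through the transported derivative
    and the gradient of [lam], each with factor [C * K], and through the gradient of [src], with
    factor [C]. *)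
Definition equi_rate : R := C * (2 * K + 1).

(* The initial derivative is only locally uniformly continuous, so the modulus is propagated on
   intervals that shrink at the maximal speed [C]. *)
Lemma dapprox_modulus (r delta eps h : R) (k : nat) :
  0 <= h -> 0 < delta -> 0 <= eps -> INR k * h <= T -> modulus r delta eps p0 ->
  modulus (r - INR k * h * C) (delta * exp (- (equi_rate * (INR k * h))))
    (growth equi_rate eps (C * K ^ 2 * (K + 1) * delta) (INR k * h)) (dapprox h k w0 p0).
Proof.
  intros Hh Hdelta Heps Hk Hm0.
  assert (Hr : 0 <= equi_rate) by (unfold equi_rate; nra).
  assert (Hb : 0 <= C * K ^ 2 * (K + 1) * delta) by (repeat apply Rmult_le_pos; lra).
  induction k as [|k IH].
  - simpl; rewrite !Rmult_0_l, Rmult_0_r, Ropp_0, exp_0, growth_0, Rminus_0_r, Rmult_1_r; auto.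
  - rewrite S_INR in *; simpl dapprox.
    assert (Hk' : INR k * h <= T) by lra; specialize (IH Hk').
    assert (Hkh : 0 <= INR k * h) by (apply Rmult_le_pos; auto using pos_INR).
    set (t := INR k * h) in *.
    replace ((INR k + 1) * h) with (t + h) by (unfold t; ring).
    intros x y Hx Hy Hxy i; unfold at_pt, dstep.
    destruct (approx_good h k Hh Hk') as [Hw Lw].
    assert (Hp := dapprox_le h k Hh Hk').
    set (w := approx h k w0) in *; set (p := dapprox h k w0 p0) in *.
    set (D := delta * exp (- (equi_rate * t))) in *.
    set (G := growth equi_rate eps (C * K ^ 2 * (K + 1) * delta) t) in *.
    assert (Hxy1 : Rabs (x - y) <= D * exp (- (equi_rate * h))).
    { eapply Rle_trans; [apply Hxy|].
      unfold D; rewrite Rmult_assoc, <- exp_plus; right; do 2 f_equal; ring. }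
    assert (He1 : exp (- (equi_rate * h)) * exp (equi_rate * h) = 1)
      by (rewrite <- exp_plus, Rplus_opp_l; apply exp_0).
    pose proof (exp_ineq1_le (equi_rate * h)) as He2.
    pose proof (exp_pos (- (equi_rate * h))) as He3.
    assert (HD : 0 < D) by (apply Rmult_lt_0_compat; [lra|apply exp_pos]).
    assert (HDd : D <= delta).
    { unfold D; rewrite <- (Rmult_1_r delta) at 2; apply Rmult_le_compat_l; [lra|].
      rewrite <- exp_0; destruct (Req_dec (equi_rate * t) 0) as [->|].
      - rewrite Ropp_0; lra.
      - left; apply exp_increasing; assert (0 <= equi_rate * t) by nra; lra. }
    assert (Hhr : h * (C * K) <= equi_rate * h) 
      by (assert (0 <= C * K * h) by (repeat apply Rmult_le_pos; lra); unfold equi_rate; nra).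
    (* One step spreads two feet by at most [1 + h * (C * K)]; the exponential shrinking of the
       admissible distance compensates for it. *)
    assert (Hxy2 : Rabs (x - y) * (1 + h * (C * K)) <= D).
    { apply Rle_trans with (D * exp (- (equi_rate * h)) * exp (equi_rate * h)).
      - apply Rmult_le_compat; [apply Rabs_pos| |auto|lra].
        assert (0 <= h * (C * K)) by (repeat apply Rmult_le_pos; lra); lra.
      - rewrite Rmult_assoc, He1; lra. }
    assert (Hxy3 : Rabs (x - y) <= D).
    { assert (0 <= h * (C * K)) by (repeat apply Rmult_le_pos; lra).
      pose proof (Rabs_pos (x - y)); nra. }
    assert (HCh : 0 <= C * h) by nra.
    assert (Hx1 : Rabs x <= r - t * C) by nra.
    assert (Hy1 : Rabs y <= r - t * C) by nra.
    assert (Hpp : close G (at_pt p x) (at_pt p y)) by (apply IH; auto).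
    assert (Hpf : Rabs (p i (foot h w i x) - p i (foot h w i y)) <= G).
    { apply IH.
      - apply foot_in; auto; lra.
      - apply foot_in; auto; lra.
      - eapply Rle_trans; [apply foot_lip; auto|auto]. }
    assert (Hww : close (K * delta) (at_pt w x) (at_pt w y)).
    { intros j; eapply Rle_trans; [apply Lw|apply Rmult_le_compat_l; lra]. }
    assert (Hg1 : Rabs (dlam S i (at_pt w x) (at_pt p x) - dlam S i (at_pt w y) (at_pt p y))
                  <= C * (K * delta * K + G))
      by (apply gradient_diff with (phi := lam S i); auto; [apply lam_regular|apply Hbd]).
    assert (Hg2 : Rabs (dsrc S i (at_pt w x) (at_pt p x) - dsrc S i (at_pt w y) (at_pt p y))
                  <= C * (K * delta * K + G))
      by (apply gradient_diff with (phi := src S i); auto; [apply src_regular|apply Hbd]).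
    assert (Hl : Rabs (dlam S i (at_pt w x) (at_pt p x)) <= C * K) by (apply dlam_le; auto).
    assert (Rh : Rabs h <= h) by (rewrite Rabs_pos_eq; lra).
    match goal with |- Rabs ?e <= _ => replace e with
      ((p i (foot h w i x) - p i (foot h w i y)) * (1 - h * dlam S i (at_pt w x) (at_pt p x))
       - p i (foot h w i y) * (h * (dlam S i (at_pt w x) (at_pt p x) - dlam S i (at_pt w y) (at_pt p y)))
       + h * (dsrc S i (at_pt w x) (at_pt p x) - dsrc S i (at_pt w y) (at_pt p y))) by ring end.
    apply Rle_trans with (G * (1 + h * (C * K)) + K * (h * (C * (K * delta * K + G)))
                          + h * (C * (K * delta * K + G))).
    + apply Rabs_plus_le; [apply Rabs_minus_le|].
      * apply Rabs_mult_le; auto; apply Rabs_minus_le; [rewrite Rabs_R1; lra|].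
        apply Rabs_mult_le; auto.
      * apply Rabs_mult_le; [apply (Hp _ i)|apply Rabs_mult_le; auto].
      * apply Rabs_mult_le; auto.
    + eapply Rle_trans; [|apply growth_step; auto].
      fold G; unfold equi_rate; right; ring.
Qed.

Lemma dapprox_equicontinuous (r eps : R) : 0 < eps -> exists delta, 0 < delta /\
  forall h k, 0 <= h -> INR k * h <= T -> modulus r delta eps (dapprox h k w0 p0).
Proof.
  intros Heps.
  assert (Hr : 0 <= equi_rate) by (unfold equi_rate; nra).
  pose proof (exp_pos (equi_rate * T)) as HE; set (E := exp (equi_rate * T)) in *.
  set (b := C * K ^ 2 * (K + 1)).
  assert (Hb : 0 < b) by (unfold b; repeat apply Rmult_lt_0_compat; try lra; apply pow_lt; lra).
  (* The cone loses at most [T * C <= 1] of radius, and [E] is the amplification up to time [T];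
     this term of [growth] takes half of [eps]. *)
  destruct (initial_modulus (r + 1) (eps / (2 * E))) as (d & Hd & Hm).
  { apply Rdiv_lt_0_compat; lra. }
  assert (HETb : 0 < 2 * E * T * b) by (repeat apply Rmult_lt_0_compat; lra).
  (* The inhomogeneous term of [growth] is proportional to the distance, so shrinking [d] makes it
     take at most the other half. *)
  set (d0 := Rmin d (eps / (2 * E * T * b))).
  assert (Hd0' : 0 < d0) by (apply Rmin_glb_lt; [auto|apply Rdiv_lt_0_compat; lra]).
  assert (Hd1 : d0 <= d) by apply Rmin_l.
  assert (Hd2 : d0 * (2 * E * T * b) <= eps) by (apply Rle_div_r; [lra|apply Rmin_r]).
  exists (d0 * exp (- (equi_rate * T))); split.
  { apply Rmult_lt_0_compat; [auto|apply exp_pos]. }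
  intros h k Hh Hk x y Hx Hy Hxy i.
  assert (Hkh : 0 <= INR k * h) by (apply Rmult_le_pos; auto using pos_INR).
  assert (He' : 0 <= eps / (2 * E)) by (left; apply Rdiv_lt_0_compat; lra).
  eapply Rle_trans.
  - apply (dapprox_modulus (r + 1) d0 (eps / (2 * E)) h k); auto.
    + intros x' y' Hx' Hy' Hxy'; apply Hm; auto; lra.
    + pose proof T_C_le; assert (INR k * h * C <= T * C) by (apply Rmult_le_compat_r; lra); lra.
    + pose proof T_C_le; assert (INR k * h * C <= T * C) by (apply Rmult_le_compat_r; lra); lra.
    + eapply Rle_trans; [apply Hxy|].
      apply Rmult_le_compat_l; [lra|].
      destruct (Req_dec (equi_rate * (INR k * h)) (equi_rate * T)) as [->|]; [lra|].
      left; apply exp_increasing, Ropp_lt_contravar; nra.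
  - eapply Rle_trans; [apply (growth_mono _ _ _ _ T); auto|].
    + fold b; nra.
    + unfold growth; fold b E.
      replace (E * (eps / (2 * E) + T * (b * d0))) with (eps / 2 + d0 * (2 * E * T * b) / 2)
        by (field; lra); lra.
Qed.

(* Equicontinuity compares [qn n x] with a difference quotient of [gn n] uniformly in [n], so the
   derivatives converge because the functions do. *)
Lemma limit_derivative (g : R -> R) (gn qn : nat -> R -> R) (x : R) :
  (forall n y, is_derive (gn n) y (qn n y)) ->
  (forall y, is_lim_seq (fun n => gn n y) (g y)) ->
  (forall eps, 0 < eps -> exists delta, 0 < delta /\
     forall n y, Rabs (y - x) <= delta -> Rabs (qn n y - qn n x) <= eps) ->
  exists l, is_derive g x l /\ is_lim_seq (fun n => qn n x) l.
Proof.
  intros Hq Hg Heq.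
  assert (Hmv : forall eps delta, 
     (forall n y, Rabs (y - x) <= delta -> Rabs (qn n y - qn n x) <= eps) ->
     forall n y, Rabs (y - x) <= delta ->
       Rabs (gn n y - gn n x - qn n x * (y - x)) <= eps * Rabs (y - x)).
  { intros eps delta He n y Hy.
    destruct (mean_value (gn n) (qn n) x y (Hq n)) as (c & Hc & ->).
    replace (qn n c * (y - x) - qn n x * (y - x)) with ((qn n c - qn n x) * (y - x)) by ring.
    apply Rabs_mult_le; [apply He|lra].
    apply Rle_trans with (2 := Hy).
    revert Hc; unfold Rmin, Rmax; destruct (Rle_dec x y); intros Hc;
      unfold Rabs; repeat destruct Rcase_abs; lra. }
  assert (Hex : ex_finite_lim_seq (fun n => qn n x)).
  { apply ex_lim_seq_cauchy_corr; intros eps.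
    destruct (Heq (eps / 4)) as (d & Hd & He); [pose proof (cond_pos eps); lra|].
    assert (Hxd : Rabs (x + d - x) = d)
      by (replace (x + d - x) with d by ring; apply Rabs_pos_eq; lra).
    assert (HL : ex_lim_seq_cauchy (fun n => gn n (x + d) - gn n x)).
    { apply ex_lim_seq_cauchy_corr; exists (g (x + d) - g x).
      apply is_lim_seq_minus'; auto. }
    assert (Hed : 0 < eps / 4 * d) by (pose proof (cond_pos eps); nra).
    destruct (HL (mkposreal _ Hed)) as (N & HN); exists N; intros n m Hn Hm.
    specialize (HN n m Hn Hm); simpl in HN.
    pose proof (Hmv _ _ He n (x + d) ltac:(lra)) as H1.
    pose proof (Hmv _ _ He m (x + d) ltac:(lra)) as H2.
    rewrite Hxd in H1, H2; replace (x + d - x) with d in H1, H2 by ring.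
    apply Rmult_lt_reg_r with d; auto.
    replace (Rabs (qn n x - qn m x) * d) with (Rabs ((qn n x - qn m x) * d))
      by (rewrite Rabs_mult, (Rabs_pos_eq d); lra).
    replace ((qn n x - qn m x) * d) with
      ((gn n (x + d) - gn n x - (gn m (x + d) - gn m x))
       - ((gn n (x + d) - gn n x - qn n x * d) - (gn m (x + d) - gn m x - qn m x * d))) by ring.
    eapply Rle_lt_trans.
    - apply Rabs_minus_le; [left; apply HN|apply Rabs_minus_le; [apply H1|apply H2]].
    - pose proof (cond_pos eps); nra. }
  destruct Hex as (l & Hl); exists l; split; auto.
  apply is_derive_Reals; intros eps Heps.
  destruct (Heq (eps / 2)) as (d & Hd & He); [lra|].
  exists (mkposreal d Hd); intros h Hh0 Hh; simpl in Hh.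
  assert (Hb : Rabs (g (x + h) - g x - l * h) <= eps / 2 * Rabs h).
  { assert (Hxh : x + h - x = h) by ring.
    apply (is_lim_seq_le (fun n => Rabs (gn n (x + h) - gn n x - qn n x * h))
      (fun _ => eps / 2 * Rabs h) (Rabs (g (x + h) - g x - l * h)) (eps / 2 * Rabs h)).
    - intros n; pose proof (Hmv _ _ He n (x + h)) as H; rewrite Hxh in H; apply H; lra.
    - apply (is_lim_seq_abs _ (g (x + h) - g x - l * h)).
      apply is_lim_seq_minus'; [apply is_lim_seq_minus'; auto|].
      apply (is_lim_seq_scal_r _ h l); auto.
    - apply is_lim_seq_const. }
  assert (Hah : 0 < Rabs h) by (apply Rabs_pos_lt; auto).
  replace ((g (x + h) - g x) / h - l) with ((g (x + h) - g x - l * h) / h) by (field; auto).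
  unfold Rdiv; rewrite Rabs_mult, Rabs_inv by auto.
  apply Rmult_lt_reg_r with (Rabs h); auto.
  rewrite Rmult_assoc, Rinv_l, Rmult_1_r by lra; nra.
Qed.

(** Taken from the limit function; [dsol_limit] identifies it with the limit of [dpolygon]. *)
Definition dsol (t : R) : field := fun i x => Derive (sol t i) x.

Lemma sol_limit (t : R) (i : unknown) (x : R) :
  0 <= t <= T -> is_lim_seq (fun n => polygon n t i x) (sol t i x).
Proof.
  intros Ht; apply is_lim_seq_spec; intros eps.
  assert (He : 0 < eps / (2 * Rabs rate + 1))
    by (apply Rdiv_lt_0_compat; [apply cond_pos|pose proof (Rabs_pos rate); lra]).
  destruct (proj2 (is_lim_seq_spec mesh 0) mesh_lim (mkposreal _ He)) as (N & HN).
  exists N; intros n Hn; specialize (HN n Hn); simpl in HN.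
  pose proof (mesh_pos n); pose proof (Rabs_pos rate).
  rewrite Rminus_0_r, Rabs_pos_eq in HN by lra.
  apply Rlt_div_r in HN; [|lra].
  pose proof (sol_rate n t i x Ht); pose proof (Rle_abs rate); nra.
Qed.

Lemma dsol_limit (t : R) (i : unknown) (x : R) :
  0 <= t <= T ->
  is_derive (sol t i) x (dsol t i x) /\ is_lim_seq (fun n => dpolygon n t i x) (dsol t i x).
Proof.
  intros Ht.
  destruct (limit_derivative (sol t i) (fun n => polygon n t i) (fun n => dpolygon n t i) x)
    as (l & Hd & Hl).
  - intros n y; apply dapprox_derivative.
  - intros y; apply sol_limit; auto.
  - intros eps He; destruct (dapprox_equicontinuous (Rabs x + 1) eps He) as (d & Hd & Hm).
    exists (Rmin d 1); split; [apply Rmin_glb_lt; lra|].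
    intros n y Hy; pose proof (Rmin_l d 1); pose proof (Rmin_r d 1).
    apply Hm; try lra.
    + left; apply mesh_pos.
    + apply index_le; auto.
    + replace y with (x + (y - x)) by ring; pose proof (Rabs_triang x (y - x)); lra.
  - unfold dsol; rewrite (is_derive_unique _ _ _ Hd); auto.
Qed.

Lemma dsol_derivative (t : R) : 0 <= t <= T -> derivative_of (sol t) (dsol t).
Proof. intros Ht i x; apply dsol_limit; auto. Qed.

Lemma dsol_bounded (t : R) : 0 <= t <= T -> bounded_by K (dsol t).
Proof.
  intros Ht x i.
  destruct (dsol_limit t i x Ht) as (_ & Hl).
  apply (is_lim_seq_le (fun n => Rabs (dpolygon n t i x)) (fun _ => K)
           (Rabs (dsol t i x)) K).
  - intros n; apply (dapprox_le (mesh n) (index n t)); [left; apply mesh_pos|apply index_le; auto].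
  - apply (is_lim_seq_abs _ (dsol t i x)); auto.
  - apply is_lim_seq_const.
Qed.

Lemma dsol_equicontinuous (r eps : R) : 0 < eps -> exists delta, 0 < delta /\
  forall t, 0 <= t <= T -> modulus r delta eps (dsol t).
Proof.
  intros He; destruct (dapprox_equicontinuous r eps He) as (d & Hd & Hm).
  exists d; split; auto; intros t Ht x y Hx Hy Hxy i.
  destruct (dsol_limit t i x Ht) as (_ & Hlx); destruct (dsol_limit t i y Ht) as (_ & Hly).
  apply (is_lim_seq_le (fun n => Rabs (dpolygon n t i x - dpolygon n t i y)) (fun _ => eps)
           (Rabs (dsol t i x - dsol t i y)) eps).
  - intros n; apply Hm; auto; [left; apply mesh_pos|apply index_le; auto].
  - apply (is_lim_seq_abs _ (dsol t i x - dsol t i y)); apply is_lim_seq_minus'; auto.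
  - apply is_lim_seq_const.
Qed.

Lemma sol_time_lip_abs (t s : R) (i : unknown) (x : R) :
  0 <= t <= T -> 0 <= s <= T -> Rabs (sol t i x - sol s i x) <= speed * Rabs (t - s).
Proof.
  intros Ht Hs; destruct (Rle_dec s t).
  - rewrite (Rabs_pos_eq (t - s)) by lra.
    replace t with (s + (t - s)) at 1 by ring; apply sol_time_lip; lra.
  - rewrite Rabs_minus_sym, (Rabs_minus_sym t s), (Rabs_pos_eq (s - t)) by lra.
    replace s with (t + (s - t)) at 1 by ring; apply sol_time_lip; lra.
Qed.

(** Equicontinuity in [x] lets a derivative be replaced by a difference quotient over a fixed length
    [d1], uniformly in time, and the quotient is Lipschitz in time because [sol] is. *)
Lemma dsol_continuous (r eps : R) : 0 < eps -> exists delta, 0 < delta /\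
  forall t s x y i, 0 <= t <= T -> 0 <= s <= T -> Rabs x <= r -> Rabs y <= r ->
    Rabs (t - s) <= delta -> Rabs (x - y) <= delta -> Rabs (dsol t i x - dsol s i y) <= eps.
Proof.
  intros He; destruct (dsol_equicontinuous (r + 1) (eps / 4)) as (d & Hd & Hm); [lra|].
  pose proof speed_pos as Hs.
  set (d1 := Rmin d 1).
  assert (Hd1 : 0 < d1) by (apply Rmin_glb_lt; lra).
  assert (Hd1d : d1 <= d) by apply Rmin_l.
  assert (Hd11 : d1 <= 1) by apply Rmin_r.
  (* Two values moving with [speed] over this time, divided by [d1], contribute [eps / 4]. *)
  assert (Hq : 0 < eps * d1 / (8 * speed)) by (apply Rdiv_lt_0_compat; nra).
  exists (Rmin d1 (eps * d1 / (8 * speed))); split; [apply Rmin_glb_lt; auto|].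
  intros t s x y i Ht Hs' Hx Hy Hts Hxy.
  assert (Hts1 : Rabs (t - s) <= eps * d1 / (8 * speed))
    by (eapply Rle_trans; [apply Hts|apply Rmin_r]).
  assert (Hxy1 : Rabs (x - y) <= d1) by (eapply Rle_trans; [apply Hxy|apply Rmin_l]).
  apply Rle_div_r in Hts1; [|lra].
  assert (Hmv : forall t', 0 <= t' <= T ->
    Rabs ((sol t' i (y + d1) - sol t' i y) - dsol t' i y * d1) <= eps / 4 * d1).
  { intros t' Ht'.
    destruct (mean_value (sol t' i) (dsol t' i) y (y + d1)) as (c & Hc & ->).
    { intros z; apply dsol_derivative; auto. }
    rewrite Rmin_left, Rmax_right in Hc by lra.
    replace (dsol t' i c * (y + d1 - y) - dsol t' i y * d1)
      with ((dsol t' i c - dsol t' i y) * d1) by ring.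
    apply Rabs_mult_le; [|rewrite Rabs_pos_eq; lra].
    apply Hm; auto; try lra.
    - apply Rabs_le_between; apply Rabs_le_between in Hy; lra.
    - rewrite Rabs_pos_eq; lra. }
  assert (Hty : Rabs (dsol t i y - dsol s i y) <= 3 * eps / 4).
  { apply Rmult_le_reg_r with d1; auto.
    replace (Rabs (dsol t i y - dsol s i y) * d1) with (Rabs ((dsol t i y - dsol s i y) * d1))
      by (rewrite Rabs_mult, (Rabs_pos_eq d1); lra).
    replace ((dsol t i y - dsol s i y) * d1) with
      (((sol t i (y + d1) - sol s i (y + d1)) - (sol t i y - sol s i y))
       - ((sol t i (y + d1) - sol t i y - dsol t i y * d1)
          - (sol s i (y + d1) - sol s i y - dsol s i y * d1))) by ring.
    eapply Rle_trans.
    - apply Rabs_minus_le; apply Rabs_minus_le;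
        [apply sol_time_lip_abs|apply sol_time_lip_abs|apply Hmv|apply Hmv]; auto.
    - lra. }
  replace (dsol t i x - dsol s i y) with
    ((dsol t i x - dsol t i y) + (dsol t i y - dsol s i y)) by ring.
  assert (Rabs (dsol t i x - dsol t i y) <= eps / 4) by (apply Hm; auto; lra).
  eapply Rle_trans; [apply Rabs_plus_le; eassumption|lra].
Qed.

(** * The limit has the time derivative prescribed by the system *)

Definition velocity (w q : field) : field :=
  fun i x => src S i (at_pt w x) - lam S i (at_pt w x) * q i x.

(** [sol_tangent] divided by [s], where the mean value theorem between [x] and its foot turns
    transport into a derivative at a nearby point [c]. *)
Lemma sol_difference_quotient (t s : R) (i : unknown) (x : R) :
  0 <= t -> 0 < s -> t + s <= T -> exists c, Rabs (c - x) <= s * C /\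
    Rabs ((sol (t + s) i x - sol t i x) / s
      - (src S i (at_pt (sol t) x) - lam S i (at_pt (sol t) x) * dsol t i c)) <= consistency * s.
Proof.
  intros Ht Hs Hts.
  assert (Htn := sol_tangent t s i x Ht (Rlt_le _ _ Hs) Hts).
  destruct (sol_good t ltac:(lra)) as [Hw Lw].
  destruct (mean_value (sol t i) (dsol t i) x (foot s (sol t) i x)) as (c & Hc & Hmv).
  { intros z; apply dsol_derivative; lra. }
  exists c; split.
  - pose proof (foot_close s (sol t) i x ltac:(lra) Hw) as Hf.
    assert (0 <= s * C) by nra.
    apply Rabs_le_between in Hf; apply Rabs_le_between.
    revert Hc; unfold Rmin, Rmax; destruct (Rle_dec x (foot s (sol t) i x)); lra.
  - apply Rmult_le_reg_r with s; auto.
    rewrite <- (Rabs_pos_eq s) at 3 by lra; rewrite <- Rabs_mult.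
    replace (consistency * s * s) with (consistency * s ^ 2) by ring.
    eapply Rle_trans; [|apply Htn].
    right; f_equal; unfold step.
    replace (sol t i (foot s (sol t) i x))
      with (sol t i x + dsol t i c * (foot s (sol t) i x - x)) by lra.
    unfold foot; field; lra.
Qed.

Lemma sol_has_dt (t x : R) (i : unknown) :
  in_strip T t -> has_dt T (fun t' y => sol t' i y) t x (velocity (sol t) (dsol t) i x).
Proof.
  intros Ht eps Heps; pose proof speed_pos as Hsp; pose proof consistency_pos as Hcp.
  unfold in_strip in Ht.
  destruct (dsol_continuous (Rabs x + 1) (eps / (4 * C))) as (d & Hd & Hm).
  { apply Rdiv_lt_0_compat; lra. }
  (* Collects the errors proportional to the increment: tangency, and the drift of source and speed
     between the times [a] and [t]. *)
  set (Q := consistency + C * speed * (K + 1)).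
  assert (HQ : 0 < Q) by (unfold Q; assert (0 < C * speed * (K + 1)) by
    (repeat apply Rmult_lt_0_compat; lra); lra).
  assert (HdC : 0 < d / (C + 1)) by (apply Rdiv_lt_0_compat; lra).
  assert (HeQ : 0 < eps / (4 * Q)) by (apply Rdiv_lt_0_compat; lra).
  assert (H1C : 0 < 1 / (C + 1)) by (apply Rdiv_lt_0_compat; lra).
  exists (Rmin (d / (C + 1)) (Rmin (eps / (4 * Q)) (1 / (C + 1)))); split.
  { repeat apply Rmin_glb_lt; auto. }
  intros h Hh0 Hth Hh; unfold in_strip in Hth.
  assert (Hs : 0 < Rabs h) by (apply Rabs_pos_lt; auto).
  pose proof (Rmin_l (d / (C + 1)) (Rmin (eps / (4 * Q)) (1 / (C + 1)))) as M1.
  pose proof (Rmin_r (d / (C + 1)) (Rmin (eps / (4 * Q)) (1 / (C + 1)))) as M2.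
  pose proof (Rmin_l (eps / (4 * Q)) (1 / (C + 1))) as M3.
  pose proof (Rmin_r (eps / (4 * Q)) (1 / (C + 1))) as M4.
  assert (S1 : Rabs h * (C + 1) <= d) by (apply Rle_div_r; lra).
  assert (S2 : Rabs h * (4 * Q) <= eps) by (apply Rle_div_r; lra).
  assert (S3 : Rabs h * (C + 1) <= 1) by (apply Rle_div_r; lra).
  set (s := Rabs h) in *.
  (* A negative increment is read as a forward step from [t + h] to [t], because the scheme only
     runs forward. *)
  assert (Hab : exists a, 0 <= a /\ a + s < T /\ Rabs (a - t) <= s /\
    (sol (t + h) i x - sol t i x) / h = (sol (a + s) i x - sol a i x) / s).
  { unfold s; destruct (Rle_dec 0 h) as [Hp|Hn].
    - exists t; rewrite !(Rabs_pos_eq h) by auto; repeat split; try lra.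
      rewrite Rminus_diag, Rabs_R0; auto.
    - exists (t + h).
      assert (Hnh : Rabs h = - h) by (apply Rabs_left; lra).
      repeat split; try lra.
      + replace (t + h - t) with h by ring; lra.
      + rewrite Hnh; replace (t + h + - h) with t by ring; field; auto. }
  destruct Hab as (a & Ha & Has & Hat & ->).
  destruct (sol_difference_quotient a s i x Ha Hs ltac:(lra)) as (c & Hc & Hdq).
  destruct (sol_good a ltac:(lra)) as [Ba _].
  destruct (sol_good t ltac:(lra)) as [Bt _].
  assert (Hcl : close (speed * s) (at_pt (sol a) x) (at_pt (sol t) x)).
  { intros j; eapply Rle_trans; [apply sol_time_lip_abs; lra|].
    apply Rmult_le_compat_l; lra. }
  assert (Hl := lam_lip i _ _ _ (Ba x) (Bt x) Hcl).
  assert (Hsr := src_lip i _ _ _ (Ba x) (Bt x) Hcl).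
  assert (Hla := lam_le i _ (Ba x)).
  assert (Hdt : Rabs (dsol t i x) <= K) by (apply (dsol_bounded t ltac:(lra) x i)).
  assert (Hdd : Rabs (dsol a i c - dsol t i x) <= eps / (4 * C)).
  { apply Hm; try lra; try nra.
    replace c with (x + (c - x)) by ring; pose proof (Rabs_triang x (c - x)); nra. }
  unfold velocity.
  match goal with |- Rabs (?e - _) < _ => set (q := e) in * end.
  match goal with |- Rabs ?e < _ => replace e with
    ((q - (src S i (at_pt (sol a) x) - lam S i (at_pt (sol a) x) * dsol a i c))
     + (src S i (at_pt (sol a) x) - src S i (at_pt (sol t) x))
     - (lam S i (at_pt (sol a) x) * (dsol a i c - dsol t i x)
        + (lam S i (at_pt (sol a) x) - lam S i (at_pt (sol t) x)) * dsol t i x)) by ring end.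
  apply Rle_lt_trans with (consistency * s + C * (speed * s)
    + (C * (eps / (4 * C)) + C * (speed * s) * K)).
  - apply Rabs_minus_le; apply Rabs_plus_le; auto; apply Rabs_mult_le; auto.
  - replace (C * (eps / (4 * C))) with (eps / 4) by (field; lra).
    replace (consistency * s + C * (speed * s) + (eps / 4 + C * (speed * s) * K))
      with (eps / 4 + s * (4 * Q) / 4) by (unfold Q; field); lra.
Qed.

End Scheme.

(** * Classical solutions of a diagonal system *)

(* Extends functions on a strip continuously to the plane, where the library's compactness results
   apply. *)
Definition clamp (t1 t : R) : R := Rmax 0 (Rmin t t1).

Lemma clamp_in (t1 t : R) : 0 <= t1 -> 0 <= clamp t1 t <= t1.
Proof.
  intros H; unfold clamp, Rmax, Rmin.
  destruct (Rle_dec t t1), (Rle_dec _ _); lra.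
Qed.

Lemma clamp_id (t1 t : R) : 0 <= t <= t1 -> clamp t1 t = t.
Proof. intros H; unfold clamp; rewrite Rmin_left, Rmax_right; lra. Qed.

Lemma clamp_lip (t1 t t' : R) :
  Rabs (clamp t1 t - clamp t1 t') <= Rabs (t - t').
Proof.
  unfold clamp, Rmax, Rmin.
  destruct (Rle_dec t t1), (Rle_dec t' t1); repeat destruct (Rle_dec _ _);
    unfold Rabs; repeat destruct Rcase_abs; lra.
Qed.

Lemma cont_strip_unif (T t1 r eps : R) (g : R -> R -> R) :
  cont_strip T g -> 0 <= t1 < T -> 0 < eps -> exists delta, 0 < delta /\
    forall t t' x x', 0 <= t <= t1 -> 0 <= t' <= t1 -> Rabs x <= r -> Rabs x' <= r ->
      Rabs (t - t') < delta -> Rabs (x - x') < delta -> Rabs (g t x - g t' x') < eps.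
Proof.
  intros Hg Ht1 He.
  destruct (cont2_unif (fun a b => g (clamp t1 a) b) 0 t1 (-r) r eps) as (d & Hd & Hu); auto.
  - intros a b e Hee.
    pose proof (clamp_in t1 a (proj1 Ht1)) as Hc.
    destruct (Hg (clamp t1 a) b) with (eps := e) as (d & Hd & H); [|auto|].
    + unfold in_strip; lra.
    + exists d; split; auto; intros a' b' Ha Hb; apply H; auto.
      * pose proof (clamp_in t1 a' (proj1 Ht1)); unfold in_strip; lra.
      * apply Rle_lt_trans with (2 := Ha), clamp_lip.
  - exists d; split; auto; intros t t' x x' Ht Ht' Hx Hx' Htt Hxx.
    specialize (Hu t' x' t x Ht'); rewrite !clamp_id in Hu by auto.
    apply Hu; auto; apply Rabs_le_between; auto.
Qed.

Lemma has_dt_mean_value (T : R) (g gt : R -> R -> R) (t s x : R) :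
  (forall t', in_strip T t' -> has_dt T g t' x (gt t' x)) ->
  0 <= t -> 0 < s -> t + s < T ->
  exists c, t < c < t + s /\ g (t + s) x - g t x = gt c x * s.
Proof.
  intros Hdt Ht Hs Hts.
  (* An affine extension to negative times with the slope at 0, so that the two-sided mean value
     theorem covers [t = 0]. *)
  set (G := fun a => if Rlt_dec a 0 then g 0 x + gt 0 x * a else g a x).
  destruct (MVT_cor2 G (fun a => gt a x) t (t + s)) as (c & Hc & Hct).
  - lra.
  - intros a Ha eps Heps.
    destruct (Hdt a) with (eps := eps) as (d & Hd & H); auto; [unfold in_strip; lra|].
    (* The increments must not leave the strip; for [a > 0] they must not reach the affine part
       either. *)
    assert (Hd' : exists d', 0 < d' <= d /\ d' <= T - a /\ (0 < a -> d' <= a)).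
    { destruct (Rle_lt_or_eq_dec 0 a ltac:(lra)).
      - exists (Rmin d (Rmin (T - a) a)).
        pose proof (Rmin_l d (Rmin (T - a) a)); pose proof (Rmin_r d (Rmin (T - a) a)).
        pose proof (Rmin_l (T - a) a); pose proof (Rmin_r (T - a) a).
        assert (0 < Rmin d (Rmin (T - a) a)) by (repeat apply Rmin_glb_lt; lra).
        repeat split; lra.
      - exists (Rmin d (T - a)).
        pose proof (Rmin_l d (T - a)); pose proof (Rmin_r d (T - a)).
        assert (0 < Rmin d (T - a)) by (repeat apply Rmin_glb_lt; lra).
        repeat split; lra. }
    destruct Hd' as (d' & Hd1 & Hd2 & Hd3).
    exists (mkposreal d' (proj1 Hd1)); intros h Hh0 Hh; simpl in Hh.
    pose proof Hh as Hhb; apply Rabs_lt_between in Hhb.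
    unfold G; destruct (Rlt_dec a 0) as [|Ha0]; [lra|].
    destruct (Rlt_dec (a + h) 0) as [Hn|Hp].
    + assert (a = 0)
        by (destruct (Rle_lt_or_eq_dec 0 a ltac:(lra)) as [Hl|]; [specialize (Hd3 Hl)|]; lra).
      subst a; rewrite Rplus_0_l.
      replace ((g 0 x + gt 0 x * h - g 0 x) / h - gt 0 x) with 0 by (field; auto).
      rewrite Rabs_R0; auto.
    + apply H; auto; [unfold in_strip; lra|lra].
  - exists c; split; auto.
    unfold G in Hc; destruct (Rlt_dec (t + s) 0), (Rlt_dec t 0); try lra.
Qed.

Lemma cont_strip_comp2 (T : R) (F g h : R -> R -> R) :
  cont2 F -> cont_strip T g -> cont_strip T h -> cont_strip T (fun t x => F (g t x) (h t x)).
Proof.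
  intros HF Hg Hh t x Ht eps He.
  destruct (HF (g t x) (h t x) eps He) as (d & Hd & H).
  destruct (Hg t x Ht d Hd) as (d1 & Hd1 & H1).
  destruct (Hh t x Ht d Hd) as (d2 & Hd2 & H2).
  exists (Rmin d1 d2); split; [apply Rmin_glb_lt; auto|].
  intros t' x' Ht' Htt Hxx.
  pose proof (Rmin_l d1 d2); pose proof (Rmin_r d1 d2).
  apply H; [apply H1|apply H2]; auto; lra.
Qed.

Lemma cont2_of_continuity_2d (g : R -> R -> R) : (forall a b, continuity_2d_pt g a b) -> cont2 g.
Proof.
  intros H a b eps He; destruct (H a b (mkposreal eps He)) as (d & Hd).
  exists d; split; [apply cond_pos|auto].
Qed.

Lemma cont2_mult : cont2 Rmult.
Proof.
  apply cont2_of_continuity_2d; intros a b.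
  apply (continuity_2d_pt_mult (fun u _ => u) (fun _ v => v));
    [apply continuity_2d_pt_id1|apply continuity_2d_pt_id2].
Qed.

Lemma cont2_minus : cont2 Rminus.
Proof.
  apply cont2_of_continuity_2d; intros a b.
  apply (continuity_2d_pt_minus (fun u _ => u) (fun _ v => v));
    [apply continuity_2d_pt_id1|apply continuity_2d_pt_id2].
Qed.

Lemma cont2_plus : cont2 Rplus.
Proof.
  apply cont2_of_continuity_2d; intros a b.
  apply (continuity_2d_pt_plus (fun u _ => u) (fun _ v => v));
    [apply continuity_2d_pt_id1|apply continuity_2d_pt_id2].
Qed.

Definition cont_strip_mult T g h := cont_strip_comp2 T Rmult g h cont2_mult.
Definition cont_strip_minus T g h := cont_strip_comp2 T Rminus g h cont2_minus.
Definition cont_strip_plus T g h := cont_strip_comp2 T Rplus g h cont2_plus.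

Lemma cont_strip_regular (T : R) (phi : state -> R) dphi (W : R -> field) :
  regular phi dphi -> (forall i, cont_strip T (fun t x => W t i x)) ->
  cont_strip T (fun t x => phi (at_pt (W t) x)).
Proof.
  intros (_ & Hch & Hb) HW t x Ht eps He.
  set (B := Rabs (W t Rho x) + Rabs (W t Vel x) + Rabs (W t En x) + 1).
  pose proof (Rabs_pos (W t Rho x)) as P1; pose proof (Rabs_pos (W t Vel x)) as P2;
    pose proof (Rabs_pos (W t En x)) as P3.
  destruct (Hb B) as (C & HC); pose proof (proj1 HC) as HC0.
  set (e := Rmin 1 (eps / (C + 1))).
  assert (Hee : 0 < e) by (apply Rmin_glb_lt; [lra|apply Rdiv_lt_0_compat; lra]).
  assert (He1 : e <= 1) by apply Rmin_l.
  assert (He2 : e * (C + 1) <= eps) by (apply Rle_div_r; [lra|apply Rmin_r]).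
  destruct (HW Rho t x Ht e Hee) as (d1 & Q1 & H1).
  destruct (HW Vel t x Ht e Hee) as (d2 & Q2 & H2).
  destruct (HW En t x Ht e Hee) as (d3 & Q3 & H3).
  exists (Rmin d1 (Rmin d2 d3)); split; [repeat apply Rmin_glb_lt; auto|].
  intros t' x' Ht' Htt Hxx.
  pose proof (Rmin_l d1 (Rmin d2 d3)); pose proof (Rmin_r d1 (Rmin d2 d3)).
  pose proof (Rmin_l d2 d3); pose proof (Rmin_r d2 d3).
  assert (Hcl : forall i, Rabs (W t' i x' - W t i x) < e)
    by (intros []; [apply H1|apply H2|apply H3]; auto; lra).
  assert (Hin : in_cube B (at_pt (W t) x)) by (intros []; unfold at_pt, B; lra).
  assert (Hin' : in_cube B (at_pt (W t') x')).
  { intros i; unfold at_pt.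
    replace (W t' i x') with (W t i x + (W t' i x' - W t i x)) by ring.
    replace B with (B - 1 + 1) by ring; apply Rabs_plus_le.
    - destruct i; unfold B; lra.
    - specialize (Hcl i); lra. }
  assert (HL : Rabs (phi (at_pt (W t') x') - phi (at_pt (W t) x)) <= C * e).
  { apply (regular_lipschitz phi dphi B C); auto.
    intros i; left; apply Hcl. }
  nra.
Qed.

(** * Tangency of arbitrary solutions to the scheme, and uniqueness *)

Section Solutions.

Context (S : diagonal_system).

(** The equation is the prescription of the time derivative by [velocity]; continuity of that
    derivative then follows in [sol_cont_dt]. *)
Record C1_solution (T : R) (W Wx : R -> field) : Prop := {
  sol_dx : forall t, in_strip T t -> derivative_of (W t) (Wx t);
  sol_dt : forall t x i, in_strip T t ->
    has_dt T (fun t' y => W t' i y) t x (velocity S (W t) (Wx t) i x);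
  sol_cont : forall i, cont_strip T (fun t x => W t i x);
  sol_cont_dx : forall i, cont_strip T (fun t x => Wx t i x) }.

Lemma sol_cont_dt (T : R) (W Wx : R -> field) (i : unknown) :
  C1_solution T W Wx -> cont_strip T (fun t x => velocity S (W t) (Wx t) i x).
Proof.
  intros [_ _ Hc Hcx]; unfold velocity.
  apply cont_strip_minus; [|apply cont_strip_mult; auto].
  - apply cont_strip_regular with (1 := src_regular S i); auto.
  - apply cont_strip_regular with (1 := lam_regular S i); auto.
Qed.

(** The mean value theorem in [t] and in [x] reduces the claim to uniform continuity of both
    derivatives on a compact set. With only C^1 regularity the error is o(s) rather than O(s^2). *)
Lemma solution_tangent (T t1 r L eps : R) (W Wx : R -> field) :
  C1_solution T W Wx -> 0 <= t1 < T -> 0 <= L -> 0 < eps -> exists delta, 0 < delta /\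
    forall t s x i, 0 <= t -> 0 < s <= delta -> t + s <= t1 -> Rabs x <= r ->
      Rabs (lam S i (at_pt (W t) x)) <= L ->
      Rabs (W (t + s) i x - step S s (W t) i x) <= s * eps.
Proof.
  intros HW Ht1 HL He.
  set (e := eps / (L + 1)).
  assert (Hee : 0 < e) by (apply Rdiv_lt_0_compat; lra).
  assert (Heq : e * (L + 1) = eps) by (unfold e; field; lra).
  assert (Hu : forall i, exists delta, 0 < delta /\
    forall t t' x x', 0 <= t <= t1 -> 0 <= t' <= t1 -> Rabs x <= r + L -> Rabs x' <= r + L ->
      Rabs (t - t') < delta -> Rabs (x - x') < delta ->
      Rabs (velocity S (W t) (Wx t) i x - velocity S (W t') (Wx t') i x') <= e /\
      Rabs (Wx t i x - Wx t' i x') <= e).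
  { intros i.
    destruct (cont_strip_unif T t1 (r + L) e _ (sol_cont_dt _ _ _ i HW) Ht1 Hee) as (d1 & P1 & H1).
    destruct (cont_strip_unif T t1 (r + L) e _ (sol_cont_dx _ _ _ HW i) Ht1 Hee) as (d2 & P2 & H2).
    exists (Rmin d1 d2); split; [apply Rmin_glb_lt; auto|].
    intros t t' x x' Ht Ht' Hx Hx' Htt Hxx.
    pose proof (Rmin_l d1 d2); pose proof (Rmin_r d1 d2).
    split; left; [apply H1|apply H2]; auto; lra. }
  assert (Hall : exists delta, 0 < delta <= 1 /\ forall i,
    forall t t' x x', 0 <= t <= t1 -> 0 <= t' <= t1 -> Rabs x <= r + L -> Rabs x' <= r + L ->
      Rabs (t - t') < delta -> Rabs (x - x') < delta ->
      Rabs (velocity S (W t) (Wx t) i x - velocity S (W t') (Wx t') i x') <= e /\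
      Rabs (Wx t i x - Wx t' i x') <= e).
  { destruct (Hu Rho) as (d1 & P1 & H1); destruct (Hu Vel) as (d2 & P2 & H2);
      destruct (Hu En) as (d3 & P3 & H3).
    set (d := Rmin 1 (Rmin d1 (Rmin d2 d3))).
    assert (Q0 : d <= 1) by apply Rmin_l.
    assert (Q : d <= Rmin d1 (Rmin d2 d3)) by apply Rmin_r.
    pose proof (Rmin_l d1 (Rmin d2 d3)); pose proof (Rmin_r d1 (Rmin d2 d3)).
    pose proof (Rmin_l d2 d3); pose proof (Rmin_r d2 d3).
    exists d; split; [split; auto; repeat apply Rmin_glb_lt; lra|].
    intros i t t' x x' Ht Ht' Hx Hx' Htt Hxx.
    destruct i; [apply H1|apply H2|apply H3]; auto; lra. }
  destruct Hall as (d & Hd & H).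
  (* Keeps both [s] and the displacement [s * L] of the foot below [d]; as [d <= 1], the foot stays
     within [r + L]. *)
  exists (d / (2 * (L + 1))); split; [apply Rdiv_lt_0_compat; lra|].
  intros t s x i Ht Hs Hts Hx Hlam.
  assert (HsL : s * (2 * (L + 1)) <= d) by (apply Rle_div_r; [lra|apply Hs]).
  destruct (has_dt_mean_value T (fun t' y => W t' i y)
     (fun t' y => velocity S (W t') (Wx t') i y) t s x) as (c & Hc & Hmt); try lra.
  { intros t' Ht'; apply (sol_dt _ _ _ HW); auto. }
  destruct (mean_value (W t i) (Wx t i) x (foot S s (W t) i x)) as (xi & Hxi & Hmx).
  { apply (sol_dx _ _ _ HW); unfold in_strip; lra. }
  set (l := lam S i (at_pt (W t) x)) in *.
  assert (Hfoot : foot S s (W t) i x = x - s * l) by reflexivity.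
  assert (Hsl : Rabs (s * l) <= s * L) by (apply Rabs_mult_le; [rewrite Rabs_pos_eq|]; lra).
  assert (HsL0 : 0 <= s * L) by nra.
  assert (Hxix : Rabs (xi - x) <= s * L).
  { rewrite Hfoot in Hxi; apply Rabs_le_between in Hsl; apply Rabs_le_between.
    revert Hxi; unfold Rmin, Rmax; destruct (Rle_dec x (x - s * l)); lra. }
  assert (Hxir : Rabs xi <= r + L).
  { replace xi with (x + (xi - x)) by ring; apply Rabs_plus_le; auto; nra. }
  assert (Hxr : Rabs x <= r + L) by lra.
  destruct (H i c t x x) as (E1 & _); try lra.
  { rewrite Rabs_pos_eq; nra. }
  { rewrite Rminus_diag, Rabs_R0; lra. }
  destruct (H i t t xi x) as (_ & E2); try lra.
  { rewrite Rminus_diag, Rabs_R0; lra. }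
  unfold step; rewrite Hfoot in *.
  replace (W (t + s) i x) with (W t i x + velocity S (W c) (Wx c) i x * s) by lra.
  replace (W t i (x - s * l)) with (W t i x + Wx t i xi * (x - s * l - x)) by lra.
  match goal with |- Rabs ?q <= _ => replace q with
    (s * ((velocity S (W c) (Wx c) i x - velocity S (W t) (Wx t) i x)
          + l * (Wx t i xi - Wx t i x))) by (unfold velocity; fold l; ring) end.
  apply Rabs_mult_le; [rewrite Rabs_pos_eq; lra|].
  rewrite <- Heq; replace (e * (L + 1)) with (e + L * e) by ring.
  apply Rabs_plus_le; auto; apply Rabs_mult_le; auto.
Qed.

(** Per step, the tangency errors of the two solutions add [s * (2 * eps)] and stability multiplies
    the gap by [1 + s * A]. The total is proportional to [eps], which is arbitrary. *)
Lemma solution_unique (B C K T : R) (U Ux V Vx : R -> field) :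
  system_bounds S B C -> 0 < C -> 1 <= K ->
  C1_solution T U Ux -> C1_solution T V Vx ->
  (forall t, in_strip T t -> good B K (U t)) -> (forall t, in_strip T t -> good B K (V t)) ->
  (forall i x, U 0 i x = V 0 i x) ->
  forall t i x, in_strip T t -> U t i x = V t i x.
Proof.
  intros Hbd HC HK HU HV GU GV H0 t i x0 Ht.
  unfold in_strip in Ht.
  destruct (Rle_lt_or_eq_dec 0 t (proj1 Ht)) as [Htp|<-]; [|auto].
  set (A := C * (K + 1)).
  assert (HA : 0 < A) by (unfold A; nra).
  assert (Heps : forall eps, 0 < eps -> Rabs (U t i x0 - V t i x0) <= exp (A * t) * (t * (2 * eps))).
  { intros eps He.
    (* The base at time 0 of the cone that has shrunk to [Rabs x0] at time [t]. *)
    set (r := Rabs x0 + t * C).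
    destruct (solution_tangent T t r C eps U Ux HU Ht) as (d1 & P1 & H1); [lra|auto|].
    destruct (solution_tangent T t r C eps V Vx HV Ht) as (d2 & P2 & H2); [lra|auto|].
    destruct (nfloor_ex (t / Rmin d1 d2)) as (n & _ & Hn).
    { left; apply Rdiv_lt_0_compat; [auto|apply Rmin_glb_lt; auto]. }
    rewrite <- S_INR in Hn; set (N := Datatypes.S n) in *.
    assert (HN : 0 < INR N) by (apply lt_0_INR; unfold N; lia).
    set (s := t / INR N).
    assert (Hs : 0 < s) by (apply Rdiv_lt_0_compat; auto).
    assert (Hsd : s < Rmin d1 d2).
    { apply Rlt_div_l in Hn; [|apply Rmin_glb_lt; auto].
      apply Rlt_div_l; [auto|lra]. }
    pose proof (Rmin_l d1 d2); pose proof (Rmin_r d1 d2).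
    assert (HNs : INR N * s = t) by (unfold s; field; lra).
    assert (Hind : forall k, (k <= N)%nat -> forall j x, Rabs x <= r - INR k * s * C ->
      Rabs (U (INR k * s) j x - V (INR k * s) j x) <= growth A 0 (2 * eps) (INR k * s)).
    { induction k as [|k IH]; intros Hk j x Hx.
      - simpl; rewrite Rmult_0_l, growth_0, H0, Rminus_diag, Rabs_R0; lra.
      - specialize (IH ltac:(lia)).
        assert (HkN : INR (Datatypes.S k) <= INR N) by (apply le_INR; auto).
        rewrite S_INR in *.
        pose proof (pos_INR k).
        replace ((INR k + 1) * s) with (INR k * s + s) in * by ring.
        assert (0 <= INR k * s) by nra.
        assert (INR k * s + s <= t) by nra.
        set (tk := INR k * s) in *.
        assert (Hks : in_strip T tk) by (unfold in_strip; lra).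
        destruct (GU tk Hks) as [BU LU]; destruct (GV tk Hks) as [BV LV].
        assert (HsC : 0 < s * C) by nra.
        assert (HtC : 0 <= tk * C) by nra.
        assert (E1 : Rabs (U (tk + s) j x - step S s (U tk) j x) <= s * eps).
        { apply H1; try lra. apply (lam_le S B C); auto. }
        assert (E2 : Rabs (V (tk + s) j x - step S s (V tk) j x) <= s * eps).
        { apply H2; try lra. apply (lam_le S B C); auto. }
        assert (E3 : Rabs (step S s (U tk) j x - step S s (V tk) j x)
                     <= (1 + s * A) * growth A 0 (2 * eps) tk).
        { apply (step_stable S B C K); auto; try lra.
          - intros j'; apply IH; lra.
          - apply IH; apply (foot_in S B C); auto; lra. }
        eapply Rle_trans; [|apply growth_step; lra].
        replace (U (tk + s) j x - V (tk + s) j x) with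
          ((step S s (U tk) j x - step S s (V tk) j x)
           + ((U (tk + s) j x - step S s (U tk) j x) - (V (tk + s) j x - step S s (V tk) j x))) by ring.
        apply Rabs_plus_le; auto.
        replace (s * (2 * eps)) with (s * eps + s * eps) by ring; apply Rabs_minus_le; auto. }
    specialize (Hind N (le_n _) i x0); rewrite HNs in Hind.
    eapply Rle_trans; [apply Hind; unfold r; lra|unfold growth; right; ring]. }
  apply Rminus_diag_uniq, Rabs_eq_0, Rle_antisym; [|apply Rabs_pos].
  apply Rnot_lt_le; intros Hlt.
  (* With [eps] equal to the gap divided by [Q], the estimate bounds a positive gap by half of
     itself. *)
  set (Q := exp (A * t) * (t * 4)).
  assert (HQ : 0 < Q) by (unfold Q; apply Rmult_lt_0_compat; [apply exp_pos|lra]).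
  specialize (Heps (Rabs (U t i x0 - V t i x0) / Q) ltac:(apply Rdiv_lt_0_compat; auto)).
  replace (exp (A * t) * (t * (2 * (Rabs (U t i x0 - V t i x0) / Q))))
    with (Rabs (U t i x0 - V t i x0) / 2) in Heps; [lra|].
  unfold Q; field; pose proof (exp_pos (A * t)); split; lra.
Qed.

(** * Restriction, time shift and gluing of solutions *)

Lemma has_dt_transfer (T T' a eta : R) (g g' : R -> R -> R) (t x v : R) :
  0 < eta -> in_strip T t ->
  (forall t', in_strip T t' -> Rabs (t' - t) < eta ->
     in_strip T' (t' - a) /\ g t' x = g' (t' - a) x) ->
  has_dt T' g' (t - a) x v -> has_dt T g t x v.
Proof.
  intros Heta Ht Hloc Hdt eps He.
  destruct (Hdt eps He) as (d & Hd & H).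
  exists (Rmin d eta); split; [apply Rmin_glb_lt; auto|].
  intros h Hh0 Hth Hh; pose proof (Rmin_l d eta); pose proof (Rmin_r d eta).
  destruct (Hloc t Ht) as (_ & E1); [rewrite Rminus_diag, Rabs_R0; auto|].
  destruct (Hloc (t + h) Hth) as (Hs & E2); [replace (t + h - t) with h by ring; lra|].
  rewrite E1, E2; replace (t + h - a) with (t - a + h) in * by ring.
  apply H; auto; lra.
Qed.

Lemma cont_strip_transfer (T : R) (g : R -> R -> R) :
  (forall t, in_strip T t -> exists T' a eta g', 0 < eta /\ cont_strip T' g' /\
     forall t', in_strip T t' -> Rabs (t' - t) < eta ->
       in_strip T' (t' - a) /\ forall x, g t' x = g' (t' - a) x) ->
  cont_strip T g.
Proof.
  intros Hloc t x Ht eps He.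
  destruct (Hloc t Ht) as (T' & a & eta & g' & Heta & Hc & Heq).
  destruct (Heq t Ht) as (Hs & E1); [rewrite Rminus_diag, Rabs_R0; auto|].
  destruct (Hc (t - a) x Hs eps He) as (d & Hd & H).
  exists (Rmin d eta); split; [apply Rmin_glb_lt; auto|].
  intros t' x' Ht' Htt Hxx; pose proof (Rmin_l d eta); pose proof (Rmin_r d eta).
  destruct (Heq t' Ht') as (Hs' & E2); [lra|].
  rewrite E1, E2; apply H; auto; try lra.
  replace (t' - a - (t - a)) with (t' - t) by ring; lra.
Qed.

(** Being a solution is local in time and invariant under time translation; shifting, restricting
    and gluing are instances. *)
Lemma C1_solution_transfer (T : R) (W Wx : R -> field) :
  (forall t, in_strip T t -> exists T' a eta W' Wx', 0 < eta /\ C1_solution T' W' Wx' /\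
     forall t', in_strip T t' -> Rabs (t' - t) < eta ->
       in_strip T' (t' - a) /\ (forall i x, W t' i x = W' (t' - a) i x)
       /\ (forall i x, Wx t' i x = Wx' (t' - a) i x)) ->
  C1_solution T W Wx.
Proof.
  intros Hloc.
  assert (Hz : forall t, Rabs (t - t) = 0) by (intros; rewrite Rminus_diag; apply Rabs_R0).
  split.
  - intros t Ht i x.
    destruct (Hloc t Ht) as (T' & a & eta & W' & Wx' & Heta & HW & Heq).
    destruct (Heq t Ht) as (Hs & E1 & E2); [rewrite Hz; auto|].
    rewrite E2; apply is_derive_ext with (W' (t - a) i); [intros y; auto|].
    apply (sol_dx _ _ _ HW); auto.
  - intros t x i Ht.
    destruct (Hloc t Ht) as (T' & a & eta & W' & Wx' & Heta & HW & Heq).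
    destruct (Heq t Ht) as (Hs & E1 & E2); [rewrite Hz; auto|].
    apply has_dt_transfer with (T' := T') (a := a) (eta := eta) (g' := fun t' y => W' t' i y); auto.
    + intros t' Ht' Htt; destruct (Heq t' Ht' Htt) as (Q1 & Q2 & _); auto.
    + replace (velocity S (W t) (Wx t) i x) with (velocity S (W' (t - a)) (Wx' (t - a)) i x).
      * apply (sol_dt _ _ _ HW); auto.
      * unfold velocity; rewrite E2; replace (at_pt (W t) x) with (at_pt (W' (t - a)) x); auto.
        apply functional_extensionality; intros j; symmetry; apply E1.
  - intros i; apply cont_strip_transfer; intros t Ht.
    destruct (Hloc t Ht) as (T' & a & eta & W' & Wx' & Heta & HW & Heq).
    exists T', a, eta, (fun t' y => W' t' i y); split; [auto|split; [apply (sol_cont _ _ _ HW)|]].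
    intros t' Ht' Htt; destruct (Heq t' Ht' Htt) as (Q1 & Q2 & _); auto.
  - intros i; apply cont_strip_transfer; intros t Ht.
    destruct (Hloc t Ht) as (T' & a & eta & W' & Wx' & Heta & HW & Heq).
    exists T', a, eta, (fun t' y => Wx' t' i y); split; [auto|split; [apply (sol_cont_dx _ _ _ HW)|]].
    intros t' Ht' Htt; destruct (Heq t' Ht' Htt) as (Q1 & _ & Q2); auto.
Qed.

Lemma C1_solution_shift (T T' t0 : R) (W Wx : R -> field) :
  0 <= t0 -> t0 + T' <= T -> C1_solution T W Wx ->
  C1_solution T' (fun t => W (t0 + t)) (fun t => Wx (t0 + t)).
Proof.
  intros Ht0 HT HW; apply C1_solution_transfer; intros t Ht.
  exists T, (- t0), 1, W, Wx; split; [lra|split; [auto|]].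
  unfold in_strip in *; intros t' Ht' _; replace (t' - - t0) with (t0 + t') by ring.
  repeat split; auto; lra.
Qed.

Lemma C1_solution_glue (T1 t0 d : R) (U Ux V Vx : R -> field) :
  0 <= t0 < T1 -> T1 < t0 + d -> C1_solution T1 U Ux -> C1_solution d V Vx ->
  (forall t i x, t0 <= t < T1 -> U t i x = V (t - t0) i x) ->
  C1_solution (t0 + d) (fun t => if Rlt_dec t T1 then U t else V (t - t0))
                       (fun t => if Rlt_dec t T1 then Ux t else Vx (t - t0)).
Proof.
  intros Ht0 Hd HU HV Heq.
  assert (Heqx : forall t i x, t0 <= t < T1 -> Ux t i x = Vx (t - t0) i x).
  { intros t i x Ht.
    rewrite <- (is_derive_unique (U t i) x (Ux t i x))
      by (apply (sol_dx _ _ _ HU); unfold in_strip; lra).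
    apply is_derive_unique.
    apply is_derive_ext with (V (t - t0) i); [intros y; symmetry; auto|].
    apply (sol_dx _ _ _ HV); unfold in_strip; lra. }
  apply C1_solution_transfer; unfold in_strip; intros t Ht.
  destruct (Rlt_dec t T1) as [Hlt|Hge].
  - exists T1, 0, (T1 - t), U, Ux; split; [lra|split; [auto|]].
    intros t' Ht' Htt; apply Rabs_lt_between in Htt; rewrite Rminus_0_r.
    destruct (Rlt_dec t' T1); [repeat split; auto; lra|lra].
  (* This radius keeps [t'] above [t0], so even for [t' < T1] the first piece may be replaced by the
     second. *)
  - exists d, t0, (t - t0), V, Vx; split; [lra|split; [auto|]].
    intros t' Ht' Htt; apply Rabs_lt_between in Htt.
    split; [lra|].
    destruct (Rlt_dec t' T1); split; intros i x; auto; [apply Heq|apply Heqx]; lra.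
Qed.

Lemma scheme_C1_solution (B C K M T : R) (w0 p0 : field) :
  system_bounds S B C -> 0 < C -> 1 <= K -> B = M + 1 -> K = M + 1 -> 0 < T ->
  T * (C * K * (K + 1)) <= 1 -> derivative_of w0 p0 -> bounded_by M w0 -> bounded_by M p0 ->
  (forall i x, continuous (p0 i) x) ->
  C1_solution T (sol S w0) (dsol S w0).
Proof.
  intros Hbd HC HK HB HKM HT HTC Hd0 Hw0 Hp0 Hc0; split.
  - unfold in_strip; intros t Ht; apply (dsol_derivative S B C K Hbd HC HK M T w0 p0); auto; lra.
  - intros t x i Ht; eapply (sol_has_dt S B C K); eauto.
  - unfold cont_strip, in_strip; intros i t x Ht eps He.
    assert (Hs := speed_pos C K HC HK).
    set (Q := speed C K + K).
    assert (HQ : 0 < Q) by (unfold Q; lra).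
    exists (eps / Q); split; [apply Rdiv_lt_0_compat; auto|].
    intros t' x' Ht' Htt Hxx.
    apply Rlt_div_r in Htt; [|auto]; apply Rlt_div_r in Hxx; [|auto].
    assert (E1 : Rabs (sol S w0 t' i x' - sol S w0 t i x') <= speed C K * Rabs (t' - t))
      by (apply (sol_time_lip_abs S B C K Hbd HC HK M T w0 p0); auto; lra).
    assert (E2 : Rabs (sol S w0 t i x' - sol S w0 t i x) <= K * Rabs (x' - x)).
    { assert (HG : good B K (sol S w0 t)) by (apply (sol_good S B C K Hbd HC HK M T w0 p0); auto; lra).
      apply HG. }
    replace (sol S w0 t' i x' - sol S w0 t i x) with
      ((sol S w0 t' i x' - sol S w0 t i x') + (sol S w0 t i x' - sol S w0 t i x)) by ring.
    eapply Rle_lt_trans; [apply Rabs_plus_le; [apply E1|apply E2]|].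
    apply Rmult_lt_reg_r with Q; auto.
    replace ((speed C K * Rabs (t' - t) + K * Rabs (x' - x)) * Q)
      with (speed C K * (Rabs (t' - t) * Q) + K * (Rabs (x' - x) * Q)) by ring.
    replace (eps * Q) with (speed C K * eps + K * eps) by (unfold Q; ring).
    apply Rplus_lt_compat; apply Rmult_lt_compat_l; lra.
  - unfold cont_strip, in_strip; intros i t x Ht eps He.
    destruct (dsol_continuous S B C K Hbd HC HK M T w0 p0 HB HKM HT HTC Hd0 Hw0 Hp0 Hc0
                (Rabs x + 1) (eps / 2)) as (d & Hd & H); [lra|].
    exists (Rmin d 1); split; [apply Rmin_glb_lt; lra|].
    intros t' x' Ht' Htt Hxx; pose proof (Rmin_l d 1); pose proof (Rmin_r d 1).
    apply Rle_lt_trans with (eps / 2); [|lra].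
    apply H; try lra.
    replace x' with (x + (x' - x)) by ring; pose proof (Rabs_triang x (x' - x)); lra.
Qed.

End Solutions.

Lemma Ck2_S (k : nat) (g : R -> R -> R) : Ck2 (S k) g -> Ck2 k g.
Proof.
  revert g; induction k as [|k IH]; intros g (Hg & g1 & g2 & H1 & H2 & K1 & K2); [auto|].
  split; [auto|exists g1, g2; auto].
Qed.

(** * The system for (rho, u, e) *)

Section Pressureless.

Context (f f1 f2 f11 f12 f21 f22 : R -> R -> R).
Context (Cf : cont2 f) (Cf1 : cont2 f1) (Cf2 : cont2 f2).
Context (Rf : regular (fun v => f (v Rho) (v Vel))
                (fun v q => f1 (v Rho) (v Vel) * q Rho + f2 (v Rho) (v Vel) * q Vel)).
Context (Rf1 : regular (fun v => f1 (v Rho) (v Vel))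
                 (fun v q => f11 (v Rho) (v Vel) * q Rho + f12 (v Rho) (v Vel) * q Vel)).
Context (Rf2 : regular (fun v => f2 (v Rho) (v Vel))
                 (fun v q => f21 (v Rho) (v Vel) * q Rho + f22 (v Rho) (v Vel) * q Vel)).

Definition lam_f (i : unknown) (v : state) : R :=
  match i with
  | Rho => f (v Rho) (v Vel) + v Rho * f1 (v Rho) (v Vel)
  | _ => v Vel
  end.

Definition dlam_f (i : unknown) (v q : state) : R :=
  match i with
  | Rho => f1 (v Rho) (v Vel) * q Rho + f2 (v Rho) (v Vel) * q Vel
           + (q Rho * f1 (v Rho) (v Vel)
              + v Rho * (f11 (v Rho) (v Vel) * q Rho + f12 (v Rho) (v Vel) * q Vel))
  | _ => q Vel
  end.

(** For [Rho], the part rho f_u u_x of the flux derivative has moved here with u_x written as e -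
    rho, which makes it free of derivatives. *)
Definition src_f (i : unknown) (v : state) : R :=
  match i with
  | Rho => - (v Rho * f2 (v Rho) (v Vel) * (v En - v Rho))
  | Vel => v Rho * (f (v Rho) (v Vel) - v Vel)
  | En => - (v En * (v En - v Rho))
  end.

Definition dsrc_f (i : unknown) (v q : state) : R :=
  match i with
  | Rho => - ((q Rho * f2 (v Rho) (v Vel)
               + v Rho * (f21 (v Rho) (v Vel) * q Rho + f22 (v Rho) (v Vel) * q Vel))
                * (v En - v Rho)
              + v Rho * f2 (v Rho) (v Vel) * (q En - q Rho))
  | Vel => q Rho * (f (v Rho) (v Vel) - v Vel)
           + v Rho * (f1 (v Rho) (v Vel) * q Rho + f2 (v Rho) (v Vel) * q Vel - q Vel)
  | En => - (q En * (v En - v Rho) + v En * (q En - q Rho))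
  end.

Lemma lam_f_regular (i : unknown) : regular (lam_f i) (dlam_f i).
Proof.
  destruct i; [|apply (regular_coord Vel)|apply (regular_coord Vel)].
  exact (regular_plus _ _ _ _ Rf (regular_mult _ _ _ _ (regular_coord Rho) Rf1)).
Qed.

Lemma src_f_regular (i : unknown) : regular (src_f i) (dsrc_f i).
Proof.
  destruct i.
  - exact (regular_opp _ _ (regular_mult _ _ _ _ (regular_mult _ _ _ _ (regular_coord Rho) Rf2)
      (regular_minus _ _ _ _ (regular_coord En) (regular_coord Rho)))).
  - exact (regular_mult _ _ _ _ (regular_coord Rho) (regular_minus _ _ _ _ Rf (regular_coord Vel))).
  - exact (regular_opp _ _ (regular_mult _ _ _ _ (regular_coord En)
      (regular_minus _ _ _ _ (regular_coord En) (regular_coord Rho)))).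
Qed.

Definition sys_f : diagonal_system :=
  {| lam := lam_f; src := src_f; dlam := dlam_f; dsrc := dsrc_f;
     lam_regular := lam_f_regular; src_regular := src_f_regular |}.

(** * Propagation of the constraint u_x = e - rho *)

Definition defect (w p : field) (x : R) : R := p Vel x - w En x + w Rho x.

Section Defect.

Context (B C K : R).
Context (Hbd : system_bounds sys_f B C) (HC : 0 < C) (HK : 1 <= K).

(** For smooth solutions of the diagonal system z = u_x - e + rho obeys z_t + u z_x = (rho f_u - u_x
    - e) z. The scheme reproduces this: [Vel] and [En] share a foot, [w Rho] is moved to it by the
    mean value theorem, and derivatives at nearby points are exchanged at the price of [eps]. *)
Lemma defect_step (h eps delta r : R) (w p : field) (x : R) :
  0 <= h -> derivative_of w p -> bounded_by B w -> bounded_by K p ->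
  h * C <= delta -> modulus r delta eps p -> Rabs x <= r - h * C ->
  Rabs (defect (step sys_f h w) (dstep sys_f h w p) x)
    <= Rabs (defect w p (foot sys_f h w Vel x)) + h * (C + 2 * B + K) * Rabs (defect w p x)
       + h * (eps * (K + 2 * C)).
Proof.
  intros Hh Hd Hw Hp Hdelta Hm Hx.
  set (x' := foot sys_f h w Vel x).
  set (x'' := foot sys_f h w Rho x).
  destruct (mean_value (w Rho) (p Rho) x' x'' (Hd Rho)) as (c & Hc & Hmv).
  assert (Hx' := foot_close sys_f B C Hbd h w Vel x Hh Hw : Rabs (x' - x) <= h * C).
  assert (Hx'' := foot_close sys_f B C Hbd h w Rho x Hh Hw : Rabs (x'' - x) <= h * C).
  assert (Hcx : Rabs (c - x) <= h * C).
  { apply Rabs_le_between in Hx'; apply Rabs_le_between in Hx''; apply Rabs_le_between.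
    revert Hc; unfold Rmin, Rmax; destruct (Rle_dec x' x''); lra. }
  assert (HhC : 0 <= h * C) by nra.
  assert (Hin : forall y, Rabs (y - x) <= h * C -> Rabs y <= r).
  { intros y Hy; replace y with (x + (y - x)) by ring.
    replace r with (r - h * C + h * C) by ring; apply Rabs_plus_le; auto. }
  assert (E1 : Rabs (p Vel x' - p Vel x) <= eps).
  { apply (Hm x' x); [apply Hin; auto|lra|lra]. }
  assert (E2 : Rabs (p Rho c - p Rho x) <= eps).
  { apply (Hm c x); [apply Hin; auto|lra|lra]. }
  assert (Hx0 := Hw x).
  set (v := at_pt w x) in *.
  assert (L1 : Rabs (lam_f Rho v) <= C) by (apply (lam_le sys_f B C Hbd Rho); auto).
  assert (L2 : Rabs (lam_f Vel v) <= C) by (apply (lam_le sys_f B C Hbd Vel); auto).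
  (* The derivative of this source in the direction of u is rho f_u - rho; it yields a bound on rho
     f_u from the system bounds. *)
  assert (L3 : Rabs (dsrc_f Vel v (fun j => match j with Vel => 1 | _ => 0 end)) <= C * 1).
  { apply (dsrc_le sys_f B C Hbd Vel); auto.
    intros []; rewrite ?Rabs_R0, ?Rabs_R1; lra. }
  set (z := defect w p x).
  assert (Rh : Rabs h <= h) by (rewrite Rabs_pos_eq; lra).
  assert (Key : defect (step sys_f h w) (dstep sys_f h w p) x =
     defect w p x'
     + h * (v Rho * f2 (v Rho) (v Vel) - p Vel x - v En) * z
     - h * ((p Vel x' - p Vel x) * p Vel x + (lam_f Rho v - lam_f Vel v) * (p Rho c - p Rho x))).
  { assert (F1 : step sys_f h w Rho x = w Rho x'' + h * src_f Rho v) by reflexivity.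
    assert (F2 : step sys_f h w En x = w En x' + h * src_f En v) by reflexivity.
    assert (F3 : dstep sys_f h w p Vel x
                 = p Vel x' * (1 - h * p Vel x) + h * dsrc_f Vel v (at_pt p x)) by reflexivity.
    unfold defect at 1; rewrite F1, F2, F3.
    replace (w Rho x'') with (w Rho x' + p Rho c * (x'' - x')) by lra.
    replace (x'' - x') with (- (h * (lam_f Rho v - lam_f Vel v)))
      by (unfold x', x'', foot; fold v; change (lam sys_f) with lam_f; ring).
    unfold z, defect, src_f, dsrc_f, lam_f, v, at_pt; ring. }
  rewrite Key.
  replace (h * (eps * (K + 2 * C))) with (h * (eps * K + (C + C) * eps)) by ring.
  apply Rabs_minus_le; [apply Rabs_plus_le; [lra|]|].
  - rewrite Rabs_mult; apply Rmult_le_compat_r; [apply Rabs_pos|].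
    apply Rabs_mult_le; auto.
    pose proof (Hp x Vel) as P1; unfold at_pt in P1.
    pose proof (Hx0 En) as P2; pose proof (Hx0 Rho) as P3.
    unfold dsrc_f in L3.
    match type of L3 with Rabs ?e <= _ =>
      replace (v Rho * f2 (v Rho) (v Vel) - p Vel x - v En) with (e + v Rho - p Vel x - v En) by ring end.
    replace (C + 2 * B + K) with (C * 1 + B + K + B) by ring.
    repeat first [apply Rabs_minus_le|apply Rabs_plus_le]; auto.
  - apply Rabs_mult_le; auto.
    apply Rabs_plus_le; apply Rabs_mult_le; auto; [apply (Hp x Vel)|apply Rabs_minus_le; auto].
Qed.

Context (M T : R) (w0 p0 : field).
Context (HB : B = M + 1) (HKM : K = M + 1).
Context (HT : 0 < T) (HTC : T * (C * K * (K + 1)) <= 1).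
Context (Hd0 : derivative_of w0 p0) (Hw0 : bounded_by M w0) (Hp0 : bounded_by M p0).
Context (Hc0 : forall i x, continuous (p0 i) x).
Context (Hdef0 : forall x, p0 Vel x = w0 En x - w0 Rho x).

Lemma defect_approx (r delta eps h : R) (k : nat) :
  0 <= h -> 0 <= eps -> h * C <= delta -> INR k * h <= T ->
  (forall j, INR j * h <= T -> modulus r delta eps (dapprox sys_f h j w0 p0)) ->
  forall x, Rabs x <= r - INR k * h * C ->
    Rabs (defect (approx sys_f h k w0) (dapprox sys_f h k w0 p0) x)
      <= growth (C + 2 * B + K) 0 (eps * (K + 2 * C)) (INR k * h).
Proof.
  intros Hh Heps Hdelta Hk Hm; induction k as [|k IH]; intros x Hx.
  - simpl; rewrite Rmult_0_l, growth_0; unfold defect; rewrite Hdef0.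
    replace (w0 En x - w0 Rho x - w0 En x + w0 Rho x) with 0 by ring; rewrite Rabs_R0; lra.
  - rewrite S_INR in *; simpl approx; simpl dapprox.
    assert (HkT : INR k * h <= T) by lra.
    assert (Hkh : 0 <= INR k * h) by (apply Rmult_le_pos; auto using pos_INR).
    assert (HhC : 0 <= h * C) by nra.
    assert (HkC : 0 <= INR k * h * C) by (apply Rmult_le_pos; lra).
    assert (Hg := approx_good sys_f B C K Hbd HC HK M T w0 p0 HB HKM HT HTC Hd0 Hw0 Hp0 h k Hh HkT).
    assert (Hp := dapprox_le sys_f B C K Hbd HC HK M T w0 p0 HB HKM HT HTC Hw0 Hp0 h k Hh HkT).
    eapply Rle_trans.
    + apply (defect_step h eps delta r); auto; try lra.
      * apply dapprox_derivative; auto.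
      * apply Hg.
    + replace ((INR k + 1) * h) with (INR k * h + h) by ring.
      assert (HB0 : 0 <= B) by (eapply in_cube_nonneg; apply (proj1 Hg 0)).
      eapply Rle_trans; [|apply growth_step; auto; try lra; apply Rmult_le_pos; lra].
      specialize (IH HkT).
      assert (I1 : Rabs x <= r - INR k * h * C) by lra.
      assert (I2 : Rabs (foot sys_f h (approx sys_f h k w0) Vel x) <= r - INR k * h * C).
      { apply (foot_in sys_f B C Hbd); auto; [apply Hg|lra]. }
      apply IH in I1; apply IH in I2.
      assert (0 <= h * (C + 2 * B + K)) by (apply Rmult_le_pos; lra).
      rewrite Rmult_plus_distr_r, Rmult_1_l.
      repeat apply Rplus_le_compat; auto; [|lra].
      apply Rmult_le_compat_l; auto.
Qed.

Lemma defect_sol (t x : R) :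
  0 <= t <= T -> dsol sys_f w0 t Vel x = sol sys_f w0 t En x - sol sys_f w0 t Rho x.
Proof.
  intros Ht.
  assert (Hs : forall i, is_lim_seq (fun n => polygon sys_f w0 n t i x) (sol sys_f w0 t i x))
    by (intros i; eapply (sol_limit sys_f B C K); eauto).
  assert (Hds : is_lim_seq (fun n => dpolygon sys_f w0 p0 n t Vel x) (dsol sys_f w0 t Vel x))
    by (eapply (dsol_limit sys_f B C K); eauto).
  set (z := fun n => defect (polygon sys_f w0 n t) (dpolygon sys_f w0 p0 n t) x).
  assert (Hz : is_lim_seq z (dsol sys_f w0 t Vel x - sol sys_f w0 t En x + sol sys_f w0 t Rho x)).
  { apply is_lim_seq_plus'; [apply is_lim_seq_minus'|]; auto. }
  assert (HB0 : 0 <= B) by (pose proof (in_cube_nonneg _ _ (Hw0 0)); lra).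
  set (A := C + 2 * B + K).
  assert (HA : 0 < A) by (unfold A; lra).
  assert (Hz0 : is_lim_seq z 0).
  { apply is_lim_seq_spec; intros eta.
    (* The accumulated defect at time [T] for unit [eps]; dividing by [2 * Q] makes the defect at
       most [eta / 2]. *)
    set (Q := exp (A * T) * (T * (K + 2 * C))).
    assert (HQ : 0 < Q).
    { unfold Q; apply Rmult_lt_0_compat; [apply exp_pos|apply Rmult_lt_0_compat; lra]. }
    set (eps := eta / (2 * Q)).
    assert (Heps : 0 < eps) by (apply Rdiv_lt_0_compat; [apply cond_pos|lra]).
    destruct (dapprox_equicontinuous sys_f B C K Hbd HC HK M T w0 p0 HB HKM HT HTC Hd0 Hw0 Hp0
                Hc0 (Rabs x + 1) eps Heps) as (d & Hd & Hm).
    assert (HdC : 0 < d / C) by (apply Rdiv_lt_0_compat; lra).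
    destruct (proj2 (is_lim_seq_spec mesh 0) mesh_lim (mkposreal _ HdC)) as (N & HN).
    exists N; intros n Hn; specialize (HN n Hn); simpl in HN.
    pose proof (mesh_pos n) as Hmp.
    rewrite Rminus_0_r, Rabs_pos_eq in HN by lra.
    apply Rlt_div_r in HN; [|lra].
    rewrite Rminus_0_r; unfold z, polygon, dpolygon.
    pose proof (index_le T n t Ht) as Hidx.
    set (k := index n t) in *.
    assert (HTC1 := T_C_le C K HC HK T HT HTC).
    assert (Hkh : 0 <= INR k * mesh n) by (apply Rmult_le_pos; [apply pos_INR|lra]).
    eapply Rle_lt_trans.
    - apply (defect_approx (Rabs x + 1) d eps); try lra.
      + intros j Hj; apply Hm; auto; lra.
      + assert (INR k * mesh n * C <= T * C) by (apply Rmult_le_compat_r; lra); lra.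
    - eapply Rle_lt_trans.
      + apply (growth_mono _ _ _ _ T); [unfold A in HA; lra|lra|apply Rmult_le_pos; lra|lra].
      + unfold growth; fold A.
        replace (exp (A * T) * (0 + T * (eps * (K + 2 * C)))) with (eta / 2)
            by (unfold eps, Q; field; pose proof (exp_pos (A * T)); repeat split; lra).
        pose proof (cond_pos eta); lra. }
  pose proof (is_lim_seq_unique _ _ Hz) as U1; pose proof (is_lim_seq_unique _ _ Hz0) as U2.
  rewrite U1 in U2; injection U2; lra.
Qed.

End Defect.

Definition constraint (w p : field) : Prop := forall x, p Vel x = w En x - w Rho x.

(** The time is chosen before the data and depends on [M] only; the restart close to [T1] relies on
    this order of quantifiers. *)
Lemma local_existence (M : R) : 0 <= M -> exists T, 0 < T /\
  forall w0 p0, derivative_of w0 p0 -> bounded_by M w0 -> bounded_by M p0 ->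
    (forall i x, continuous (p0 i) x) -> constraint w0 p0 ->
    exists W Wx, C1_solution sys_f T W Wx /\ (forall i x, W 0 i x = w0 i x) /\
      forall t, in_strip T t ->
        bounded_by (M + 1) (W t) /\ bounded_by (M + 1) (Wx t) /\ constraint (W t) (Wx t).
Proof.
  intros HM.
  destruct (ex_system_bounds sys_f (M + 1)) as (C & HC & Hbd).
  set (K := M + 1); assert (HK : 1 <= K) by (unfold K; lra).
  assert (HQ : 0 < C * K * (K + 1)) by (repeat apply Rmult_lt_0_compat; lra).
  set (T := / (C * K * (K + 1))).
  assert (HT : 0 < T) by (apply Rinv_0_lt_compat; auto).
  assert (HTC : T * (C * K * (K + 1)) <= 1) by (unfold T; rewrite Rinv_l; lra).
  exists T; split; auto.
  intros w0 p0 Hd0 Hw0 Hp0 Hc0 Hdef.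
  exists (sol sys_f w0), (dsol sys_f w0); split; [|split].
  - apply (scheme_C1_solution sys_f (M + 1) C K M T w0 p0); auto.
  - intros i x; apply sol_0.
  - unfold in_strip; intros t Ht; split; [|split].
    + apply (sol_good sys_f (M + 1) C K Hbd HC HK M T w0 p0); auto; lra.
    + apply (dsol_bounded sys_f (M + 1) C K Hbd HC HK M T w0 p0); auto; lra.
    + intros x; apply (defect_sol (M + 1) C K Hbd HC HK M T w0 p0); auto; lra.
Qed.

Lemma lipschitz_derivative_le (g : R -> R) (x l L : R) :
  0 <= L -> (forall y, Rabs (g y - g x) <= L * Rabs (y - x)) -> is_derive g x l -> Rabs l <= L.
Proof.
  intros HL Hg Hd; apply Rnot_lt_le; intros Hlt.
  apply is_derive_Reals in Hd.
  destruct (Hd (Rabs l - L)) as (d & H); [lra|].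
  pose proof (cond_pos d) as Hdp.
  specialize (H (d / 2)); rewrite (Rabs_pos_eq (d / 2)) in H by lra.
  specialize (H ltac:(lra) ltac:(lra)).
  specialize (Hg (x + d / 2)); replace (x + d / 2 - x) with (d / 2) in Hg by ring.
  rewrite (Rabs_pos_eq (d / 2)) in Hg by lra.
  assert (Hq : Rabs ((g (x + d / 2) - g x) / (d / 2)) <= L).
  { unfold Rdiv at 1; rewrite Rabs_mult, (Rabs_pos_eq (/ (d / 2)))
      by (left; apply Rinv_0_lt_compat; lra).
    apply Rmult_le_reg_r with (d / 2); [lra|].
    rewrite Rmult_assoc, Rinv_l by lra; lra. }
  pose proof (Rabs_triang ((g (x + d / 2) - g x) / (d / 2))
                (- ((g (x + d / 2) - g x) / (d / 2) - l))) as Ht.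
  rewrite Rabs_Ropp in Ht.
  replace ((g (x + d / 2) - g x) / (d / 2) + - ((g (x + d / 2) - g x) / (d / 2) - l))
    with l in Ht by ring.
  lra.
Qed.

(* A bound on e_x for positive times is not assumed: the Lipschitz constant at time 0 is transported
   along the scheme, with an additive error that vanishes with the step. *)
Lemma energy_gradient_bound (B C K L T : R) (W Wx : R -> field) :
  system_bounds sys_f B C -> 0 < C -> 0 <= K -> 0 <= L -> C1_solution sys_f T W Wx ->
  (forall t, in_strip T t -> bounded_by B (W t)) ->
  (forall t x i, in_strip T t -> i <> En -> Rabs (Wx t i x) <= K) ->
  (forall x, Rabs (Wx 0 En x) <= L) ->
  forall t x, in_strip T t -> Rabs (Wx t En x) <= growth (K + C) L (C * K) t.
Proof.
  intros Hbd HC HK HL HW HB Hx HL0 t x0 Ht.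
  set (A := K + C); assert (HA : 0 < A) by (unfold A; lra).
  assert (HCK : 0 <= C * K) by nra.
  unfold in_strip in Ht.
  apply (lipschitz_derivative_le (W t En) x0);
    [apply growth_nonneg; lra| |apply (sol_dx _ _ _ _ HW); auto].
  intros y0.
  assert (Hlip : forall t i, in_strip T t -> i <> En -> forall x y,
            Rabs (W t i x - W t i y) <= K * Rabs (x - y)).
  { intros t' i Ht' Hi x y.
    destruct (mean_value (W t' i) (Wx t' i) y x) as (c & _ & ->).
    - intros z; apply (sol_dx _ _ _ _ HW); auto.
    - apply Rabs_mult_le; [auto|lra]. }
  assert (Hlip0 : forall x y, Rabs (W 0 En x - W 0 En y) <= L * Rabs (x - y)).
  { intros x y.
    destruct (mean_value (W 0 En) (Wx 0 En) y x) as (c & _ & ->).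
    - intros z; apply (sol_dx _ _ _ _ HW); unfold in_strip; lra.
    - apply Rabs_mult_le; [auto|lra]. }
  destruct (Rle_lt_or_eq_dec 0 t (proj1 Ht)) as [Htp|<-]; [|rewrite growth_0; auto].
  set (G := growth A L (C * K) t * Rabs (y0 - x0)).
  assert (Heps : forall eps, 0 < eps ->
     Rabs (W t En y0 - W t En x0) <= G + exp (A * t) * (t * (2 * eps))).
  { intros eps He.
    set (r := Rmax (Rabs x0) (Rabs y0) + t * C).
    destruct (solution_tangent sys_f T t r C eps W Wx HW Ht) as (d & Hd & Htan); [lra|auto|].
    destruct (nfloor_ex (t / d)) as (n & _ & Hn).
    { left; apply Rdiv_lt_0_compat; auto. }
    rewrite <- S_INR in Hn; set (N := S n) in *.
    assert (HN : 0 < INR N) by (apply lt_0_INR; unfold N; lia).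
    set (s := t / INR N).
    assert (Hs : 0 < s) by (apply Rdiv_lt_0_compat; auto).
    assert (Hsd : s < d).
    { apply Rlt_div_l in Hn; [|auto]; apply Rlt_div_l; [auto|lra]. }
    assert (HNs : INR N * s = t) by (unfold s; field; lra).
    assert (Hind : forall k, (k <= N)%nat -> forall x y,
      Rabs x <= r - INR k * s * C -> Rabs y <= r - INR k * s * C ->
      Rabs (W (INR k * s) En x - W (INR k * s) En y)
        <= growth A L (C * K) (INR k * s) * Rabs (x - y) + growth A 0 (2 * eps) (INR k * s)).
    { induction k as [|k IH]; intros Hk x y Hxr Hyr.
      - simpl; rewrite Rmult_0_l, !growth_0, Rplus_0_r; auto.
      - specialize (IH ltac:(lia)).
        assert (HkN : INR (S k) <= INR N) by (apply le_INR; auto).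
        rewrite S_INR in *.
        pose proof (pos_INR k).
        replace ((INR k + 1) * s) with (INR k * s + s) in * by ring.
        assert (0 <= INR k * s) by nra.
        assert (INR k * s + s <= t) by nra.
        set (tk := INR k * s) in *.
        assert (Hks : in_strip T tk) by (unfold in_strip; lra).
        assert (HsC : 0 < s * C) by nra.
        assert (HtC : 0 <= tk * C) by nra.
        assert (HBk := HB tk Hks).
        assert (Ex : Rabs (W (tk + s) En x - step sys_f s (W tk) En x) <= s * eps).
        { apply Htan; try lra; apply (lam_le sys_f B C); auto. }
        assert (Ey : Rabs (W (tk + s) En y - step sys_f s (W tk) En y) <= s * eps).
        { apply Htan; try lra; apply (lam_le sys_f B C); auto. }
        set (x' := foot sys_f s (W tk) En x) in *.
        set (y' := foot sys_f s (W tk) En y) in *.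
        assert (Hx'r : Rabs x' <= r - tk * C) by (apply (foot_in sys_f B C); auto; lra).
        assert (Hy'r : Rabs y' <= r - tk * C) by (apply (foot_in sys_f B C); auto; lra).
        (* The speed of [En] is u, whose slope is at most [K]; the unknown slope of e does not
           enter, so its growth is linear. *)
        assert (Hxy' : Rabs (x' - y') <= (1 + s * K) * Rabs (x - y)).
        { replace (x' - y') with ((x - y) - s * (W tk Vel x - W tk Vel y))
            by (unfold x', y', foot; simpl lam; unfold at_pt; ring).
          replace ((1 + s * K) * Rabs (x - y)) with (Rabs (x - y) + s * (K * Rabs (x - y))) by ring.
          apply Rabs_minus_le; [lra|].
          apply Rabs_mult_le; [rewrite Rabs_pos_eq; lra|apply Hlip; auto; discriminate]. }
        set (a := growth A L (C * K) tk) in *.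
        set (b := growth A 0 (2 * eps) tk) in *.
        assert (Ha : 0 <= a) by (apply growth_nonneg; lra).
        assert (Hb : 0 <= b) by (apply growth_nonneg; lra).
        set (D := Rabs (x - y)) in *.
        assert (HD : 0 <= D) by apply Rabs_pos.
        assert (I1 : Rabs (W tk En x' - W tk En y') <= a * ((1 + s * K) * D) + b).
        { eapply Rle_trans; [apply IH; auto|].
          apply Rplus_le_compat_r, Rmult_le_compat_l; auto. }
        assert (I2 : Rabs (W tk En x - W tk En y) <= a * D + b) by (apply IH; lra).
        assert (HKD : 0 <= K * D) by nra.
        assert (HaD : 0 <= a * D) by nra.
        assert (Hcl : close (K * D + (a * D + b)) (at_pt (W tk) x) (at_pt (W tk) y)).
        { assert (Hn1 : Rho <> En) by discriminate; assert (Hn2 : Vel <> En) by discriminate.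
          intros []; unfold at_pt.
          - pose proof (Hlip tk Rho Hks Hn1 x y) as Hj; fold D in Hj; lra.
          - pose proof (Hlip tk Vel Hks Hn2 x y) as Hj; fold D in Hj; lra.
          - lra. }
        assert (I3 := src_lip sys_f B C Hbd En _ _ _ (HBk x) (HBk y) Hcl).
        assert (I4 : Rabs (step sys_f s (W tk) En x - step sys_f s (W tk) En y)
                     <= a * ((1 + s * K) * D) + b + s * (C * (K * D + (a * D + b)))).
        { unfold step; fold x' y'.
          match goal with |- Rabs (?p + s * ?q - (?p' + s * ?q')) <= _ =>
            replace (p + s * q - (p' + s * q')) with ((p - p') + s * (q - q')) by ring end.
          apply Rabs_plus_le; auto; apply Rabs_mult_le; [rewrite Rabs_pos_eq; lra|auto]. }
        assert (Ga : (1 + s * A) * a + s * (C * K) <= growth A L (C * K) (tk + s))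
          by (apply growth_step; lra).
        assert (Gb : (1 + s * A) * b + s * (2 * eps) <= growth A 0 (2 * eps) (tk + s))
          by (apply growth_step; lra).
        apply Rle_trans with (((1 + s * A) * a + s * (C * K)) * D + ((1 + s * A) * b + s * (2 * eps)));
          [|apply Rplus_le_compat; [apply Rmult_le_compat_r|]; auto].
        replace (W (tk + s) En x - W (tk + s) En y) with
          ((step sys_f s (W tk) En x - step sys_f s (W tk) En y)
           + ((W (tk + s) En x - step sys_f s (W tk) En x)
              - (W (tk + s) En y - step sys_f s (W tk) En y))) by ring.
        eapply Rle_trans; [apply Rabs_plus_le; [apply I4|apply Rabs_minus_le; [apply Ex|apply Ey]]|].
        assert (0 <= s * K * b) by (apply Rmult_le_pos; [apply Rmult_le_pos; lra|auto]).
        unfold A; lra. }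
    pose proof (Rmax_l (Rabs x0) (Rabs y0)); pose proof (Rmax_r (Rabs x0) (Rabs y0)).
    specialize (Hind N (le_n _) y0 x0); rewrite HNs in Hind.
    eapply Rle_trans; [apply Hind; unfold r; lra|].
    fold G; apply Rplus_le_compat_l; unfold growth; right; ring. }
  apply Rnot_lt_le; intros Hlt.
  change (growth (K + C) L (C * K) t * Rabs (y0 - x0)) with G in Hlt.
  set (Q := exp (A * t) * (t * 4)).
  assert (HQ : 0 < Q) by (unfold Q; apply Rmult_lt_0_compat; [apply exp_pos|lra]).
  set (z := Rabs (W t En y0 - W t En x0) - G) in *.
  assert (Hz : 0 < z) by (unfold z; lra).
  specialize (Heps (z / Q) ltac:(apply Rdiv_lt_0_compat; auto)).
  replace (exp (A * t) * (t * (2 * (z / Q)))) with (z / 2) in Heps; [unfold z in *; lra|].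
  unfold Q; field; pose proof (exp_pos (A * t)); split; lra.
Qed.

(** * Passage between the original system and the diagonal one *)

Lemma flux_derivative (w q : field) (x : R) :
  derivative_of w q ->
  is_derive (fun y => w Rho y * f (w Rho y) (w Vel y)) x
    (q Rho x * f (w Rho x) (w Vel x)
     + w Rho x * (f1 (w Rho x) (w Vel x) * q Rho x + f2 (w Rho x) (w Vel x) * q Vel x)).
Proof.
  intros Hd.
  exact (proj1 (proj2 (regular_mult _ _ _ _ (regular_coord Rho) Rf)) w x (at_pt q x)
           (fun j => Hd j x)).
Qed.

Lemma C1_strip_of_solution (T : R) (W Wx : R -> field) (i : unknown) (g : R -> R -> R) :
  C1_solution sys_f T W Wx -> (forall t x, in_strip T t -> g t x = W t i x) -> C1_strip T g.
Proof.
  intros HW Hg.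
  exists (fun t x => velocity sys_f (W t) (Wx t) i x), (fun t x => Wx t i x).
  split; [|split; [|split; [|split]]].
  - intros t x Ht.
    apply has_dt_transfer with (T' := T) (a := 0) (eta := 1) (g' := fun t y => W t i y); auto; [lra| |].
    + intros t' Ht' _; rewrite Rminus_0_r; auto.
    + rewrite Rminus_0_r; apply (sol_dt _ _ _ _ HW); auto.
  - intros t x Ht; apply is_derive_ext with (W t i); [intros y; symmetry; auto|].
    apply (sol_dx _ _ _ _ HW); auto.
  - apply cont_strip_transfer; intros t Ht.
    exists T, 0, 1, (fun t x => W t i x); split; [lra|split; [apply (sol_cont _ _ _ _ HW)|]].
    intros t' Ht' _; rewrite Rminus_0_r; auto.
  - apply sol_cont_dt with (1 := HW).
  - apply (sol_cont_dx _ _ _ _ HW).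
Qed.

(** The constraint turns the source of [Rho] back into the flux derivative and identifies [En] with
    [e_of]. *)
Lemma classical_of_C1_solution (rho0 u0 : R -> R) (T M : R) (W Wx : R -> field) :
  C1_solution sys_f T W Wx ->
  (forall t, in_strip T t ->
     bounded_by M (W t) /\ bounded_by M (Wx t) /\ constraint (W t) (Wx t)) ->
  (forall x, W 0 Rho x = rho0 x) -> (forall x, W 0 Vel x = u0 x) ->
  classical_solution f rho0 u0 T (fun t => W t Rho) (fun t => W t Vel) /\
  C1_strip T (e_of (fun t => W t Rho) (fun t => W t Vel)).
Proof.
  intros HW Hb H0r H0u.
  assert (HD : forall t i x, in_strip T t -> Derive (W t i) x = Wx t i x).
  { intros t i x Ht; apply is_derive_unique, (sol_dx _ _ _ _ HW); auto. }
  split.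
  - repeat split; auto.
    + apply (C1_strip_of_solution T W Wx Rho); auto.
    + apply (C1_strip_of_solution T W Wx Vel); auto.
    + intros t x Ht.
      exists (velocity sys_f (W t) (Wx t) Rho x).
      eexists; split; [apply (sol_dt _ _ _ _ HW t x Rho Ht)|split].
      * apply flux_derivative, (sol_dx _ _ _ _ HW); auto.
      * destruct (Hb t Ht) as (_ & _ & Hcs); specialize (Hcs x).
        unfold velocity; simpl; unfold at_pt; rewrite Hcs; ring.
    + intros t x Ht.
      exists (velocity sys_f (W t) (Wx t) Vel x), (Wx t Vel x).
      split; [apply (sol_dt _ _ _ _ HW t x Vel Ht)|split].
      * apply (sol_dx _ _ _ _ HW); auto.
      * unfold velocity; simpl; unfold at_pt; ring.
    + intros t1 Ht1; exists M; intros t x Ht.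
      assert (Hts : in_strip T t) by (unfold in_strip; lra).
      destruct (Hb t Hts) as (B1 & B2 & _).
      rewrite !HD by auto.
      repeat split; [apply (B1 x Rho)|apply (B1 x Vel)|apply (B2 x Rho)|apply (B2 x Vel)].
  - apply (C1_strip_of_solution T W Wx En); auto.
    intros t x Ht; unfold e_of; rewrite HD by auto.
    destruct (Hb t Ht) as (_ & _ & Hcs); rewrite Hcs; ring.
Qed.

(** The space argument of the difference is a dummy, which allows values of functions at two
    different points to be subtracted. *)
Lemma has_dt_minus (T : R) (g1 g2 : R -> R -> R) (t x1 x2 v1 v2 : R) :
  has_dt T g1 t x1 v1 -> has_dt T g2 t x2 v2 ->
  has_dt T (fun t' _ => g1 t' x1 - g2 t' x2) t 0 (v1 - v2).
Proof.
  intros H1 H2 eps He.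
  destruct (H1 (eps / 2)) as (d1 & P1 & Q1); [lra|].
  destruct (H2 (eps / 2)) as (d2 & P2 & Q2); [lra|].
  exists (Rmin d1 d2); split; [apply Rmin_glb_lt; auto|].
  intros h Hh0 Hth Hh; pose proof (Rmin_l d1 d2); pose proof (Rmin_r d1 d2).
  specialize (Q1 h Hh0 Hth ltac:(lra)); specialize (Q2 h Hh0 Hth ltac:(lra)).
  match goal with |- Rabs ?e < _ => replace e with
    (((g1 (t + h) x1 - g1 t x1) / h - v1) - ((g2 (t + h) x2 - g2 t x2) / h - v2))
    by (field; auto) end.
  eapply Rle_lt_trans; [apply Rabs_minus_le; apply Rle_refl|lra].
Qed.

(** As [t < T], small positive increments are always admissible, so even a one-sided derivative is
    determined. *)
Lemma has_dt_unique (T : R) (g : R -> R -> R) (t x v v' : R) :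
  in_strip T t -> has_dt T g t x v -> has_dt T g t x v' -> v = v'.
Proof.
  unfold in_strip; intros Ht H H'.
  apply Rminus_diag_uniq, Rabs_eq_0, Rle_antisym; [|apply Rabs_pos].
  apply Rnot_lt_le; intros Hlt.
  destruct (H (Rabs (v - v') / 2)) as (d & Hd & Q); [lra|].
  destruct (H' (Rabs (v - v') / 2)) as (d' & Hd' & Q'); [lra|].
  set (m := Rmin (T - t) (Rmin d d')).
  assert (Hm : 0 < m) by (unfold m; repeat apply Rmin_glb_lt; lra).
  pose proof (Rmin_l (T - t) (Rmin d d')); pose proof (Rmin_r (T - t) (Rmin d d')).
  pose proof (Rmin_l d d'); pose proof (Rmin_r d d').
  fold m in H0, H1.
  assert (Hts : in_strip T (t + m / 2)) by (unfold in_strip; lra).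
  assert (Ha : Rabs (m / 2) = m / 2) by (apply Rabs_pos_eq; lra).
  specialize (Q (m / 2) ltac:(lra) Hts ltac:(lra)).
  specialize (Q' (m / 2) ltac:(lra) Hts ltac:(lra)).
  set (q := (g (t + m / 2) x - g t x) / (m / 2)) in *.
  assert (Rabs (v - v') <= Rabs (q - v') + Rabs (q - v)); [|lra].
  replace (v - v') with ((q - v') - (q - v)) by ring; apply Rabs_minus_le; lra.
Qed.

(* Both sides are values of the same double difference of [g] at points close to (t, x); this also
   covers t = 0, where the t-derivatives are one-sided. *)
Lemma mixed_derivatives (T : R) (g gt gx gtx gxt : R -> R -> R) :
  (forall t x, in_strip T t -> has_dt T g t x (gt t x)) ->
  (forall t x, in_strip T t -> is_derive (g t) x (gx t x)) ->
  (forall t x, in_strip T t -> is_derive (gt t) x (gtx t x)) ->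
  (forall t x, in_strip T t -> has_dt T gx t x (gxt t x)) ->
  cont_strip T gtx -> cont_strip T gxt ->
  forall t x, in_strip T t -> gtx t x = gxt t x.
Proof.
  intros Hgt Hgx Hgtx Hgxt C1 C2 t x Ht.
  apply Rminus_diag_uniq, Rabs_eq_0, Rle_antisym; [|apply Rabs_pos].
  apply Rnot_lt_le; intros Hlt.
  set (eps := Rabs (gtx t x - gxt t x) / 2) in *.
  assert (He : 0 < eps) by (unfold eps; lra).
  destruct (C1 t x Ht eps He) as (d1 & P1 & Q1).
  destruct (C2 t x Ht eps He) as (d2 & P2 & Q2).
  unfold in_strip in *.
  set (s := Rmin (T - t) (Rmin d1 d2) / 2).
  pose proof (Rmin_l (T - t) (Rmin d1 d2)); pose proof (Rmin_r (T - t) (Rmin d1 d2)).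
  pose proof (Rmin_l d1 d2); pose proof (Rmin_r d1 d2).
  assert (Hs : 0 < s).
  { unfold s; assert (0 < Rmin (T - t) (Rmin d1 d2)) by (repeat apply Rmin_glb_lt; lra); lra. }
  assert (HsT : t + s < T) by (unfold s in *; lra).
  assert (Hs1 : s < d1) by (unfold s in *; lra).
  assert (Hs2 : s < d2) by (unfold s in *; lra).
  destruct (has_dt_mean_value T (fun t' _ => g t' (x + s) - g t' x)
    (fun t' _ => gt t' (x + s) - gt t' x) t s 0) as (c & Hc & E1); try lra.
  { intros t' Ht'; apply (has_dt_minus T g g t' (x + s) x); auto. }
  destruct (MVT_cor2 (gt c) (gtx c) x (x + s)) as (y & E2 & Hy); [lra| |].
  { intros z _; apply is_derive_Reals; apply Hgtx; lra. }
  destruct (MVT_cor2 (fun z => g (t + s) z - g t z) (fun z => gx (t + s) z - gx t z) x (x + s))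
    as (y' & E3 & Hy'); [lra| |].
  { intros z _; apply is_derive_Reals.
    apply (is_derive_minus (V := R_NormedModule)); apply Hgx; lra. }
  destruct (has_dt_mean_value T gx gxt t s y') as (c' & Hc' & E4); try lra; auto.
  assert (Heq : gtx c y = gxt c' y').
  { apply Rmult_eq_reg_r with (s * s); [|nra].
    rewrite E2 in E1; rewrite E4 in E3.
    replace (x + s - x) with s in * by ring; lra. }
  assert (F1 : Rabs (gtx c y - gtx t x) < eps).
  { apply Q1; [lra| |]; rewrite Rabs_pos_eq; lra. }
  assert (F2 : Rabs (gxt c' y' - gxt t x) < eps).
  { apply Q2; [lra| |]; rewrite Rabs_pos_eq; lra. }
  assert (Rabs (gtx t x - gxt t x) < eps + eps); [|unfold eps in *; lra].
  replace (gtx t x - gxt t x) with ((gxt c' y' - gxt t x) - (gtx c y - gtx t x)) by lra.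
  eapply Rle_lt_trans; [apply Rabs_minus_le; apply Rle_refl|lra].
Qed.

Definition unknowns (rho u : R -> R -> R) (t : R) : field :=
  fun i => match i with Rho => rho t | Vel => u t | En => e_of rho u t end.

(** The equation for e has to be derived without second derivatives of u as a hypothesis. Since e
    and rho are C^1, u_x = e - rho has a time derivative, and by its equation u_t has an
    x-derivative; equating the two gives e_t. *)
Lemma C1_solution_of_classical (rho0 u0 : R -> R) (T : R) (rho u : R -> R -> R) :
  classical_solution f rho0 u0 T rho u -> C1_strip T (e_of rho u) ->
  exists Wx, C1_solution sys_f T (unknowns rho u) Wx /\
    forall t, in_strip T t -> constraint (unknowns rho u t) (Wx t).
Proof.
  intros ((rt & rx & Hrt & Hrx & Cr & Crt & Crx) & (ut & ux & Hut & Hux & Cu & Cut & Cux)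
          & Heqr & Hequ & _) (et & ex & Het & Hex & Ce & Cet & Cex).
  set (W := unknowns rho u).
  set (Wx := fun t i => match i with Rho => rx t | Vel => ux t | En => ex t end : R -> R).
  assert (Hd : forall t, in_strip T t -> derivative_of (W t) (Wx t)).
  { intros t Ht []; intros x; simpl; auto. }
  assert (HC : forall i, cont_strip T (fun t x => W t i x)) by (intros []; auto).
  assert (HCx : forall i, cont_strip T (fun t x => Wx t i x)) by (intros []; auto).
  assert (Hcs : forall t x, in_strip T t -> ux t x = e_of rho u t x - rho t x).
  { intros t x Ht; unfold e_of; rewrite (is_derive_unique _ _ _ (Hux t x Ht)); ring. }
  assert (Vr : forall t x, in_strip T t -> rt t x = velocity sys_f (W t) (Wx t) Rho x).
  { intros t x Ht.
    destruct (Heqr t x Ht) as (a & b & Ha & Hb & Hab).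
    rewrite (has_dt_unique _ _ _ _ _ _ Ht (Hrt t x Ht) Ha).
    pose proof (is_derive_unique _ _ _ Hb) as E1.
    pose proof (is_derive_unique (fun y => rho t y * f (rho t y) (u t y)) x _
                  (flux_derivative (W t) (Wx t) x (Hd t Ht))) as E2.
    rewrite E1 in E2; simpl in E2.
    unfold velocity; simpl; unfold at_pt, W; simpl.
    rewrite <- (Hcs t x Ht); lra. }
  assert (Vu : forall t x, in_strip T t -> ut t x = velocity sys_f (W t) (Wx t) Vel x).
  { intros t x Ht.
    destruct (Hequ t x Ht) as (a & b & Ha & Hb & Hab).
    rewrite (has_dt_unique _ _ _ _ _ _ Ht (Hut t x Ht) Ha).
    pose proof (is_derive_unique _ _ _ Hb) as E1.
    rewrite (is_derive_unique _ _ _ (Hux t x Ht)) in E1.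
    unfold velocity; simpl; unfold at_pt, W; simpl; rewrite E1; lra. }
  (* The x-derivative of u_t, read off the right-hand side of the second equation. *)
  set (utx := fun t x => dsrc_f Vel (at_pt (W t) x) (at_pt (Wx t) x)
     - (ux t x * (e_of rho u t x - rho t x) + u t x * (ex t x - rx t x))).
  assert (Ve : forall t x, in_strip T t -> et t x = velocity sys_f (W t) (Wx t) En x).
  { intros t x Ht.
    assert (Hmix : utx t x = et t x - rt t x).
    { apply (mixed_derivatives T u (fun t x => src_f Vel (at_pt (W t) x)
               - u t x * (e_of rho u t x - rho t x)) (fun t x => e_of rho u t x - rho t x)
               utx (fun t x => et t x - rt t x)); auto.
      - intros t' x' Ht'.
        replace (src_f Vel (at_pt (W t') x') - u t' x' * (e_of rho u t' x' - rho t' x'))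
          with (ut t' x'); auto.
        rewrite Vu by auto; unfold velocity; simpl; rewrite Hcs by auto; reflexivity.
      - intros t' x' Ht'; rewrite <- Hcs by auto; auto.
      - intros t' x' Ht'; unfold utx.
        apply (is_derive_minus (V := R_NormedModule)).
        + apply (proj1 (proj2 (src_f_regular Vel))); intros j; apply (Hd t' Ht' j x').
        + apply (is_derive_mult (u t') (fun y => e_of rho u t' y - rho t' y)); auto.
          * apply (is_derive_minus (V := R_NormedModule)); auto.
          * intros; apply Rmult_comm.
      - intros t' x' Ht' eps He.
        destruct (has_dt_minus T _ _ t' x' x' _ _ (Het t' x' Ht') (Hrt t' x' Ht') eps He)
          as (d & Hdp & H); exists d; split; auto.
      - assert (CF : forall g, cont2 g -> cont_strip T (fun t' x' => g (rho t' x') (u t' x')))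
          by (intros g Hg; apply cont_strip_comp2; auto).
        apply (cont_strip_minus T
          (fun t x => rx t x * (f (rho t x) (u t x) - u t x)
             + rho t x * (f1 (rho t x) (u t x) * rx t x + f2 (rho t x) (u t x) * ux t x - ux t x))
          (fun t x => ux t x * (e_of rho u t x - rho t x) + u t x * (ex t x - rx t x))).
        + apply cont_strip_plus; apply cont_strip_mult; auto; apply cont_strip_minus; auto.
          apply cont_strip_plus; apply cont_strip_mult; auto.
        + apply cont_strip_plus; apply cont_strip_mult; auto; apply cont_strip_minus; auto.
      - apply cont_strip_minus; auto. }
    unfold utx in Hmix; rewrite Vr in Hmix by auto.
    unfold velocity in *; simpl in *; unfold at_pt, W in *; simpl in *.
    rewrite Hcs in Hmix by auto; lra. }
  exists Wx; split; [split; auto|].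
  - intros t x [] Ht; [rewrite <- Vr|rewrite <- Vu|rewrite <- Ve]; auto.
  - intros t Ht x; apply Hcs; auto.
Qed.

Lemma bounded_fun_nonneg (g : R -> R) : bounded_fun g -> exists M, 0 <= M /\ forall x, Rabs (g x) <= M.
Proof.
  intros (M & HM); exists M; split; auto.
  apply Rle_trans with (2 := HM 0), Rabs_pos.
Qed.

(** * Existence and continuation for the given data *)

Section InitialData.

Context (rho0 u0 rho1 u1 u2 : R -> R).
Context (Hr1 : forall x, is_derive rho0 x (rho1 x)) (Cr1 : forall x, continuous rho1 x).
Context (Hu1 : forall x, is_derive u0 x (u1 x)) (Hu2 : forall x, is_derive u1 x (u2 x)).
Context (Cu2 : forall x, continuous u2 x).
Context (Br0 : bounded_fun rho0) (Br1 : bounded_fun rho1).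
Context (Bu0 : bounded_fun u0) (Bu1 : bounded_fun u1) (Bu2 : bounded_fun u2).

Lemma classical_existence :
  exists T, 0 < T /\ exists rho u : R -> R -> R,
    classical_solution f rho0 u0 T rho u /\ C1_strip T (e_of rho u).
Proof.
  destruct (bounded_fun_nonneg _ Br0) as (a0 & P0 & Q0);
    destruct (bounded_fun_nonneg _ Br1) as (a1 & P1 & Q1).
  destruct (bounded_fun_nonneg _ Bu0) as (b0 & R0 & S0);
    destruct (bounded_fun_nonneg _ Bu1) as (b1 & R1 & S1);
    destruct (bounded_fun_nonneg _ Bu2) as (b2 & R2 & S2).
  set (M := a0 + a1 + b0 + b1 + b2).
  set (w0 := fun i => match i with Rho => rho0 | Vel => u0 | En => fun x => u1 x + rho0 x end).
  (* Here the second derivative of the initial velocity is spent, as part of the slope of e. *)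
  set (p0 := fun i => match i with Rho => rho1 | Vel => u1 | En => fun x => u2 x + rho1 x end).
  destruct (local_existence M) as (T & HT & Hex); [unfold M; lra|].
  destruct (Hex w0 p0) as (W & Wx & HW & H0 & Hb).
  - intros []; simpl; auto; intros x.
    apply (is_derive_plus (V := R_NormedModule)); auto.
  - intros x []; unfold at_pt, M; simpl.
    + specialize (Q0 x); lra.
    + specialize (S0 x); lra.
    + eapply Rle_trans; [apply Rabs_plus_le; auto|lra].
  - intros x []; unfold at_pt, M; simpl.
    + specialize (Q1 x); lra.
    + specialize (S1 x); lra.
    + eapply Rle_trans; [apply Rabs_plus_le; auto|lra].
  - intros []; simpl; auto; intros x.
    + apply (ex_derive_continuous u1); exists (u2 x); auto.
    + apply (continuous_plus (V := R_NormedModule)); auto.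
  - intros x; simpl; ring.
  - exists T; split; auto.
    exists (fun t => W t Rho), (fun t => W t Vel).
    apply (classical_of_C1_solution rho0 u0 T (M + 1) W Wx); auto; intros x; apply H0.
Qed.

Lemma classical_continuation (T1 : R) (rho u : R -> R -> R) :
  0 < T1 -> classical_solution f rho0 u0 T1 rho u -> C1_strip T1 (e_of rho u) ->
  (exists M, forall t x, 0 <= t < T1 ->
     Rabs (rho t x) <= M /\ Rabs (u t x) <= M /\
     Rabs (Derive (rho t) x) <= M /\ Rabs (Derive (u t) x) <= M) ->
  exists T2 (rho' u' : R -> R -> R), T1 < T2 /\
    classical_solution f rho0 u0 T2 rho' u' /\ C1_strip T2 (e_of rho' u') /\
    (forall t x, 0 <= t < T1 -> rho' t x = rho t x /\ u' t x = u t x).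
Proof.
  intros HT1 Hcl He (M & HM).
  assert (HT1s : in_strip T1 0) by (unfold in_strip; lra).
  assert (HM0 : 0 <= M).
  { destruct (HM 0 0) as (H & _); [lra|]; pose proof (Rabs_pos (rho 0 0)); lra. }
  destruct (C1_solution_of_classical _ _ _ _ _ Hcl He) as (Ux & HU & Hcs).
  set (U := unknowns rho u) in *.
  destruct Hcl as (_ & _ & _ & _ & H0r & H0u & _).
  assert (HUb : forall t, in_strip T1 t -> bounded_by (2 * M) (U t)).
  { intros t Ht x i; destruct (HM t x Ht) as (h1 & h2 & h3 & h4).
    destruct i; unfold at_pt, U, unknowns; simpl; [lra|lra|].
    (* Both u_x and rho are bounded by [M], hence e by twice that. *)
    unfold e_of; replace (2 * M) with (M + M) by ring; apply Rabs_plus_le; auto. }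
  assert (HUx : forall t x i, in_strip T1 t -> i <> En -> Rabs (Ux t i x) <= M).
  { intros t x i Ht Hi; destruct (HM t x Ht) as (h1 & h2 & h3 & h4).
    rewrite <- (is_derive_unique _ _ _ (sol_dx _ _ _ _ HU t Ht i x)).
    destruct i; auto; contradiction. }
  destruct (bounded_fun_nonneg _ Br1) as (a1 & P1 & Q1);
    destruct (bounded_fun_nonneg _ Bu2) as (b2 & R2 & S2).
  (* The initial slope of e is not controlled by [M]; it is bounded through the data. *)
  assert (HU0 : forall x, Rabs (Ux 0 En x) <= a1 + b2).
  { intros x.
    replace (Ux 0 En x) with (u2 x + rho1 x); [eapply Rle_trans; [apply Rabs_plus_le; auto|lra]|].
    rewrite <- (is_derive_unique _ _ _ (sol_dx _ _ _ _ HU 0 HT1s En x)).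
    symmetry; apply is_derive_unique.
    apply is_derive_ext with (fun y => u1 y + rho0 y).
    - intros y; unfold U, unknowns, e_of; rewrite H0r; f_equal.
      symmetry; apply is_derive_unique, is_derive_ext with u0; auto.
    - apply (is_derive_plus (V := R_NormedModule)); auto. }
  destruct (ex_system_bounds sys_f (2 * M)) as (C0 & HC0 & Hbd0).
  set (L := growth (M + C0) (a1 + b2) (C0 * M) T1).
  assert (HL0 : 0 <= L) by (apply growth_nonneg; nra).
  assert (HUe : forall t x, in_strip T1 t -> Rabs (Ux t En x) <= L).
  { intros t x Ht; eapply Rle_trans.
    - apply (energy_gradient_bound (2 * M) C0 M (a1 + b2) T1 U Ux); auto; lra.
    - unfold in_strip in Ht; apply growth_mono; nra. }
  set (M' := 2 * M + L).
  assert (HM' : 0 <= M') by (unfold M'; lra).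
  assert (HUb' : forall t, in_strip T1 t -> bounded_by M' (U t)).
  { intros t Ht x i; specialize (HUb t Ht x i); unfold M'; lra. }
  assert (HUxb : forall t, in_strip T1 t -> bounded_by M' (Ux t)).
  { intros t Ht x i; unfold at_pt, M'.
    destruct i; [specialize (HUx t x Rho Ht ltac:(discriminate))
      |specialize (HUx t x Vel Ht ltac:(discriminate))|specialize (HUe t x Ht)]; lra. }
  destruct (local_existence M' HM') as (d & Hd & Hex).
  (* Restarting within [d / 2] of [T1], but not before time 0, lets the lifespan [d] reach past
     [T1]. *)
  set (t0 := Rmax 0 (T1 - d / 2)).
  assert (Ht0 : 0 <= t0 < T1) by (split; [apply Rmax_l|apply Rmax_lub_lt; lra]).
  assert (Ht0d : T1 < t0 + d) by (pose proof (Rmax_r 0 (T1 - d / 2)); unfold t0; lra).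
  destruct (Hex (U t0) (Ux t0)) as (V & Vx & HV & HV0 & HVb); auto.
  - apply (sol_dx _ _ _ _ HU); auto.
  - intros i x; apply filterlim_locally; intros eps.
    destruct (sol_cont_dx _ _ _ _ HU i t0 x Ht0 eps (cond_pos eps)) as (dl & Hdl & Hc).
    exists (mkposreal dl Hdl); intros y Hy; apply Hc; auto.
    rewrite Rminus_diag, Rabs_R0; auto.
  - destruct (ex_system_bounds sys_f (M' + 1)) as (C & HC & Hbd).
    assert (Hsub : forall t, in_strip (T1 - t0) t -> in_strip T1 (t0 + t) /\ in_strip d t)
      by (unfold in_strip; intros; lra).
    assert (Huniq : forall t i x, in_strip (T1 - t0) t -> U (t0 + t) i x = V t i x).
    { apply (solution_unique sys_f (M' + 1) C (M' + 1) (T1 - t0) (fun t => U (t0 + t))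
               (fun t => Ux (t0 + t)) V Vx); auto; [lra| | | | |].
      - apply (C1_solution_shift sys_f T1); auto; lra.
      (* A shift by 0 restricts the new solution to the overlap. *)
      - replace V with (fun t => V (0 + t)) by (apply functional_extensionality; intros; f_equal; ring).
        replace Vx with (fun t => Vx (0 + t))
          by (apply functional_extensionality; intros; f_equal; ring).
        apply (C1_solution_shift sys_f d); auto; lra.
      - intros t Ht; destruct (Hsub t Ht) as (Hs1 & _); split.
        + intros x i; specialize (HUb' _ Hs1 x i); lra.
        + apply derivative_lipschitz with (Ux (t0 + t)); [apply (sol_dx _ _ _ _ HU); auto|].
          intros x i; specialize (HUxb _ Hs1 x i); lra.
      - intros t Ht; destruct (Hsub t Ht) as (_ & Hs2); destruct (HVb t Hs2) as (B1 & B2 & _).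
        split; auto.
        apply derivative_lipschitz with (Vx t); [apply (sol_dx _ _ _ _ HV)|]; auto.
      - intros i x; rewrite Rplus_0_r, HV0; auto. }
    assert (HG := C1_solution_glue sys_f T1 t0 d U Ux V Vx Ht0 Ht0d HU HV).
    set (G := fun t => if Rlt_dec t T1 then U t else V (t - t0)) in *.
    set (Gx := fun t => if Rlt_dec t T1 then Ux t else Vx (t - t0)) in *.
    assert (HG' : C1_solution sys_f (t0 + d) G Gx).
    { apply HG; intros t i x Ht.
      rewrite <- Huniq by (unfold in_strip; lra); f_equal; ring. }
    assert (HGU : forall t, t < T1 -> G t = U t).
    { intros t Ht; unfold G; destruct (Rlt_dec t T1); [auto|lra]. }
    destruct (classical_of_C1_solution rho0 u0 (t0 + d) (M' + 1) G Gx HG') as (K1 & K2).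
    + intros t Ht; unfold in_strip in Ht; unfold G, Gx; destruct (Rlt_dec t T1).
      * assert (Hts : in_strip T1 t) by (unfold in_strip; lra).
        repeat split; auto; intros x i;
          [specialize (HUb' t Hts x i)|specialize (HUxb t Hts x i)]; lra.
      * apply HVb; unfold in_strip; lra.
    + intros x; rewrite HGU by auto; apply H0r.
    + intros x; rewrite HGU by auto; apply H0u.
    + exists (t0 + d), (fun t => G t Rho), (fun t => G t Vel).
      split; [auto|split; [auto|split; [auto|]]].
      intros t x Ht; rewrite HGU by lra; auto.
Qed.

End InitialData.

End Pressureless.

Theorem theorem2 :
  forall (f : R -> R -> R) (rho0 u0 : R -> R),
    smooth2 f -> C1b rho0 -> C2b u0 -> (forall x, 0 <= rho0 x) ->
    (* local existence, with e = u_x + rho in C^1 *)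
    (exists T, 0 < T /\ exists rho u : R -> R -> R,
        classical_solution f rho0 u0 T rho u /\ C1_strip T (e_of rho u)) /\
    (* continuation criterion *)
    (forall (T1 : R) (rho u : R -> R -> R),
        0 < T1 ->
        classical_solution f rho0 u0 T1 rho u -> C1_strip T1 (e_of rho u) ->
        (exists M, forall t x, 0 <= t < T1 ->
           Rabs (rho t x) <= M /\ Rabs (u t x) <= M /\
           Rabs (Derive (rho t) x) <= M /\ Rabs (Derive (u t) x) <= M) ->
        exists T2 (rho' u' : R -> R -> R), T1 < T2 /\
          classical_solution f rho0 u0 T2 rho' u' /\ C1_strip T2 (e_of rho' u') /\
          (forall t x, 0 <= t < T1 -> rho' t x = rho t x /\ u' t x = u t x)).
Proof.
  intros f rho0 u0 Hf (rho1 & Hr1 & Cr1 & Br0 & Br1)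
    (u1 & u2 & Hu1 & Hu2 & Cu2 & Bu0 & Bu1 & Bu2) _.
  (* Speeds and sources contain first derivatives of [f], and their gradients must be locally
     Lipschitz, so three derivatives are drawn. *)
  destruct (Hf 3%nat) as (Cf & f1 & f2 & Hf1 & Hf2 & K1 & K2).
  pose proof (Ck2_S 1 f1 K1) as J1; pose proof (Ck2_S 1 f2 K2) as J2.
  destruct K1 as (Cf1 & f11 & f12 & H11 & H12 & K11 & K12).
  destruct K2 as (Cf2 & f21 & f22 & H21 & H22 & K21 & K22).
  assert (Rf := regular_Ck2 f f1 f2 Cf Hf1 Hf2 J1 J2).
  assert (Rf1 := regular_Ck2 f1 f11 f12 Cf1 H11 H12 K11 K12).
  assert (Rf2 := regular_Ck2 f2 f21 f22 Cf2 H21 H22 K21 K22).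
  split.
  - apply (classical_existence f f1 f2 f11 f12 f21 f22 Rf Rf1 Rf2 rho0 u0 rho1 u1 u2); auto.
  - apply (classical_continuation f f1 f2 f11 f12 f21 f22 Cf Cf1 Cf2 Rf Rf1 Rf2
             rho0 u0 rho1 u1 u2); auto.
Qed.
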